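(* Let $\Delta$ be a finite simplicial complex with $\operatorname{depth}\Delta=d-1$, and let $r$ be an integer with $2\le r\le (d+1)/2$. Let $\mathcal{A},\mathcal{B}$ be nonempty cross-intersecting families, where $\mathcal{A}$ consists of $(r-1)$-element faces of $\Delta$ and $\mathcal{B}$ consists of $r$-element faces of $\Delta$, and suppose $\partial\mathcal{B}\subseteq\mathcal{A}$. If $\Delta$ is shifted with respect to $\{v_1<\cdots<v_r\}$, then \[|\mathcal{A}|+|\mathcal{B}|\le f_{r-1}(\Delta)-\gamma+1,\] where $\gamma$ is the number of $(r-1)$-element faces of $\Delta$ containing no element of $\{v_1,\dots,v_r\}$.
   Context: A simplicial complex is a nonempty finite family of sets closed under subsets; $f_k(\Delta)$ is the number of $k$-element faces; $\operatorname{link}_\Delta A=\{B\in\Delta:A\cap B=\emptyset,A\cup B\in\Delta\}$. Fix a field $\mathbb{F}$. A complex $\Gamma$ is Cohen-Macaulay if $\tilde H_i(\operatorname{link}_\Gamma A;\mathbb{F})=0$ for all faces $A$ (including $\emptyset$) and all $i<\dim\operatorname{link}_\Gamma A$ (a face $A$ has dimension $|A|-1$). The depth of $\Delta$ is the largest $k$ such that the subcomplex of faces of dimension at most $k$ is Cohen-Macaulay. $\Delta$ is shifted with respect to $\{v_1<\cdots<v_t\}$ if for every $i\le t$, every face $B$, and every $w\in B$ with $w\notin\{v_1,\dots,v_i\}$ and $v_i\notin B$, the set $(B\setminus\{w\})\cup\{v_i\}$ is a face. Families $\mathcal{A},\mathcal{B}$ are cross-intersecting if $A\cap B\ne\emptyset$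 for all $A\in\mathcal{A},B\in\mathcal{B}$. The shadow $\partial\mathcal{B}$ of a family of $r$-element sets is the family of all $(r-1)$-element sets contained in at least one member of $\mathcal{B}$. *)

(* Defs.v *)
From mathcomp Require Import all_boot all_order all_algebra.
Set Implicit Arguments. Unset Strict Implicit. Unset Printing Implicit Defensive.
Import GRing.Theory.
Local Open Scope ring_scope.

Section SC.
Variable T : finType.

Definition simplicial_complex (D : {set {set T}}) : Prop :=
  D != set0 /\ forall A B : {set T}, A \in D -> B \subset A -> B \in D.

Definition fnum (D : {set {set T}}) (k : nat) : nat :=
  #|[set A in D | #|A| == k]|.

Definition link (D : {set {set T}}) (A : {set T}) : {set {set T}} :=
  [set B in D | [disjoint A & B] && (A :|: B \in D)].

(* largest face size = dimension + 1 *)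
Definition maxsize (D : {set {set T}}) : nat := (\max_(A in D) #|A|)%N.

(* faces of size <= e, i.e. of dimension <= e - 1 *)
Definition skel (D : {set {set T}}) (e : nat) : {set {set T}} :=
  [set A in D | #|A| <= e]%N.

Variable F : fieldType.

(* incidence coefficient [A : B] of the oriented simplicial boundary, vertices
   ordered by enum_rank; the removed vertex x gets sign (-1)^(#vertices of A below x) *)
Definition incid (A B : {set T}) : F :=
  if (B \subset A) && (#|A| == #|B|.+1)%N
  then (-1) ^+ #|[set y in A | [exists x in A :\: B, (enum_rank y < enum_rank x)%N]]|
  else 0.

Definition chain_on (D : {set {set T}}) (k : nat) (c : {set T} -> F) : Prop :=
  forall A, c A != 0 -> (A \in D) && (#|A| == k)%N.

Definition bd (c : {set T} -> F) (B : {set T}) : F :=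
  \sum_(A : {set T}) c A * incid A B.

(* reduced homology in dimension k - 1 (chains on k-element faces) vanishes:
   every cycle is a boundary.  k = 0 is reduced homology in degree -1
   (the empty face, with the augmentation map). *)
Definition homology_vanishes (D : {set {set T}}) (k : nat) : Prop :=
  forall c, chain_on D k c -> (forall B, bd c B = 0) ->
  exists2 e, chain_on D k.+1 e & forall A, bd e A = c A.

(* Cohen-Macaulay over F: H~_i(link A) = 0 for all faces A and all
   i < dim link A; with k = i + 1 this is k < maxsize (link A). *)
Definition cohen_macaulay (D : {set {set T}}) : Prop :=
  forall A, A \in D -> forall k, (k < maxsize (link D A))%N ->
    homology_vanishes (link D A) k.

(* depth D = d - 1 : the (d-1)-skeleton is CM, d - 1 <= dim D, and no
   larger skeleton of dimension <= dim D is CM *)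
Definition depth_is (D : {set {set T}}) (d : nat) : Prop :=
  [/\ (d <= maxsize D)%N, cohen_macaulay (skel D d)
    & forall e, (d < e)%N -> (e <= maxsize D)%N -> ~ cohen_macaulay (skel D e)].

End SC.

Definition shifted (T : finType) (D : {set {set T}}) (t : nat) (v : 'I_t -> T) : Prop :=
  forall (i : 'I_t) (B : {set T}) (w : T),
    B \in D -> w \in B -> w \notin [set v j | j : 'I_t & (j <= i)%N] -> v i \notin B ->
    (B :\ w) :|: [set v i] \in D.

Definition cross_intersecting (T : finType) (A B : {set {set T}}) : Prop :=
  forall a b, a \in A -> b \in B -> a :&: b != set0.

Definition shadow (T : finType) (r : nat) (B : {set {set T}}) : {set {set T}} :=
  [set S : {set T} | (#|S| == r.-1) && [exists b in B, S \subset b]].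

(* Main.v *)
Require Import Defs.
From mathcomp Require Import all_boot all_order all_algebra all_fingroup all_field.
From mathcomp Require Import zify ring.
From Stdlib Require Import Classical.

Set Implicit Arguments. Unset Strict Implicit. Unset Printing Implicit Defensive.
Import GRing.Theory.

(** Let V = {v_1, ..., v_r}. After compressing A and B towards V we may assume that B is
    shifted with respect to V, hence contains V. Split the families into their fibers over
    the subsets of V: the fibers consist of faces of S = link V, which is Cohen-Macaulay
    and all of whose facets have at least r - 1 elements. Replace each fiber by its algebraic
    shift, using one generic basis g for all fibers. This preserves cardinalities,
    inclusions, shadows and cross-intersection, and makes every fiber shifted, so the new
    fibers glue to families hatA and hatB of subsets of an initial segment of the integers
    in which V is [r]; hatB is shifted. Given b in hatB, let i be the last index with
    2 |b :&: [i]| = i + 1 and exchange b with its complement inside [i]. This is an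
    injection from hatB minus [r] into the (r-1)-sets that meet [r] and are not in hatA, whence
    the bound. That the reflected sets still come from faces is where the depth is used:
    if Q lies in the shift of S, misses [p], and |Q| + p <= r - 1, then Q :|: [p] also lies in
    it. By semicontinuity of ranks it suffices to see this for a Vandermonde matrix g, where
    it says that g_q is exact modulo the ideal (g_0, ..., g_(q-1)) in low degrees;
    this follows by induction on q, over an algebraically closed field, from the fact that
    multiplication by a vector with few zeros is exact in low degrees. *)


(** * Multiplication in the exterior algebra *)

(** The hypothesis [2 * r <= d + 1] enters twice. By purity a face with at most r - 1 vertices lies
    in a d-face, and shiftedness can then move all of V into it; so the fiber of the (r-1)-faces
    over X depends only on |X|, which is what allows a reflection to change X. Moreover r - 1 <= d -
    r, so the sizes met by a reflection stay in the range where link V is controlled. The number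
    gamma is the fiber of the faces over the empty set: since V lies in B, no member of A avoids V,
    and this whole fiber can be left out of the target of the injection. The field F may be finite,
    while generic choices need infinitely many scalars and the exactness argument needs eigenvalues;
    but boundary matrices are integral, so the Cohen-Macaulay property is transported to a closed
    field of the same characteristic. A Vandermonde matrix need not be generic, so its exactness is
    not carried over as such: it is first turned, by rank-nullity, into an upper bound for a number
    of faces by a sum of two ranks, and both ranks can only grow when g becomes generic. *)

Section ExteriorProduct.
Local Open Scope ring_scope.
Variables (T : finType) (R : comNzRingType).
Implicit Types (x y : {ffun {set T} -> R^o}) (w : {ffun T -> R^o}) (Y Z Q : {set T}).

Lemma scale_ffE (I : finType) c (x : {ffun I -> R^o}) i : (c *: x) i = c * x i.
Proof. by rewrite ffunE. Qed.

Lemma add_ffE (I : finType) (x y : {ffun I -> R^o}) i : (x + y) i = x i + y i.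
Proof. by rewrite ffunE. Qed.

Lemma opp_ffE (I : finType) (x : {ffun I -> R^o}) i : (- x) i = - x i.
Proof. by rewrite ffunE. Qed.

Lemma sub_ffE (I : finType) (x y : {ffun I -> R^o}) i : (x - y) i = x i - y i.
Proof. by rewrite !ffunE. Qed.

Definition rk (a : T) : nat := enum_rank a.

Lemma rk_inj : injective rk.
Proof. by move=> a b /ord_inj /enum_rank_inj. Qed.

Definition sg Y (a : T) : R := (-1) ^+ #|[set z in Y | (rk z < rk a)%N]|.

(* A cochain is a function on all subsets of T, read as an element of the exterior
   algebra on T; L w is then left multiplication by the vector w. *)
Definition L w x : {ffun {set T} -> R^o} :=
  [ffun Y : {set T} => \sum_(a in Y) sg Y a * w a * x (Y :\ a)].

Lemma LE w x Y : L w x Y = \sum_(a in Y) sg Y a * w a * x (Y :\ a).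
Proof. by rewrite ffunE. Qed.

Lemma LD w x y : L w (x + y) = L w x + L w y.
Proof.
apply/ffunP => Y; rewrite !ffunE -big_split; apply: eq_bigr => a _.
by rewrite ffunE mulrDr.
Qed.

Lemma LZ w c x : L w (c *: x) = c *: L w x.
Proof.
apply/ffunP => Y; rewrite scale_ffE !LE mulr_sumr; apply: eq_bigr => a _.
by rewrite scale_ffE mulrCA.
Qed.

Lemma L0 w : L w 0 = 0.
Proof. by rewrite -(scale0r (0 : {ffun {set T} -> R^o})) LZ !scale0r. Qed.

Lemma LN w x : L w (- x) = - L w x.
Proof. by rewrite -scaleN1r LZ scaleN1r. Qed.

Lemma LB w x y : L w (x - y) = L w x - L w y.
Proof. by rewrite LD LN. Qed.

Lemma L_sum w I (r : seq I) (P : pred I) (F : I -> {ffun {set T} -> R^o}) :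
  L w (\sum_(i <- r | P i) F i) = \sum_(i <- r | P i) L w (F i).
Proof. by apply: (big_morph _ (LD w) (L0 w)). Qed.

Lemma LDl w w' x : L (w + w') x = L w x + L w' x.
Proof.
apply/ffunP => Y; rewrite !ffunE -big_split; apply: eq_bigr => a _.
by rewrite ffunE mulrDr mulrDl.
Qed.

Lemma LZl c w x : L (c *: w) x = c *: L w x.
Proof.
apply/ffunP => Y; rewrite scale_ffE !LE mulr_sumr; apply: eq_bigr => a _.
by rewrite scale_ffE !mulrA [_ * c]mulrC.
Qed.

Lemma L_eq_on w x y Y :
  (forall a, a \in Y -> x (Y :\ a) = y (Y :\ a)) -> L w x Y = L w y Y.
Proof. by move=> h; rewrite !LE; apply: eq_bigr => a aY; rewrite h. Qed.

Lemma sg_swap Y a b : a \in Y -> b \in Y -> a != b ->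
  sg Y a * sg (Y :\ a) b = - (sg Y b * sg (Y :\ b) a).
Proof.
wlog lt_ab : a b / (rk a < rk b)%N => [hw aY bY ab|].
  case: (ltngtP (rk a) (rk b)) => [lt|gt|/rk_inj e].
  - exact: hw.
  - by rewrite (hw b a) ?opprK // eq_sym.
  - by rewrite e eqxx in ab.
move=> aY bY ab.
have e1 : [set z in Y :\ b | (rk z < rk a)%N] = [set z in Y | (rk z < rk a)%N].
  apply/setP => z; rewrite !inE; case: eqP => // ->.
  by rewrite [(rk b < rk a)%N]ltnNge ltnW //= andbF.
have e2 : [set z in Y | (rk z < rk b)%N] = a |: [set z in Y :\ a | (rk z < rk b)%N].
  by apply/setP => z; rewrite !inE; case: eqP => // ->; rewrite aY lt_ab.
rewrite /sg e1 e2 cardsU1 !inE eqxx /= add1n exprS.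
by rewrite mulN1r mulNr opprK mulrC.
Qed.

(** Each term is cancelled against its reverse, without dividing by 2, so that characteristic 2 is
    covered. *)
Lemma antisym_sum0 (P : pred T) (F : T -> T -> R) :
  (forall a b, P a -> P b -> a != b -> F a b = - F b a) ->
  \sum_(a | P a) \sum_(b | P b && (b != a)) F a b = 0.
Proof.
move=> hF.
rewrite (eq_bigr (fun a => \sum_(b | P b && (rk b < rk a)%N) F a b +
                           \sum_(b | P b && (rk a < rk b)%N) F a b)); last first.
  move=> a _; rewrite (bigID (fun b => (rk b < rk a)%N)) /=; congr (_ + _);
    apply: eq_bigl => b; rewrite -andbA; congr (_ && _).
  - by case: eqP => // ->; rewrite ltnn.
  - rewrite -leqNgt [in RHS]ltn_neqAle; congr (_ && _).
    by rewrite eq_sym (inj_eq rk_inj).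
rewrite big_split /= [X in X + _](exchange_big_dep P) /=; last by move=> ? ? _ /andP [].
rewrite -big_split big1 // => b Pb /=.
rewrite (eq_bigl (fun i => P i && (rk b < rk i)%N)); last first.
  by move=> a; rewrite Pb.
rewrite -big_split big1 // => a /andP [Pa lt] /=.
rewrite hF ?addNr //; apply: contraTneq lt => ->; by rewrite ltnn.
Qed.

Lemma L_sq w x : L w (L w x) = 0.
Proof.
apply/ffunP => Y; rewrite !ffunE.
pose F a b := sg Y a * sg (Y :\ a) b * (w a * w b) * x (Y :\ a :\ b).
rewrite (eq_bigr (fun a => \sum_(b | (b \in Y) && (b != a)) F a b)).
  apply: antisym_sum0 => a b aY bY ab; rewrite /F sg_swap // !mulNr.
  have -> : Y :\ a :\ b = Y :\ b :\ a by rewrite setDDl setUC -setDDl.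
  by rewrite [w a * _]mulrC.
move=> a aY; rewrite LE mulr_sumr; apply: eq_big => [b|b _].
  by rewrite !inE andbC.
by rewrite /F; ring.
Qed.

(** Polarization of [L_sq], applied to [w + w']. *)
Lemma L_anti w w' x : L w (L w' x) = - L w' (L w x).
Proof.
apply/eqP; rewrite -subr_eq0 opprK; apply/eqP.
by rewrite -[RHS](L_sq (w + w') x) !LDl !LD !L_sq add0r addr0.
Qed.

Definition one : {ffun {set T} -> R^o} := [ffun Y : {set T} => (Y == set0)%:R].

Definition Ls (g : T -> {ffun T -> R^o}) (s : seq T) x := foldr (fun i => L (g i)) x s.

Lemma Ls_cat g s t x : Ls g (s ++ t) x = Ls g s (Ls g t x).
Proof. by rewrite /Ls foldr_cat. Qed.

Lemma Ls_pull g i s x : Ls g s (L (g i) x) = (-1) ^+ size s *: L (g i) (Ls g s x).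
Proof.
elim: s => [|j s IH] /=; first by rewrite scale1r.
by rewrite IH LZ L_anti scalerN exprS mulN1r scaleNr.
Qed.

(** The sign depends on the permutation alone, hence is chosen before [g] and [x]: [sh_shift] uses
    one sign for two matrices at once. *)
Lemma Ls_perm s t : perm_eq s t ->
  exists b : bool, forall g x, Ls g s x = (-1) ^+ b *: Ls g t x.
Proof.
elim: s t => [|i s IH] t.
  by rewrite perm_sym => /perm_nilP ->; exists false => g x; rewrite scale1r.
move=> pst; have it : i \in t by rewrite -(perm_mem pst) inE eqxx.
case/splitPr: it pst => t1 t2.
rewrite perm_sym -cat1s perm_catCA /= perm_cons perm_sym => /IH [b hb].
exists (b (+) odd (size t1)) => g x.
rewrite /= hb !Ls_cat /= Ls_pull LZ scalerA signr_addb signr_odd.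
by rewrite -mulrA -expr2 sqrr_sign mulr1.
Qed.

Lemma Ls_eq g g' s x : {in s, g =1 g'} -> Ls g s x = Ls g' s x.
Proof.
elim: s => //= i s IH h; rewrite h ?inE ?eqxx // IH // => j js.
by apply: h; rewrite inE js orbT.
Qed.

Lemma Ls_dup g s x : ~~ uniq s -> Ls g s x = 0.
Proof.
elim: s => //= i s IH; rewrite negb_and negbK => /orP [is_s|/IH -> //]; last by rewrite L0.
case/splitPr: is_s => s1 s2; rewrite Ls_cat /= Ls_pull LZ L_sq scaler0 //.
Qed.

Lemma Ls_supp g s Y : #|Y| != size s -> Ls g s one Y = 0.
Proof.
elim: s Y => [|i s IH] Y /= hY.
  by rewrite ffunE -cards_eq0 (negbTE hY).
rewrite LE big1 // => a aY; rewrite IH ?mulr0 //.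
by rewrite (cardsD1 a) aY add1n eqSS in hY.
Qed.

(* The product of the vectors g_i, i in Q: its value at Y is the minor of the matrix g
   with rows Q and columns Y. *)
Definition gs (g : T -> {ffun T -> R^o}) (Q : {set T}) := Ls g (enum Q) one.

Lemma gs_supp g Q Y : #|Y| != #|Q| -> gs g Q Y = 0.
Proof. by rewrite [#|Q|]cardE; exact: Ls_supp. Qed.

Lemma gs_eq g g' Q : {in Q, g =1 g'} -> gs g Q = gs g' Q.
Proof. by move=> h; apply: Ls_eq => i; rewrite mem_enum; apply: h. Qed.

Lemma Ls_gs s : uniq s -> exists b : bool,
  forall g, Ls g s one = (-1) ^+ b *: gs g [set i in s].
Proof.
move=> us; have ps : perm_eq s (enum [set i in s]).
  by apply: uniq_perm; rewrite ?enum_uniq // => i; rewrite mem_enum inE.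
by have [b hb] := Ls_perm ps; exists b => g; rewrite hb.
Qed.

Lemma L_gs i Q : i \notin Q -> exists b : bool,
  forall g, L (g i) (gs g Q) = (-1) ^+ b *: gs g (i |: Q).
Proof.
move=> iQ; have us : uniq (i :: enum Q) by rewrite /= mem_enum iQ enum_uniq.
have [b hb] := Ls_gs us; exists b => g; rewrite -[L _ _]/(Ls g (i :: enum Q) one) hb.
by congr (_ *: gs _ _); apply/setP => j; rewrite !inE mem_enum.
Qed.

Lemma L_gs0 g i Q : i \in Q -> L (g i) (gs g Q) = 0.
Proof.
by move=> iQ; rewrite -[L _ _]/(Ls g (i :: enum Q) one) Ls_dup //= mem_enum iQ.
Qed.

Lemma gs_pull i Q : i \in Q -> exists b : bool,
  forall g, gs g Q = (-1) ^+ b *: L (g i) (gs g (Q :\ i)).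
Proof.
move=> iQ; have [|b hb] := @L_gs i (Q :\ i); first by rewrite !inE eqxx.
by exists b => g; rewrite hb setD1K // scalerA -expr2 sqrr_sign scale1r.
Qed.

End ExteriorProduct.


(** * Exactness of multiplication by a vector *)

Section Complexes.
Variable T : finType.
Implicit Types (S : {set {set T}}) (A B Y : {set T}).

Definition down_closed S := forall A B, A \in S -> B \subset A -> B \in S.

Definition level S k := [set Y in S | #|Y| == k].

Lemma in_link S A B : B \in link S A = [&& B \in S, [disjoint A & B] & A :|: B \in S].
Proof. by rewrite inE. Qed.

Lemma link_down S A : down_closed S -> down_closed (link S A).
Proof.
move=> dS B C; rewrite !in_link => /and3P [BS dAB ABS] CB.
rewrite (dS _ _ BS CB) (dS _ _ ABS (setUS A CB)) andbT /=.
by rewrite disjoint_sym (disjointWl CB) // disjoint_sym.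
Qed.

Lemma link_link S A B : down_closed S -> B \in link S A ->
  link (link S A) B = link S (A :|: B).
Proof.
move=> dS; rewrite in_link => /and3P [BS dAB ABS].
apply/setP => C; rewrite !in_link setUA.
have -> : [disjoint A :|: B & C] = [disjoint A & C] && [disjoint B & C].
  by rewrite -!setI_eq0 setIUl setU_eq0.
have -> : [disjoint A & B :|: C] = [disjoint A & C].
  by rewrite -!setI_eq0 setIUr setU_eq0 setI_eq0 dAB.
case: (boolP (A :|: B :|: C \in S)) => h; rewrite ?andbF // !andbT.
have -> : C \in S by apply: dS h _; rewrite subsetUr.
have -> : A :|: C \in S by apply: dS h _; rewrite setUAC subsetUl.
have -> : B :|: C \in S by apply: dS h _; rewrite -setUA subsetUr.
by rewrite /= andbT; case: [disjoint B & C]; case: [disjoint A & C].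
Qed.

Lemma link0 S : link S set0 = S.
Proof.
by apply/setP => B; rewrite in_link set0U -setI_eq0 set0I eqxx /= andbb.
Qed.

End Complexes.

Section CoboundaryExactness.
Local Open Scope ring_scope.
Variables (T : finType) (K : fieldType).
Implicit Types (S : {set {set T}}) (Y : {set T}) (x y : {ffun {set T} -> K^o}).
Implicit Types (f w : {ffun T -> K^o}).

(** Equality in degree [k] of the exterior face ring of [S]. Cochains remain functions on all
    subsets and are only compared on faces, so the same [x] can be read on a complex and on its
    links. *)
Definition eqon S k x y := forall Y, Y \in S -> #|Y| = k -> x Y = y Y.

Lemma eqon_sym S k x y : eqon S k x y -> eqon S k y x.
Proof. by move=> h Y YS Yk; rewrite h. Qed.

Lemma eqon_L S k w x y : down_closed S -> eqon S k x y -> eqon S k.+1 (L w x) (L w y).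
Proof.
move=> dS h Y YS Yk; apply: L_eq_on => a aY; apply: h.
  by apply: dS YS _; rewrite subD1set.
by rewrite (cardsD1 a) aY in Yk; case: Yk.
Qed.

Definition exact_at S f j :=
  forall x, eqon S j.+1 (L f x) 0 -> exists a, eqon S j x (L f a).

Definition ones : {ffun T -> K^o} := [ffun=> 1].

(* Cohomological Cohen-Macaulayness, with k + #|A| < m in place of a bound on k by the
   dimension of the link of A, so that it passes to links without a purity argument. *)
Definition coCM S m :=
  forall A, A \in S -> forall k, (k + #|A| < m)%N -> exact_at (link S A) ones k.

Lemma coCM_link S m v : down_closed S -> [set v] \in S -> coCM S m.+1 ->
  coCM (link S [set v]) m.
Proof.
move=> dS vS cS A Alk k km; rewrite link_link //; apply: cS.
  by move: Alk; rewrite in_link => /and3P [].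
move: Alk; rewrite in_link => /and3P [_ dvA _].
by rewrite cardsU (disjoint_setI0 dvA) cards0 subn0 cards1 addnCA add1n ltnS.
Qed.

Definition monom f Y : K := \prod_(a in Y) f a.

Definition rescale (u : {set T} -> K) x : {ffun {set T} -> K^o} :=
  [ffun Y => (u Y * x Y : K)].

Lemma rescaleE u x Y : rescale u x Y = u Y * x Y :> K.
Proof. by rewrite ffunE. Qed.

(** A diagonal change of coordinates carries [ones] to [f]; if [f] has no zeros on the vertices of a
    complex, multiplication by [f] is thus as exact there as the simplicial coboundary. *)
Lemma L_rescale f x Y : L f (rescale (monom f) x) Y = monom f Y * L ones x Y :> K.
Proof.
rewrite !LE mulr_sumr; apply: eq_bigr => a aY.
rewrite rescaleE ffunE /monom (big_setD1 a aY) /=; ring.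
Qed.

Lemma sg_sq Y v : sg K Y v * sg K Y v = 1.
Proof. by rewrite /sg -expr2 sqrr_sign. Qed.

Lemma sg_cancel Y v (u : K) : - sg K Y v * u = 0 -> u = 0.
Proof. by move=> /eqP; rewrite mulf_eq0 oppr_eq0 signr_eq0 => /eqP. Qed.

Definition slice v x : {ffun {set T} -> K^o} :=
  [ffun Y => sg K (v |: Y) v * x (v |: Y)].

(** As [f v = 0], contraction by [v] anticommutes with multiplication by [f], up to the sign built
    into [slice]. Faces through [v] therefore see multiplication by [f] on the link of [v]. *)
Lemma L_slice f v x Y : f v = 0 -> v \notin Y ->
  L f x (v |: Y) = - sg K (v |: Y) v * L f (slice v x) Y.
Proof.
move=> fv vY; rewrite !LE (big_setU1 _ vY) /= fv mulr0 mul0r add0r mulr_sumr.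
apply: eq_bigr => a aY.
have av : a != v by apply: contraTneq aY => ->.
have e1 : (v |: Y) :\ a = v |: (Y :\ a).
  by rewrite setDUl; congr (_ :|: _); apply/setDidPl; rewrite disjoints1 inE eq_sym.
have e2 : (v |: Y) :\ v = Y by rewrite setU1K.
have := @sg_swap T K (v |: Y) v a; rewrite !inE eqxx aY orbT eq_sym av e1 e2.
move=> /(_ isT isT isT) hs; rewrite ffunE.
have {hs} hs : sg K (v |: Y) a = - (sg K (v |: Y) v * sg K Y a * sg K (v |: Y :\ a) v).
  by rewrite hs mulNr opprK -mulrA sg_sq mulr1.
rewrite hs; ring.
Qed.

Definition off v x : {ffun {set T} -> K^o} :=
  [ffun Y : {set T} => if v \in Y then 0 else x Y].

Lemma L_off_in f v x Y : f v = 0 -> v \in Y -> L f (off v x) Y = 0.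
Proof.
move=> fv vY; rewrite LE big1 // => a aY.
case: (eqVneq a v) => [->|av]; first by rewrite fv mulr0 mul0r.
by rewrite ffunE !inE eq_sym av vY mulr0.
Qed.

Lemma L_off_out f v x Y : v \notin Y -> L f (off v x) Y = L f x Y.
Proof.
by move=> vY; apply: L_eq_on => a aY; rewrite ffunE !inE (negbTE vY) andbF.
Qed.

Lemma L_change f f' v x Y : v \notin Y -> (forall a, a != v -> f a = f' a) ->
  L f x Y = L f' x Y.
Proof.
move=> vY ff; rewrite !LE; apply: eq_bigr => a aY; rewrite ff //.
by apply: contraTneq aY => ->.
Qed.

Definition zeros S f := [set v | ([set v] \in S) && (f v == 0)].

(** Once [x] is zero on the star of [v] in degree [j], the value of [f] at [v] no longer matters and
    can be set to 1. Exactness on the link is used twice, in degree [j - 1] for the faces through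
    [v] and in degree [j] for the faces of the link. *)
Lemma exact_at_zero_step S m z f v j : down_closed S -> coCM S m -> (j + z.+1 < m)%N ->
  [set v] \in S -> f v = 0 ->
  (forall j', (j' + z < m.-1)%N -> exact_at (link S [set v]) f j') ->
  exact_at S [ffun a => if a == v then 1 else f a] j ->
  exact_at S f j.
Proof.
move=> dS cS jm vS fv exl exS x hx.
have lkS Y : Y \in link S [set v] -> Y \in S by rewrite in_link => /and3P [].
have in_lk Y : v |: Y \in S -> v \notin Y -> Y \in link S [set v].
  move=> h vY; rewrite in_link h disjoints1 vY /= andbT.
  by apply: dS h _; rewrite subsetUr.
have lkv Y : Y \in link S [set v] -> (v \notin Y) && (v |: Y \in S).
  by rewrite in_link disjoints1 => /and3P [_ -> ->].
(* Kill x on the faces containing v. *)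
have [a1 ha1] : exists a1, forall Y, Y \in S -> #|Y| = j -> v \in Y -> x Y = L f a1 Y.
  case: j jm hx {exS} => [|j] jm hx.
    by exists 0 => Y _ /eqP; rewrite cards_eq0 => /eqP ->; rewrite inE.
  have [||a ha] := exl j _ (slice v x); first by move: jm; lia.
    move=> Y Ylk Yj; have /andP [vY vYS] := lkv _ Ylk.
    have := hx _ vYS; rewrite cardsU1 vY Yj => /(_ erefl); rewrite L_slice // ffunE.
    by rewrite !ffunE => h; rewrite (sg_cancel h).
  exists (- [ffun Y : {set T} => sg K Y v * a (Y :\ v)]) => Y YS Yj vY.
  have e : Y = v |: (Y :\ v) by rewrite setD1K.
  have nv : v \notin Y :\ v by rewrite !inE eqxx.
  have Zlk : Y :\ v \in link S [set v] by apply: in_lk; rewrite -?e.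
  have Zj : #|Y :\ v| = j by rewrite (cardsD1 v) vY in Yj; case: Yj.
  rewrite LN ffunE [in RHS]e L_slice // -e mulNr opprK.
  have -> : L f (slice v [ffun Z : {set T} => sg K Z v * a (Z :\ v)]) (Y :\ v)
          = L f a (Y :\ v).
    apply: L_eq_on => b bY; rewrite !ffunE mulrA sg_sq mul1r setU1K //.
    by rewrite !inE eqxx !andbF.
  by rewrite -ha // ffunE -e mulrA sg_sq mul1r.
pose x1 := x - L f a1.
have x1v Y : Y \in S -> #|Y| = j -> v \in Y -> x1 Y = 0.
  by move=> YS Yj vY; rewrite sub_ffE ha1 // subrr.
have hx1 : eqon S j.+1 (L f x1) 0.
  by move=> Y YS Yj; rewrite LB L_sq subr0 hx.
(* Then on the link of v, without touching the faces containing v. *)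
have [||a2 ha2] := exl j _ x1; first by move: jm; lia.
  by move=> Y Ylk Yj; apply: hx1 => //; apply: lkS.
pose x2 := x1 - L f (off v a2).
have hx2 : eqon S j.+1 (L f x2) 0.
  by move=> Y YS Yj; rewrite LB L_sq subr0 hx1.
have x2v Y : Y \in S -> #|Y| = j -> v \in Y -> x2 Y = 0.
  by move=> YS Yj vY; rewrite sub_ffE L_off_in // x1v // subrr.
have x2l Y : Y \in link S [set v] -> #|Y| = j -> x2 Y = 0.
  move=> Ylk Yj; have /andP [vY _] := lkv _ Ylk.
  by rewrite sub_ffE L_off_out // ha2 // subrr.
set f' := (X in exact_at S X j) in exS.
have f'E a : a != v -> f' a = f a by rewrite ffunE => /negbTE ->.
have [|b hb] := exS x2.
  move=> Y YS Yj; rewrite [RHS]ffunE; case: (boolP (v \in Y)) => vY.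
    rewrite LE big1 // => a aY.
    have YaS : Y :\ a \in S by apply: dS YS _; rewrite subD1set.
    have Yaj : #|Y :\ a| = j by rewrite (cardsD1 a) aY in Yj; case: Yj.
    case: (eqVneq a v) => [e|av]; last by rewrite x2v ?mulr0 // !inE eq_sym av.
    rewrite x2l ?mulr0 //; apply: in_lk; first by rewrite -e setD1K.
    by rewrite e !inE eqxx.
  by rewrite (L_change _ vY f'E) hx2 // ffunE.
exists (a1 + off v a2 + off v b) => Y YS Yj.
have -> : x Y = x2 Y + L f (off v a2) Y + L f a1 Y by rewrite /x2 /x1 !sub_ffE !subrK.
clearbody x2.
(* The part of [b] on faces through [v] is discarded: on faces through [v] both sides are then 0,
   and elsewhere [f] and [f'] act alike. *)
suff hb2 : L f (off v b) Y = x2 Y.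
  by rewrite !LD !add_ffE hb2 addrC [x2 Y + _]addrC addrA.
case: (boolP (v \in Y)) => vY; first by rewrite L_off_in // x2v.
by rewrite L_off_out // hb // (L_change _ vY f'E).
Qed.

(** Every zero costs one degree. At a zero [v], both inputs of the previous step have one zero
    fewer: the link does not contain [v], and the modified vector is 1 there. The link loses one in
    [m], which the smaller [z] compensates. *)
Lemma exact_at_few_zeros z S m f j : down_closed S -> coCM S m ->
  (#|zeros S f| <= z)%N -> (j + z < m)%N -> exact_at S f j.
Proof.
elim: z S m f j => [|z IH] S m f j dS cS.
  rewrite leqn0 cards_eq0 => /eqP z0 jm x hx.
  have fn0 Y : Y \in S -> monom f Y != 0.
    move=> YS; apply/prodf_neq0 => a aY.
    have : a \notin zeros S f by rewrite z0 inE.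
    by rewrite inE (dS _ _ YS) // sub1set.
  have S0 : set0 \in S \/ S = set0.
    case: (set_0Vmem S) => [|[A AS]]; first by right.
    by left; apply: dS AS _; apply: sub0set.
  case: S0 => [S0|S0]; last by exists 0 => Y; rewrite S0 inE.
  move: jm; rewrite addn0 => jm.
  have := cS _ S0 j; rewrite cards0 link0 addn0 => /(_ jm).
  move=> /(_ (rescale (fun Y => (monom f Y)^-1) x)) [|a ha].
    move=> Y YS Yj; apply: (mulfI (fn0 _ YS)); rewrite -L_rescale.
    transitivity (L f x Y); last by rewrite hx // ffunE mulr0.
    apply: L_eq_on => b bY; rewrite !rescaleE mulrA divff ?mul1r //.
    by apply: fn0; apply: dS YS _; rewrite subD1set.
  exists (rescale (monom f) a) => Y YS Yj.
  by rewrite L_rescale -ha // rescaleE mulrA divff ?mul1r // fn0.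
move=> hz jm; case: (leqP #|zeros S f| z) => [le|gt].
  by apply: (IH S m) => //; move: jm; lia.
have /card_gt0P [v] : (0 < #|zeros S f|)%N by apply: leq_ltn_trans gt.
rewrite inE => /andP [vS /eqP fv].
have hz' : (#|zeros S f :\ v| <= z)%N.
  by move: hz; rewrite (cardsD1 v) inE vS fv eqxx.
apply: (@exact_at_zero_step S m z f v j) => //.
- move=> j' j'm; apply: (IH _ m.-1) => //.
  + exact: link_down.
  + by apply: coCM_link => //; rewrite prednK //; move: jm; lia.
  + apply: leq_trans hz'; apply: subset_leq_card; apply/subsetP => a.
    rewrite !inE => /andP [/and3P [aS dva _] ->]; rewrite aS !andbT.
    by move: dva; rewrite disjoints1 inE eq_sym.
- apply: (IH _ m) => //; last by move: jm; lia.
  apply: leq_trans hz'; apply: subset_leq_card; apply/subsetP => a.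
  rewrite !inE ffunE => /andP [->]; case: ifP => [_ /eqP h|_ ->] //.
  by have := oner_neq0 K; move: (h : 1 = 0 :> K) => ->; rewrite eqxx.
Qed.

End CoboundaryExactness.


Section LinearDependence.
Local Open Scope ring_scope.

(** The coefficients are packed into a polynomial so that the relation can later be split into
    linear factors. *)
Lemma linear_dependence (K : fieldType) (I : finType) (xs : nat -> {ffun I -> K^o}) :
  exists p : {poly K}, [/\ p != 0, (size p <= #|I|.+1)%N &
    \sum_(i < #|I|.+1) p`_i *: xs i = 0].
Proof.
pose N := #|I|; pose M : 'M[K]_(N.+1, N) := \matrix_(i, j) xs i (enum_val j).
have : kermx M != 0.
  rewrite -mxrank_eq0 mxrank_ker subn_eq0 -ltnNge.
  by apply: leq_ltn_trans (rank_leq_col M) _.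
case/rowV0Pn => v /sub_kermxP vM vn0.
pose p := \poly_(i < N.+1) (if insub i is Some j then v 0 j else 0).
have pE (i : 'I_N.+1) : p`_i = v 0 i.
  by rewrite coef_poly ltn_ord; case: insubP => [j _ e|/negP []//]; congr (v 0 _); apply: val_inj.
exists p; split; [|exact: size_poly|].
  apply: contraNneq vn0 => p0; apply/eqP/rowP => i; rewrite -pE p0 coef0 mxE //.
apply/ffunP => a; rewrite sum_ffunE ffunE.
have /rowP /(_ (enum_rank a)) := vM; rewrite [RHS]mxE => e; rewrite -[RHS]e mxE.
by apply: eq_bigr => i _; rewrite scale_ffE mxE enum_rankK pE.
Qed.

End LinearDependence.

(** * Exactness modulo the ideal of the first Vandermonde rows *)

Section VandermondeExactness.
Local Open Scope ring_scope.
Variables (T : finType) (K : closedFieldType) (al : T -> K).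
Hypothesis al_inj : injective al.
Variables (S : {set {set T}}) (m : nat).
Hypotheses (dS : down_closed S) (cS : coCM K S m).
Implicit Types (p : {poly K}) (x y : {ffun {set T} -> K^o}).

Definition vec p : {ffun T -> K^o} := [ffun t => (p.[al t] : K)].

Lemma vecB p c p' : vec (p - c *: p') = vec p - c *: vec p'.
Proof. by apply/ffunP => t; rewrite sub_ffE scale_ffE !ffunE hornerD hornerN hornerZ. Qed.

Definition comb q (a : nat -> {ffun {set T} -> K^o}) := \sum_(i < q) L (vec 'X^i) (a i).

Lemma combD q a b : comb q (fun i => a i + b i) = comb q a + comb q b.
Proof. by rewrite -big_split; apply: eq_bigr => i _; rewrite LD. Qed.

Lemma combZ q c a : comb q (fun i => c *: a i) = c *: comb q a.
Proof. by rewrite scaler_sumr; apply: eq_bigr => i _; rewrite LZ. Qed.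

Lemma combL q w a : L w (comb q a) = comb q (fun i => - L w (a i)).
Proof. by rewrite L_sum; apply: eq_bigr => i _; rewrite LN L_anti. Qed.

Definition in_ideal q j x := exists a, eqon S j x (comb q a).

Lemma eqon_trans j x y z : eqon S j x y -> eqon S j y z -> eqon S j x z.
Proof. by move=> h h' Y YS Yj; rewrite h // h'. Qed.

Lemma eqonD j x y x' y' : eqon S j x y -> eqon S j x' y' -> eqon S j (x + x') (y + y').
Proof. by move=> h h' Y YS Yj; rewrite !add_ffE h // h'. Qed.

Lemma eqonZ j c x y : eqon S j x y -> eqon S j (c *: x) (c *: y).
Proof. by move=> h Y YS Yj; rewrite !scale_ffE h. Qed.

Lemma zeros_vec p z : size p = z.+1 -> (#|zeros S (vec p)| <= z)%N.
Proof.
move=> sp; have p0 : p != 0 by rewrite -size_poly_eq0 sp.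
rewrite cardE -(size_map al) -ltnS -sp.
apply: max_poly_roots => //; last by rewrite map_inj_uniq // enum_uniq.
apply/allP => _ /mapP [v hv ->].
by move: hv; rewrite mem_enum inE ffunE => /andP [].
Qed.

(* A polynomial of degree z plus any combination of lower powers vanishes at no more than
   z of the points al t, which is what exact_at_few_zeros requires. *)
Lemma exact_mod_vandermonde q p z j x : size p = z.+1 -> (q <= z)%N -> (j + z < m)%N ->
  in_ideal q j.+1 (L (vec p) x) ->
  exists b c, eqon S j x (L (vec p) b + comb q c).
Proof.
elim: q p z j x => [|q IH] p z j x sp qz jm [a ha].
  have [|b hb] := exact_at_few_zeros dS cS (zeros_vec sp) jm (x := x).
    by apply: eqon_trans ha _ => Y _ _; rewrite /comb big_ord0.
  by exists b, (fun=> 0) => Y YS Yj; rewrite /comb big_ord0 addr0 hb.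
set f := vec p; set w := vec 'X^q.
pose rel x y := in_ideal q j.+1 (L f x - L w y).
(* From f u = w v modulo the ideal, multiplying by f gives w (f v) = 0. Exactness of [w] one degree
   higher, affordable since q < z, yields f v = w v'. So the relation can be iterated forever. *)
have next u v : rel u v -> exists v', rel v v'.
  case=> c hc.
  have [| | |b [e hbe]] := IH 'X^q q j.+1 (L f v) _ (leqnn q).
  - by rewrite size_polyXn.
  - by move: jm; lia.
  - exists (fun i => - L f (c i)); apply: eqon_trans (_ : eqon _ _ _ (L f (comb q c))) _.
      apply: eqon_sym; apply: eqon_trans (eqon_sym (eqon_L f dS hc)) _.
      by move=> Y _ _; rewrite LB L_sq sub0r -L_anti.
    by rewrite combL.
  by exists b, e => Y YS Yj; rewrite sub_ffE hbe // add_ffE addrC addKr.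
have [xs xs0 hxs] : exists2 xs : nat -> _, xs 0%N = x &
    forall i, (i <= #|{set T}|)%N -> rel (xs i) (xs i.+1).
  have relx : rel x (a q).
    exists a => Y YS Yj; rewrite sub_ffE ha // /comb big_ord_recr /= add_ffE addrK //.
  elim: #|{set T}| x (a q) relx {ha} => [|N IHN] u v uv.
    by exists (fun i => if i is 0 then u else v) => // [[]].
  have [v' vv'] := next _ _ uv; have [ys ys0 hys] := IHN _ _ vv'.
  exists (fun i => if i is i'.+1 then ys i' else u) => // [[|i]] hi //=.
    by rewrite ys0.
  exact: hys.
pose inJ u := exists b c, eqon S j u (L f b + comb q.+1 c).
have inJZ c u : inJ u -> inJ (c *: u).
  case=> b [e h]; exists (c *: b), (fun i => c *: e i).
  by rewrite LZ combZ -scalerDr; apply: eqonZ.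
(* Exactness for f - lam w modulo the first q vectors says that lam is not an eigenvalue
   of the relation rel modulo J; as K is closed, this forces the domain of rel into J. *)
have key lam u v : rel u v -> inJ (v - lam *: u) -> inJ u.
  case=> c hc [b [e h]].
  (* Modulo the ideal, v = lam u + f b + (a multiple of w), so (f - lam w) u = w f b = - f w b.
     Adding [L w b] to [u] cancels this, because w w = 0. *)
  have [| | | |b' [c' h']] := IH (p - lam *: 'X^q) z j (u + L w b).
  - rewrite size_polyDl ?sp // size_polyN ltnS (leq_trans (size_scale_leq _ _)) //.
    by rewrite size_polyXn.
  - exact: ltnW.
  - exact: jm.
  - exists (fun i => c i - L w (e i)).
    have hv : eqon S j v (lam *: u + (L f b + comb q.+1 e)).
      by move=> Y YS Yj; rewrite add_ffE -h // sub_ffE addrC subrK.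
    move=> Y YS Yj.
    have -> : comb q (fun i => c i - L w (e i)) = comb q c + L w (comb q e).
      by rewrite combL -combD.
    rewrite add_ffE -hc // sub_ffE (eqon_L w dS hv) // vecB -scaleNr.
    rewrite /comb big_ord_recr /= -/(comb q e) -/w -/f.
    rewrite !(LD, LZ, LDl, LZl, LN, L_sq, addr0, scaler0).
    rewrite (L_anti f w) !(add_ffE, scale_ffE, opp_ffE); ring.
  exists b', (fun i => if (i < q)%N then c' i else - (lam *: b') - b).
  move=> Y YS Yj.
  have -> : comb q.+1 (fun i => if (i < q)%N then c' i else - (lam *: b') - b)
      = comb q c' - lam *: L w b' - L w b.
    rewrite /comb big_ord_recr /= ltnn LD !LN LZ addrA; congr (_ - _ - _).
    by apply: eq_bigr => i _; rewrite ltn_ord.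
  have := h' Y YS Yj; rewrite vecB -scaleNr LDl LZl scaleNr.
  rewrite !(add_ffE, opp_ffE, scale_ffE) => e1.
  by apply: (addIr (L w b Y)); rewrite e1 -/f -/w; ring.
have relD u v u' v' : rel u v -> rel u' v' -> rel (u + u') (v + v').
  case=> c h [c' h']; exists (fun i => c i + c' i).
  by rewrite combD !LD opprD addrACA; apply: eqonD.
have relZ c u v : rel u v -> rel (c *: u) (c *: v).
  by case=> e h; exists (fun i => c *: e i); rewrite combZ !LZ -scalerBr; apply: eqonZ.
have rel0 : rel 0 0.
  by exists (fun=> 0); rewrite !L0 subr0 /comb big1 // => i _; rewrite L0.
set N := #|{set T}| in hxs; pose ev (c : {poly K}) := \sum_(i < N.+1) c`_i *: xs i.
have evX (c : {poly K}) : (size c <= N)%N -> rel (ev c) (ev (c * 'X)).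
  move=> sc; rewrite /ev big_ord_recr [X in rel _ X]big_ord_recl /= coefMX /=.
  rewrite nth_default // !scale0r addr0 add0r.
  apply: (big_ind2 rel) => // i _; rewrite coefMX /=; apply/relZ/hxs.
  exact: ltnW.
(* A root [lam] gives c = c' (X - lam), so [ev c] is v - lam u for the related pair u = [ev c'], v =
   [ev (c' * 'X)], and [key] strips the factor. What remains at the end is a nonzero multiple of
   [xs 0]. *)
have peel n (c : {poly K}) : size c = n.+1 -> (n <= N)%N -> inJ (ev c) -> inJ (xs 0%N).
  elim: n c => [|n IHn] c sc nN.
    have /size_poly1P [k k0 ->] : size c == 1%N by rewrite sc.
    rewrite /ev big_ord_recl big1 ?addr0 => [|i _]; last by rewrite coefC scale0r.
    by rewrite coefC /= => /(inJZ k^-1); rewrite scalerA mulVf // scale1r.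
  have /closed_rootP [lam] : size c != 1%N by rewrite sc.
  case/factor_theorem => c' ec h.
  have c'0 : c' != 0.
    by apply: contra_eqN sc => /eqP c0; rewrite ec c0 mul0r size_poly0.
  have sc' : size c' = n.+1.
    by move: sc; rewrite ec size_mul ?polyXsubC_eq0 // size_XsubC addn2 => [[]].
  apply: (IHn c' sc' (ltnW nN)); apply: (key lam _ (ev (c' * 'X))).
    by apply: evX; rewrite sc'.
  have -> : ev (c' * 'X) - lam *: ev c' = ev c; last exact: h.
  rewrite /ev scaler_sumr -sumrB; apply: eq_bigr => i _.
  by rewrite scalerA -scalerBl ec mulrBr coefB coefMC [lam * _]mulrC.
have [c [c0 sc hc]] := linear_dependence xs.
have inJ0 : inJ 0.
  by exists 0, (fun=> 0) => Y _ _; rewrite L0 /comb big1 ?addr0 // => i _; rewrite L0.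
rewrite -xs0; apply: (peel (size c).-1 c).
- by rewrite prednK // size_poly_gt0.
- by rewrite -ltnS prednK // size_poly_gt0.
- by rewrite /ev hc.
Qed.

Fixpoint vandermonde_prod q x :=
  if q is q'.+1 then vandermonde_prod q' (L (vec 'X^q') x) else x.

(** In low degrees the annihilator of the product of the first [q] rows is the ideal they generate;
    each step of the induction is [exact_mod_vandermonde] with z = q. *)
Lemma vandermonde_prod_exact q j x : (j + q <= m)%N ->
  eqon S (j + q)%N (vandermonde_prod q x) 0 -> in_ideal q j x.
Proof.
elim: q j x => [|q IH] j x jq h.
  by exists (fun=> 0) => Y YS Yj; rewrite h ?addn0 // /comb big_ord0.
rewrite addnS -addSn in jq h; have hI := IH _ _ jq h.
have [|b [c hbc]] := exact_mod_vandermonde (size_polyXn K q) (leqnn q) _ hI.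
  by rewrite addSn in jq.
exists (fun i => if (i < q)%N then c i else b); apply: eqon_trans hbc _ => Y _ _.
rewrite [in RHS]/comb big_ord_recr /= ltnn addrC.
suff -> : \sum_(i < q) L (vec 'X^i) (if (i < q)%N then c i else b) = comb q c by [].
by apply: eq_bigr => i _; rewrite ltn_ord.
Qed.

End VandermondeExactness.


(** * Algebraic shifting *)

Section Weights.
Variable T : finType.
Implicit Types (Q R A B : {set T}) (a b : T).

(* Binary weights: the order by decreasing weight is the lexicographic one, and weights
   are additive on disjoint unions. *)
Definition wt1 a := 2 ^ (#|T|.-1 - rk a).
Definition wt Q := \sum_(a in Q) wt1 a.

Lemma rk_lt a : rk a < #|T|.
Proof. exact: ltn_ord. Qed.

Lemma wt1_lt a b : rk a < rk b -> wt1 b < wt1 a.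
Proof. by move=> ab; rewrite ltn_exp2l //; have := rk_lt b; lia. Qed.

Lemma wtU A B : [disjoint A & B] -> wt (A :|: B) = wt A + wt B.
Proof.
by move=> dAB; rewrite /wt -bigU //; apply: eq_bigl => a; rewrite !inE.
Qed.

Lemma wtU1 a Q : a \notin Q -> wt (a |: Q) = wt1 a + wt Q.
Proof. by move=> aQ; rewrite /wt big_setU1. Qed.

Lemma wtD1 a Q : a \in Q -> wt Q = wt1 a + wt (Q :\ a).
Proof. by move=> aQ; rewrite -wtU1 ?setD1K // !inE eqxx. Qed.

Lemma wt_tail k : k <= #|T| -> \sum_(b | #|T| - k <= rk b) wt1 b < 2 ^ k.
Proof.
elim: k => [|k IH] kT.
  by rewrite big1 // => b; rewrite subn0 leqNgt rk_lt.
have lt : #|T| - k.+1 < #|T| by move: kT; lia.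
pose c := enum_val (Ordinal lt).
have rc : rk c = #|T| - k.+1 by rewrite /rk enum_valK.
rewrite (bigD1 c) /=; last by rewrite rc.
have -> : wt1 c = 2 ^ k by rewrite /wt1 rc; congr (2 ^ _); move: kT; lia.
rewrite expnS mul2n -addnn ltn_add2l.
rewrite (eq_bigl (fun b => #|T| - k <= rk b)); first exact: (IH (ltnW kT)).
move=> b; rewrite -(inj_eq (@rk_inj T)) rc andbC eq_sym -ltn_neqAle.
by rewrite -subSn // subSS.
Qed.

Lemma wt_lex a Q R : (forall b, rk b < rk a -> b \in Q -> b \in R) ->
  a \notin Q -> a \in R -> wt Q < wt R.
Proof.
move=> hlt aQ aR.
rewrite /wt (bigID (fun b => rk b < rk a)) [ltnRHS](bigID (fun b => rk b < rk a)) /=.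
apply: (@leq_ltn_trans (\sum_(b in R | rk b < rk a) wt1 b
  + \sum_(b in Q | ~~ (rk b < rk a)) wt1 b)).
  rewrite leq_add2r big_mkcond [leqRHS]big_mkcond; apply: leq_sum => b _.
  by case: ifP => // /andP [bQ ba]; rewrite ba (hlt b ba bQ).
rewrite ltn_add2l.
apply: (@leq_trans (wt1 a)); last first.
  by rewrite (bigD1 a) /= ?aR ?ltnn // leq_addr.
have ha : #|T| - (#|T|.-1 - rk a) = (rk a).+1 by have := rk_lt a; lia.
apply: leq_ltn_trans (@wt_tail (#|T|.-1 - rk a) _); last by lia.
rewrite big_mkcond [leqRHS]big_mkcond; apply: leq_sum => b _.
case: ifP => // /andP [bQ ba]; rewrite ha.
suff -> : rk a < rk b by [].
rewrite ltn_neqAle (inj_eq (@rk_inj T)) leqNgt ba andbT.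
by apply: contraNneq aQ => ->.
Qed.

Lemma wt_lex_total Q R : Q != R ->
  exists a, (forall b, rk b < rk a -> (b \in Q) = (b \in R)) /\ (a \in Q) != (a \in R).
Proof.
move=> QR; have [a0 ha0] : exists a, (a \in Q) != (a \in R).
  apply/existsP; apply: contraNT QR; rewrite negb_exists => /forallP h.
  by apply/eqP/setP => a; apply/eqP; rewrite -[_ == _]negbK h.
case: (@arg_minnP _ a0 (fun a => (a \in Q) != (a \in R)) (@rk T) ha0) => a ha hmin; exists a; split=> // b ba.
by apply/eqP; apply: contraTT ba => hb; rewrite -leqNgt hmin.
Qed.

Lemma wt_inj : injective wt.
Proof.
move=> Q R e; apply/eqP; apply: contraTT isT => /wt_lex_total [a [hb ha]].
case: (boolP (a \in Q)) ha => aQ; case: (boolP (a \in R)) => // aR _.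
- by have := @wt_lex a R Q _ aR aQ; rewrite e ltnn; apply=> b ba; rewrite hb.
- by have := @wt_lex a Q R _ aQ aR; rewrite e ltnn; apply=> b ba; rewrite hb.
Qed.

(** Terminal segments of the weight order, on which the members of an algebraic shift are counted by
    a rank ([card_sh_up]). *)
Definition up_closed (X : {set {set T}}) :=
  forall Q R, Q \in X -> wt Q < wt R -> R \in X.

Definition initseg p : {set T} := [set a | rk a < p].

Lemma up_above Q : up_closed [set R : {set T} | wt Q < wt R].
Proof. by move=> R R'; rewrite !inE; apply: ltn_trans. Qed.

Lemma up_contains_initseg p : up_closed [set R : {set T} | initseg p \subset R].
Proof.
move=> Q R; rewrite !inE => pQ; apply: contraTT => /subsetPn [a0].
rewrite inE => a0p a0R; rewrite -leqNgt ltnW //.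
case: (@arg_minnP _ a0 (fun a => a \notin R) (@rk T) a0R) => a aR hmin.
have ap : rk a < p by apply: leq_ltn_trans (hmin _ a0R) a0p.
apply: (@wt_lex a) => // [b ba _|]; apply: (subsetP pQ); rewrite inE //.
exact: ltn_trans ap.
Qed.

Lemma up_meets_initseg p : up_closed [set R : {set T} | ~~ [disjoint R & initseg p]].
Proof.
move=> Q R; rewrite !inE => /pred0Pn [a0 /= /andP [a0Q a0p]]; apply: contraTN => dR.
rewrite -leqNgt ltnW //.
case: (@arg_minnP _ a0 (fun a => a \in Q) (@rk T) a0Q) => a aQ hmin.
have ap : rk a < p by apply: leq_ltn_trans (hmin _ a0Q) _; rewrite inE in a0p.
have nR b : rk b < p -> b \notin R.
  by move=> bp; rewrite (disjointFl dR) // inE.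
apply: (@wt_lex a) => // [b ba bR|]; last exact: nR.
by have := nR b (ltn_trans ba ap); rewrite bR.
Qed.

End Weights.


(** * Specialization of parameters and semicontinuity of ranks *)

Section Evaluation.
Local Open Scope ring_scope.
Variables (T : finType) (K : fieldType).

Lemma horner_sg (lam : K) (Y : {set T}) a : (sg {poly K} Y a).[lam] = sg K Y a.
Proof. by rewrite /sg horner_exp hornerN hornerC. Qed.

Lemma horner_gs (lam : K) (gp : T -> {ffun T -> {poly K}^o}) (g : T -> {ffun T -> K^o}) :
  (forall i a, (gp i a : {poly K}).[lam] = g i a) ->
  forall Q Y, (gs gp Q Y : {poly K}).[lam] = gs g Q Y.
Proof.
move=> hg Q; rewrite /gs; elim: (enum Q) => [|i s IH] Y /=.
  by rewrite !ffunE; case: (Y == set0); rewrite ?hornerC.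
rewrite !LE horner_sum; apply: eq_bigr => a _.
by rewrite !hornerM horner_sg IH hg.
Qed.

End Evaluation.

Section Semicontinuity.
Local Open Scope ring_scope.
Variable K : fieldType.

(** Constant matrices with A M(l0) B = 1, of size the rank of M(l0), exist; [u] is the determinant
    of A M B, which is 1 at [l0] and, where nonzero, forces at least the same rank. *)
Lemma rank_semicontinuous a b (M : 'M[{poly K}]_(a, b)) (l0 : K) :
  exists u : {poly K}, u.[l0] != 0 /\ forall l, u.[l] != 0 ->
    (\rank (map_mx (horner_eval l0) M) <= \rank (map_mx (horner_eval l) M))%N.
Proof.
set M0 := map_mx (horner_eval l0) M.
have [A [B AB]] : exists (A : 'M_(\rank M0, a)) (B : 'M_(b, \rank M0)),
    A *m M0 *m B = 1%:M.
  exists (pinvmx (col_base M0)), (pinvmx (row_base M0)).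
  rewrite -[X in _ *m X *m _](mulmx_base M0) [pinvmx _ *m _]mulmxA mulVpmx ?col_base_full // mul1mx.
  by rewrite mulmxVp // row_base_free.
pose P := map_mx polyC A *m M *m map_mx polyC B.
have PE l : map_mx (horner_eval l) P = A *m map_mx (horner_eval l) M *m B.
  rewrite /P !map_mxM; congr (_ *m _ *m _); apply/matrixP => i j;
    by rewrite !mxE; apply: hornerC.
have detE l : (\det P).[l] = \det (A *m map_mx (horner_eval l) M *m B).
  by rewrite -PE -[LHS]/(horner_eval l (\det P)) -det_map_mx.
exists (\det P); split; first by rewrite detE -/M0 AB det1 oner_neq0.
move=> l; rewrite detE => hl.
have /mxrank_unit <- : A *m map_mx (horner_eval l) M *m B \in unitmx.
  by rewrite unitmxE unitfE.
apply: leq_trans (mxrankM_maxl _ _) _; exact: mxrankM_maxr.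
Qed.

Lemma prod_semicontinuous (I : finType) (P : I -> K -> Prop) l0 :
  (forall i, exists u : {poly K}, u.[l0] != 0 /\ forall l, u.[l] != 0 -> P i l) ->
  exists u : {poly K}, u.[l0] != 0 /\ forall l, u.[l] != 0 -> forall i, P i l.
Proof.
move=> h.
suff [u [u0 hu]] : exists u : {poly K}, u.[l0] != 0 /\
    forall l, u.[l] != 0 -> {in enum I, forall i, P i l}.
  by exists u; split=> // l ul i; apply: hu => //; rewrite mem_enum.
elim: (enum I) => [|i s [u [u0 hu]]].
  by exists 1; split; [rewrite hornerC oner_neq0|].
have [v [v0 hv]] := h i; exists (v * u); split; first by rewrite hornerM mulf_neq0.
move=> l; rewrite hornerM mulf_eq0 negb_or => /andP [vl ul] j.
by rewrite inE => /orP [/eqP ->|]; [apply: hv|apply: hu].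
Qed.

End Semicontinuity.

Section RowSpaces.
Local Open Scope ring_scope.
Variables (T : finType) (K : fieldType).
Implicit Types (g h : T -> {ffun T -> K^o}) (H X : {set {set T}}) (Q R Y : {set T}).
Implicit Types x : {ffun {set T} -> K^o}.

Notation N := #|{: {set T}}|.

Definition rowof H x : 'rV[K]_N :=
  \row_j (if enum_val j \in H then x (enum_val j) else 0).

Definition gmx g H X : 'M[K]_(N, N) :=
  \matrix_(i < N) (if enum_val i \in X then rowof H (gs g (enum_val i)) else 0).

Definition rho g H X := \rank (gmx g H X).

Lemma row_gmx g H X Q : Q \in X -> row (enum_rank Q) (gmx g H X) = rowof H (gs g Q).
Proof. by move=> QX; rewrite rowK enum_rankK QX. Qed.

Lemma rowof_sum H (c : {set T} -> K) (F : {set T} -> {ffun {set T} -> K^o}) X :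
  rowof H (\sum_(R in X) c R *: F R) = \sum_(R in X) c R *: rowof H (F R).
Proof.
apply/rowP => j; rewrite summxE mxE; case: ifP => hj; last first.
  by rewrite big1 // => R _; rewrite !mxE hj mulr0.
by rewrite sum_ffunE; apply: eq_bigr => R _; rewrite scale_ffE !mxE hj.
Qed.

Lemma rowof_eq H x y : rowof H x = rowof H y <-> {in H, x =1 y}.
Proof.
split=> [/rowP h Y YH|h].
  by have := h (enum_rank Y); rewrite !mxE enum_rankK YH.
by apply/rowP => j; rewrite !mxE; case: ifP => // jH; rewrite h.
Qed.

Lemma rowofD H x y : rowof H (x + y) = rowof H x + rowof H y.
Proof.
apply/rowP => j; rewrite !mxE; case: ifP => _; last by rewrite addr0.
by rewrite add_ffE.
Qed.

Lemma rowofZ H c x : rowof H (c *: x) = c *: rowof H x.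
Proof.
apply/rowP => j; rewrite !mxE; case: ifP => _; last by rewrite mulr0.
by rewrite scale_ffE.
Qed.

Definition unrow (v : 'rV[K]_N) : {ffun {set T} -> K^o} :=
  [ffun Y => v 0 (enum_rank Y)].

Lemma sub_gmxP g H X x : reflect
  (exists c : {set T} -> K, {in H, x =1 \sum_(R in X) c R *: gs g R})
  (rowof H x <= gmx g H X)%MS.
Proof.
apply: (iffP submxP) => [[v hv]|[c hc]].
  exists (fun R => v 0 (enum_rank R)); apply/rowof_eq; rewrite hv mulmx_sum_row rowof_sum.
  rewrite (reindex (@enum_rank _)) /=; last by apply: onW_bij; apply: enum_rank_bij.
  rewrite [RHS]big_mkcond; apply: eq_bigr => R _; rewrite rowK enum_rankK.
  by case: ifP => // _; rewrite scaler0.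
exists (\row_i c (enum_val i)); have /rowof_eq -> := hc.
rewrite rowof_sum mulmx_sum_row (reindex (@enum_rank _)) /=; last first.
  by apply: onW_bij; apply: enum_rank_bij.
rewrite big_mkcond; apply: eq_bigr => R _; rewrite rowK mxE enum_rankK.
by case: ifP => // _; rewrite scaler0.
Qed.

Lemma rho_le_card g H X : (rho g H X <= #|H|)%N.
Proof.
pose A : 'M[K]_(N, #|H|) := \matrix_(i, k)
  (if enum_val i \in X then gs g (enum_val i) (enum_val k) else 0).
pose B : 'M[K]_(#|H|, N) := \matrix_(k, j) (enum_val k == enum_val j)%:R.
suff e : gmx g H X = A *m B by rewrite /rho e; apply: leq_trans (mxrankM_maxl _ _) (rank_leq_col _).
apply/matrixP => i j; rewrite !mxE.
case: (boolP (enum_val j \in H)) => jH; last first.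
  rewrite big1; last first.
    move=> k _; rewrite !mxE; case: eqP => [e|]; last by rewrite mulr0.
    by rewrite -e enum_valP in jH.
  by case: ifP; rewrite mxE ?(negbTE jH).
rewrite (bigD1 (enum_rank_in jH (enum_val j))) //= !mxE enum_rankK_in // eqxx mulr1.
rewrite big1 ?addr0.
  by case: ifP; rewrite mxE ?jH.
move=> k kj; rewrite !mxE; case: eqP => [e|]; last by rewrite mulr0.
by case/eqP: kj; apply: enum_val_inj; rewrite enum_rankK_in.
Qed.

Definition shiftg g l h : T -> {ffun T -> K^o} := fun i => g i + l *: h i.

Lemma rho_semicontinuous g h l0 : exists u : {poly K}, u.[l0] != 0 /\
  forall l, u.[l] != 0 -> forall H X, (rho (shiftg g l0 h) H X <= rho (shiftg g l h) H X)%N.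
Proof.
pose gp i : {ffun T -> {poly K}^o} := [ffun a => ((g i a)%:P + (h i a)%:P * 'X : {poly K})].
have hgp l i a : (gp i a : {poly K}).[l] = shiftg g l h i a.
  by rewrite ffunE hornerD hornerM !hornerC hornerX add_ffE scale_ffE mulrC.
pose M (HX : {set {set T}} * {set {set T}}) : 'M[{poly K}]_(N, N) := \matrix_(i, j)
  (if (enum_val i \in HX.2) && (enum_val j \in HX.1)
   then (gs gp (enum_val i) (enum_val j) : {poly K}) else 0).
have ME l HX : map_mx (horner_eval l) (M HX) = gmx (shiftg g l h) HX.1 HX.2.
  apply/matrixP => i j; rewrite !mxE /horner_eval.
  case: (enum_val i \in HX.2) => /=; rewrite mxE ?horner0 //.
  by case: ifP => _; [exact: horner_gs (hgp l) _ _|exact: horner0].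
have [u [u0 hu]] := prod_semicontinuous (fun HX => rank_semicontinuous (M HX) l0).
exists u; split=> // l ul H X.
by have := hu l ul (H, X); rewrite !ME.
Qed.

End RowSpaces.


Section AlgebraicShifting.
Local Open Scope ring_scope.
Variables (T : finType) (K : closedFieldType).
Implicit Types (g h : T -> {ffun T -> K^o}) (H X : {set {set T}}) (P Q R Y : {set T}).
Implicit Types x y : {ffun {set T} -> K^o}.

(** Either [u] is constant, or it takes the value 1 at a root of [u - 1]. *)
Lemma nonroot (u : {poly K}) : u != 0 -> exists a, u.[a] != 0.
Proof.
move=> u0; case: (boolP (size (u - 1) == 1%N)).
  case/size_poly1P => c c0 /(canRL (subrK _)) e; exists 0.
  by move: u0; rewrite e -polyCD hornerC polyC_eq0.
case/closed_rootP => a /rootP; rewrite hornerD hornerN hornerC => /eqP.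
by rewrite subr_eq0 => /eqP e; exists a; rewrite e oner_neq0.
Qed.

Lemma rho_eq g g' H X : g =1 g' -> rho g H X = rho g' H X.
Proof.
move=> gg; rewrite /rho; congr (\rank _); apply/matrixP => i j; rewrite !mxE.
by rewrite (gs_eq (g' := g')) // => a _; apply: gg.
Qed.

(** On the line through [g] and [g'], all but finitely many points have ranks at least those at both
    given points. *)
Lemma rho_common_bound g g' : exists g'', forall H X,
  (rho g H X <= rho g'' H X)%N /\ (rho g' H X <= rho g'' H X)%N.
Proof.
pose h i := g' i - g i.
have [u [u0 hu]] := rho_semicontinuous g h 0.
have [v [v0 hv]] := rho_semicontinuous g h 1.
have [l] : exists l, (u * v).[l] != 0.
  apply: nonroot; rewrite mulf_neq0 //.
    by apply: contraNneq u0 => ->; rewrite horner0.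
  by apply: contraNneq v0 => ->; rewrite horner0.
rewrite hornerM mulf_eq0 negb_or => /andP [ul vl].
exists (shiftg g l h) => H X; split.
  by rewrite (rho_eq (g' := shiftg g 0 h)) ?hu // => i; rewrite /shiftg scale0r addr0.
rewrite (rho_eq (g' := shiftg g 1 h)) ?hv // => i.
by rewrite /shiftg scale1r addrC subrK.
Qed.

(* Genericity is only needed up to the ranks of finitely many matrices. *)
Definition generic g := forall g' H X, (rho g' H X <= rho g H X)%N.

Definition total_rank g := (\sum_(HX : {set {set T}} * {set {set T}}) rho g HX.1 HX.2)%N.

(** The sum of all ranks is bounded, so it has a maximizer. If some single rank could still be
    increased, [rho_common_bound] would give a matrix with a larger sum. *)
Lemma exists_generic : exists g, generic g.
Proof.
pose bound := (\sum_(HX : {set {set T}} * {set {set T}}) #|HX.1|)%N.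
have le_bound g : (total_rank g <= bound)%N by apply: leq_sum => HX _; apply: rho_le_card.
suff [g hg] : exists g, forall g', (total_rank g' <= total_rank g)%N.
  exists g => g' H X; have [g'' hg''] := rho_common_bound g g'.
  rewrite leqNgt; apply/negP => lt.
  have := hg g''; rewrite leqNgt => /negP; apply.
  rewrite /total_rank (bigD1 (H, X)) //= [ltnRHS](bigD1 (H, X)) //=.
  rewrite -addSn leq_add ?leq_sum //=.
    by apply: leq_trans lt _; case: (hg'' H X).
  by move=> HX _; case: (hg'' HX.1 HX.2).
have [k] := ubnP (bound - total_rank (fun=> 0)).
elim: k (fun=> 0) => // k IH g hk.
case: (classic (exists g', (total_rank g < total_rank g')%N)) => [[g' lt]|no].
  by apply: (IH g'); have := le_bound g'; lia.
by exists g => g'; rewrite leqNgt; apply/negP => lt; apply: no; exists g'.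
Qed.

Lemma rowof_mem g H X Q : Q \in X -> (rowof H (gs g Q) <= gmx g H X)%MS.
Proof. by move=> QX; rewrite -(row_gmx _ _ QX) row_sub. Qed.

Lemma gmx_subP g H X m (M : 'M[K]_(m, #|{: {set T}}|)) :
  (forall Q, Q \in X -> (rowof H (gs g Q) <= M)%MS) -> (gmx g H X <= M)%MS.
Proof.
move=> h; apply/row_subP => i; rewrite rowK; case: ifP => [iX|_]; first exact: h.
exact: sub0mx.
Qed.

Lemma gmxS g H X X' : X \subset X' -> (gmx g H X <= gmx g H X')%MS.
Proof. by move/subsetP => XX'; apply: gmx_subP => Q /XX'; apply: rowof_mem. Qed.

Lemma rho_setU1 g H X Q : rho g H (Q |: X) =
  (rho g H X + ~~ (rowof H (gs g Q) <= gmx g H X)%MS)%N.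
Proof.
have e : (gmx g H (Q |: X) :=: rowof H (gs g Q) + gmx g H X)%MS.
  apply/eqmxP; apply/andP; split.
    apply: gmx_subP => R; rewrite !inE => /orP [/eqP ->|RX].
      exact: addsmxSl.
    by apply: submx_trans (rowof_mem _ _ RX) (addsmxSr _ _).
  rewrite addsmx_sub rowof_mem ?setU11 //=; apply: gmxS; exact: subsetUr.
rewrite /rho e; case: (boolP (_ <= _)%MS) => [/addsmx_idPr ->|nsub].
  by rewrite addn0.
apply/eqP; rewrite eqn_leq; apply/andP; split.
  apply: leq_trans (mxrank_adds_leqif _ _) _.
  by rewrite addnC leq_add2l rank_leq_row.
rewrite addn1 ltn_neqAle mxrankS ?addsmxSr // andbT.
apply: contra nsub => /eqP h.
have : (gmx g H X == rowof H (gs g Q) + gmx g H X)%MS.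
  by rewrite -(geq_leqif (mxrank_leqif_eq (addsmxSr _ _))) h.
by move/eqmxP => ->; exact: addsmxSl.
Qed.

(* The algebraic shift of H: the index sets Q for which gs g Q, restricted to H, is not a
   combination of products of larger weight. *)
Definition sh g H : {set {set T}} :=
  [set Q | ~~ (rowof H (gs g Q) <= gmx g H [set R : {set T} | (wt Q < wt R)%N])%MS].

(** When the products are added in order of decreasing weight, the rank jumps exactly at the members
    of the shift. *)
Lemma card_sh_up g H X : up_closed X -> #|sh g H :&: X| = rho g H X.
Proof.
move: {2}#|X| (leqnn #|X|) => n; elim: n X => [|n IH] X.
  rewrite leqn0 cards_eq0 => /eqP -> _; rewrite setI0 cards0; apply/esym/eqP.
  rewrite mxrank_eq0; apply/eqP/row_matrixP => i; rewrite rowK inE row0 //.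
case: (set_0Vmem X) => [->|[Q0 Q0X]]; first by move=> _; apply: IH; rewrite cards0.
case: (@arg_minnP _ Q0 (fun Q => Q \in X) (@wt T) Q0X) => Q QX hmin Xn upX.
have eX : X :\ Q = [set R : {set T} | (wt Q < wt R)%N].
  apply/setP => R; rewrite !inE; apply/andP/idP => [[RQ RX]|lt].
    by rewrite ltn_neqAle hmin // andbT eq_sym (inj_eq (@wt_inj T)).
  by split; [apply: contraTneq lt => ->; rewrite ltnn|apply: upX lt].
have upX' : up_closed (X :\ Q) by rewrite eX; apply: up_above.
rewrite -{2}(setD1K QX) rho_setU1 -IH //; last by move: Xn; rewrite (cardsD1 Q) QX.
rewrite (cardsD1 Q) !inE QX andbT -eX addnC; congr (_ + _)%N.
by apply: eq_card => R; rewrite !inE; case: (R == Q); rewrite /= ?andbF.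
Qed.

Lemma sh_mono g H H' : H \subset H' -> sh g H \subset sh g H'.
Proof.
move=> /subsetP HH'; apply/subsetP => Q; rewrite !inE; apply: contra.
case/sub_gmxP => c hc; apply/sub_gmxP; exists c => Y YH; apply: hc; exact: HH'.
Qed.

Lemma sh_card_eq g H Q : Q \in sh g H -> exists2 Y, Y \in H & #|Y| = #|Q|.
Proof.
rewrite inE => hQ.
case: (boolP [exists Y in H, #|Y| == #|Q|]) => [/exists_inP [Y YH /eqP]|]; first by exists Y.
rewrite negb_exists_in => /forall_inP h; have e0 : rowof H (gs g Q) = 0.
  apply/rowP => j; rewrite !mxE; case: ifP => // jH.
  by rewrite gs_supp // h.
by rewrite e0 sub0mx in hQ.
Qed.

Definition delta : T -> {ffun T -> K^o} := fun i => [ffun a => ((a == i)%:R : K)].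

Lemma L_delta i x Y : L (delta i) x Y = (if i \in Y then sg K Y i * x (Y :\ i) else 0) :> K.
Proof.
rewrite LE; case: ifP => iY.
  rewrite (bigD1 i) //= ffunE eqxx mulr1 big1 ?addr0 // => a /andP [_ /negbTE ai].
  by rewrite ffunE ai mulr0 mul0r.
rewrite big1 // => a aY; rewrite ffunE; case: eqP => [e|]; last by rewrite mulr0 mul0r.
by rewrite -e aY in iY.
Qed.

Lemma gs_delta Q Y : (gs delta Q Y != 0) = (Q == Y).
Proof.
rewrite -{2}[Q]set_enum /gs; elim: (enum Q) (enum_uniq Q) Y => [|i s IH] /= us Y.
  rewrite ffunE set_nil [set0 == Y]eq_sym; case: (Y == set0); last by rewrite eqxx.
  exact: (oner_neq0 K).
have /andP [iS {}us] := us.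
rewrite L_delta; case: ifP => iY; last first.
  rewrite eqxx; apply/esym; apply: contraFF iY => /eqP <-.
  by rewrite inE mem_head.
rewrite mulf_eq0 signr_eq0 /= IH // set_cons; apply/eqP/eqP => [->|<-].
  by rewrite setD1K.
by rewrite setU1K // inE.
Qed.

Lemma rank_delta H : (#|H| <= rho delta H setT)%N.
Proof.
rewrite -card_sh_up; last by move=> *; rewrite inE.
rewrite setIT; apply: subset_leq_card; apply/subsetP => Q QH; rewrite inE.
apply/negP => /sub_gmxP [c /(_ Q QH)]; apply/eqP; rewrite sum_ffunE big1.
  by rewrite gs_delta.
move=> R; rewrite inE => lt; rewrite scale_ffE.
have : ~~ (gs delta R Q != 0) by rewrite gs_delta; apply: contraTneq lt => ->; rewrite ltnn.
by rewrite negbK => /eqP ->; rewrite mulr0.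
Qed.

(** The bound [rho_le_card] is attained by the identity matrix [delta], hence by every generic
    matrix. *)
Lemma sh_card g H : generic g -> #|sh g H| = #|H|.
Proof.
move=> gg; have upT : up_closed [set: {set T}] by move=> *; rewrite inE.
have cT g' : #|sh g' H| = rho g' H setT by rewrite -card_sh_up // setIT.
apply/eqP; rewrite eqn_leq cT rho_le_card /=; apply: leq_trans (gg delta H setT).
exact: rank_delta.
Qed.
Lemma rowof_sum_sub H (c : {set T} -> K) (F : {set T} -> {ffun {set T} -> K^o}) X
    m (M : 'M[K]_(m, #|{: {set T}}|)) :
  (forall R, R \in X -> (rowof H (F R) <= M)%MS) ->
  (rowof H (\sum_(R in X) c R *: F R)%R <= M)%MS.
Proof. by move=> hF; rewrite rowof_sum; apply: summx_sub => R RX; rewrite scalemx_sub ?hF. Qed.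

Lemma rowof_sign H (b : bool) x m (M : 'M[K]_(m, #|{: {set T}}|)) :
  (rowof H ((-1) ^+ b *: x)%R <= M)%MS = (rowof H x <= M)%MS.
Proof.
apply/idP/idP => h; last by rewrite rowofZ scalemx_sub.
rewrite -[x]scale1r -(sqrr_sign K b) expr2 -scalerA rowofZ.
by rewrite scalemx_sub.
Qed.

(** A dependence of Q minus q on heavier products over [H'], multiplied by the vector [g q], becomes
    one for [Q] over [H]: products with a repeated [q] vanish, and additivity of weights keeps the
    others heavier. *)
Lemma sh_shadow g H H' Q q : (forall Y a, Y \in H -> a \in Y -> Y :\ a \in H') ->
  Q \in sh g H -> q \in Q -> Q :\ q \in sh g H'.
Proof.
move=> hH + qQ; rewrite !inE; apply: contra => /sub_gmxP [c hc].
have [b ->] := gs_pull K qQ; rewrite rowof_sign.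
set X := [set R : {set T} | _] in hc.
have -> : rowof H (L (g q) (gs g (Q :\ q)))
        = rowof H (\sum_(R in X) c R *: L (g q) (gs g R)).
  apply/rowof_eq => Y YH; under eq_bigr do rewrite -LZ; rewrite -L_sum.
  by apply: L_eq_on => a aY; apply: hc; apply: hH.
apply: rowof_sum_sub => R; rewrite inE => lt.
case: (boolP (q \in R)) => qR; first by rewrite L_gs0 // -(scale0r 0) rowofZ scale0r sub0mx.
have [b' ->] := L_gs K qR; rewrite rowof_sign; apply: rowof_mem.
by rewrite inE (wtD1 qQ) wtU1 // ltn_add2l.
Qed.

Lemma generic_line g h : generic g -> exists2 l, l != 0 &
  forall H X, rho (shiftg g l h) H X = rho g H X.
Proof.
move=> gg; have [u [u0 hu]] := rho_semicontinuous g h 0.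
have [l] : exists l, (u * 'X).[l] != 0.
  apply: nonroot; rewrite mulf_neq0 ?polyX_eq0 //.
  by apply: contraNneq u0 => ->; rewrite horner0.
rewrite hornerM hornerX mulf_eq0 negb_or => /andP [ul l0]; exists l => // H X.
apply/eqP; rewrite eqn_leq gg /=; apply: leq_trans (hu l ul H X).
by rewrite (rho_eq (g' := g)) // => i; rewrite /shiftg scale0r addr0.
Qed.

(* Adding l g_q to g_i, for a suitable l, keeps all ranks of a generic g, but adds a
   multiple of gs g Q to the product indexed by i |: (Q :\ q). *)
Lemma sh_shift g H Q q i : generic g -> Q \in sh g H -> q \in Q -> i \notin Q ->
  (rk i < rk q)%N -> i |: (Q :\ q) \in sh g H.
Proof.
move=> gg QH qQ iQ iq; pose R0 := i |: (Q :\ q).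
have iQq : i \notin Q :\ q by rewrite !inE negb_and iQ orbT.
have qi : q != i by apply: contraTneq iq => ->; rewrite ltnn.
pose h j := if j == i then g q else 0.
have [l l0 hl] := generic_line h gg.
pose X0 := [set R : {set T} | (wt R0 < wt R)%N].
rewrite -/R0; apply: contraLR QH; rewrite !inE !negbK -/X0 => hR0.
set M := gmx g H _.
(* The ranks over [X0] and over [R0 |: X0] agree for the two matrices, so the dependence of [R0]
   passes from [g] to the perturbed matrix. *)
have : (rowof H (gs (shiftg g l h) R0) <= gmx (shiftg g l h) H X0)%MS.
  have := rho_setU1 (shiftg g l h) H X0 R0.
  rewrite !hl rho_setU1 hR0 /= => /addnI.
  by case: (_ <= _)%MS.
have wR0 : (wt R0 + wt1 q = wt Q + wt1 i)%N.
  by rewrite (wtD1 qQ) /R0 wtU1 //; lia.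
have lt0 : (wt Q < wt R0)%N by have := wt1_lt iq; move: wR0; lia.
have gsl R : i \in R -> exists b : bool, gs (shiftg g l h) R = gs g R +
    (if q \in R then 0 else ((-1) ^+ b * l) *: gs g (q |: R :\ i)).
  move=> iR; have [b hb] := gs_pull K iR.
  have e : gs (shiftg g l h) (R :\ i) = gs g (R :\ i).
    apply: gs_eq => j; rewrite !inE => /andP [ji _].
    by rewrite /shiftg /h (negbTE ji) scaler0 addr0.
  have hi : shiftg g l h i = g i + l *: g q by rewrite /shiftg /h eqxx.
  case: (boolP (q \in R)) => qR.
    exists b; rewrite (hb (shiftg g l h)) [in RHS](hb g) e hi LDl LZl scalerDr addr0.
    by rewrite [L (g q) _]L_gs0 ?scaler0 ?addr0 // !inE qi.
  have [|b' hb'] := @L_gs T K q (R :\ i); first by rewrite !inE negb_and qR orbT.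
  exists (b (+) b'); rewrite (hb (shiftg g l h)) [in RHS](hb g) e hi LDl LZl scalerDr; congr (_ + _).
  by rewrite hb' !scalerA signr_addb mulrAC.
have gsl' R : i \notin R -> gs (shiftg g l h) R = gs g R.
  move=> iR; apply: gs_eq => j jR; rewrite /shiftg /h.
  by case: eqP => [e|]; rewrite ?scaler0 ?addr0 // -e jR in iR *.
(* Trading [i] for [q] changes the weights of R and of [R0] by the same amount and turns [R0] into
   [Q]; so the extra term of a product heavier than [R0] is heavier than [Q]. *)
have sub : (gmx (shiftg g l h) H X0 <= M)%MS.
  apply: gmx_subP => R; rewrite inE => lt.
  have RM : (rowof H (gs g R) <= M)%MS by apply: rowof_mem; rewrite inE (ltn_trans lt0).
  case: (boolP (i \in R)) => iR; last by rewrite gsl'.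
  have [b ->] := gsl R iR; rewrite rowofD addmx_sub //.
  case: (boolP (q \in R)) => qR; first by rewrite -(scale0r 0) rowofZ scale0r sub0mx.
  rewrite rowofZ scalemx_sub // rowof_mem // inE wtU1; last by rewrite !inE negb_and qR orbT.
  by have := wtD1 iR; move: lt wR0; lia.
move=> /submx_trans /(_ sub).
have [|b ->] := gsl R0; first by rewrite !inE eqxx.
have -> : q \in R0 = false by rewrite !inE (negbTE qi) eqxx.
have -> : q |: R0 :\ i = Q by rewrite setU1K // setD1K.
rewrite rowofD => h1.
have : (rowof H (((-1) ^+ b * l) *: gs g Q)%R <= M)%MS.
  rewrite -[X in (X <= _)%MS](addKr (rowof H (gs g R0))) addmx_sub //.
  by rewrite -scaleN1r scalemx_sub // rowof_mem // inE.
by rewrite -scalerA rowof_sign rowofZ eqmx_scale.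
Qed.

End AlgebraicShifting.


(** * Coproduct and Laplace expansion in the exterior algebra *)

Section Laplace.
Local Open Scope ring_scope.
Variables (T : finType) (K : fieldType).
Implicit Types (Y Z A Q : {set T}).

(* [lap g s Y Z] is the component in degree (Y, Z) of the product of the vectors
   g_i placed diagonally in two copies of the vector space. *)
Fixpoint lap (g : T -> {ffun T -> K^o}) (s : seq T) Y Z : K :=
  if s is i :: s' then
    \sum_(a in Y) sg K Y a * g i a * lap g s' (Y :\ a) Z +
    (-1) ^+ #|Y| * \sum_(a in Z) sg K Z a * g i a * lap g s' Y (Z :\ a)
  else ((Y == set0) && (Z == set0))%:R.

Lemma sg_prod Y a : sg K Y a = \prod_(b in Y) (-1) ^+ (rk b < rk a)%N.
Proof.
rewrite /sg -sum1_card big_mkcond (big_morph (fun n => (-1) ^+ n) (exprD (-1)) (expr0 _)) /=.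
rewrite [RHS]big_mkcond; apply: eq_bigr => b _; rewrite !inE.
by case: (b \in Y) => //=; case: (_ < _)%N.
Qed.

(** The sign of the shuffle sorting Y followed by Z, one factor -1 for each inversion. *)
Definition eps Y Z : K := \prod_(a in Y) sg K Z a.

Lemma eps_pull_l Y Z a : a \in Y -> eps Y Z = sg K Z a * eps (Y :\ a) Z.
Proof. by move=> aY; rewrite /eps (big_setD1 a). Qed.

Lemma sgU Y Z a : [disjoint Y & Z] -> sg K (Y :|: Z) a = sg K Y a * sg K Z a.
Proof.
move=> dYZ; rewrite !sg_prod -bigU //; apply: eq_bigl => b; by rewrite !inE.
Qed.

Lemma sgD1 Z a : sg K (Z :\ a) a = sg K Z a.
Proof.
congr (_ ^+ _); apply: eq_card => b; rewrite !inE.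
by case: (eqVneq b a) => [->|] //=; rewrite ltnn andbF.
Qed.

Lemma eps_pull_r Y Z a : a \notin Y -> a \in Z ->
  sg K Y a * eps Y Z = (-1) ^+ #|Y| * eps Y (Z :\ a).
Proof.
move=> aY aZ; rewrite sg_prod /eps -sum1_card.
rewrite (big_morph (fun n => (-1) ^+ n) (exprD (-1)) (expr0 _)) -!big_split /=.
apply: eq_bigr => b bY; rewrite [sg K Z b]sg_prod (big_setD1 a aZ) /= -sg_prod mulrA expr1.
congr (_ * _); have : rk b != rk a.
  by rewrite (inj_eq (@rk_inj T)); apply: contraNneq aY => <-.
by case: ltngtP => //= _ _; rewrite ?mulr1 ?mul1r.
Qed.

Lemma lap_disjoint g s Y Z : [disjoint Y & Z] ->
  lap g s Y Z = eps Y Z * Ls g s (one T K) (Y :|: Z).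
Proof.
elim: s Y Z => [|i s IH] Y Z dYZ /=.
  rewrite ffunE setU_eq0; case: eqP => [->|] /=; last by rewrite mulr0.
  by rewrite /eps big_set0 mul1r.
rewrite LE [in LHS]mulr_sumr [in RHS]mulr_sumr [in RHS](eq_bigl [predU Y & Z]);
  last by move=> a; rewrite !inE.
rewrite bigU //=; congr (_ + _); apply: eq_bigr => a aYZ.
  have aZ : a \notin Z by rewrite (disjointFr dYZ).
  have e : (Y :|: Z) :\ a = (Y :\ a) :|: Z.
    by rewrite setDUl [Z :\ a](setDidPl _) // disjoint_sym disjoints1.
  rewrite IH; last by apply: disjointWl dYZ; apply: subD1set.
  have h : sg K Z a * sg K Z a = 1 by apply: sg_sq.
  rewrite e sgU // (eps_pull_l _ aYZ) -[LHS]mul1r -h; ring.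
have aY : a \notin Y by rewrite (disjointFl dYZ).
have e : (Y :|: Z) :\ a = Y :|: (Z :\ a).
  by rewrite setDUl [Y :\ a](setDidPl _) // disjoint_sym disjoints1.
rewrite IH; last by apply: disjointWr dYZ; apply: subD1set.
rewrite e sgU //.
have h := eps_pull_r aY aYZ.
transitivity (sg K Z a * g i a * ((-1) ^+ #|Y| * eps Y (Z :\ a)) *
   Ls g s (one T K) (Y :|: Z :\ a)); first by ring.
by rewrite -h; ring.
Qed.

(** At a common vertex [v], terms removing another vertex vanish by induction, and the two terms
    removing [v] from one copy or the other either both vanish or have opposite signs. *)
Lemma lap_meet g s Y Z : ~~ [disjoint Y & Z] -> lap g s Y Z = 0.
Proof.
elim: s Y Z => [|i s IH] Y Z /= mYZ.
  case: eqP mYZ => //= ->; by rewrite -setI_eq0 set0I eqxx.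
have /pred0Pn [v /= /andP [vY vZ]] := mYZ.
rewrite (bigD1 v) //= [X in _ + X + _]big1 ?addr0; last first.
  move=> a /andP [aY av]; rewrite IH ?mulr0 //; apply/pred0Pn; exists v.
  by rewrite /= !inE eq_sym av vY.
rewrite [X in _ + _ * X](bigD1 v) //= [X in _ + _ * (_ + X)]big1 ?addr0; last first.
  move=> a /andP [aZ av]; rewrite IH ?mulr0 //; apply/pred0Pn; exists v.
  by rewrite /= !inE eq_sym av vY.
case: (boolP [disjoint Y :\ v & Z]) => dYZ; last first.
  rewrite IH // mulr0 add0r IH ?mulr0 //.
  have /pred0Pn [u /= /andP []] := dYZ; rewrite !inE => /andP [uv uY] uZ.
  by apply/pred0Pn; exists u; rewrite /= !inE uv uY.
have dYZ' : [disjoint Y & Z :\ v].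
  apply: contraTT dYZ => /pred0Pn [u /= /andP [uY]]; rewrite !inE => /andP [uv uZ].
  by apply/pred0Pn; exists u; rewrite /= !inE uv uY.
rewrite !lap_disjoint //.
have -> : Y :|: Z :\ v = Y :\ v :|: Z.
  by apply/setP => u; rewrite !inE; case: (eqVneq u v) => [->|] //=; rewrite vY vZ.
have nv : v \notin Y :\ v by rewrite !inE eqxx.
have h1 := eps_pull_r nv vZ; rewrite sgD1 in h1.
have h2 := eps_pull_l (Z :\ v) vY; rewrite sgD1 in h2.
have h3 : (-1) ^+ #|Y| = - (-1) ^+ #|Y :\ v| :> K.
  by rewrite [in LHS](cardsD1 v) vY add1n exprS mulN1r.
set X := Ls _ _ _ _; have h : sg K Z v * sg K Z v = 1 by apply: sg_sq.
transitivity (g i v * X * (sg K Y v * eps (Y :\ v) Z) +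
  g i v * X * ((-1) ^+ #|Y| * (sg K Z v * eps Y (Z :\ v)))); first by ring.
by rewrite h1 h2 h3 mulrA h mul1r mulNr mulrN subrr.
Qed.

(** The same coproduct expanded along rows: each vector goes to one of the two copies, and [A]
    collects those going to the first. The coefficients are signs, of which only nonvanishing is
    needed later. *)
Lemma lap_split g s : uniq s -> exists c : {set T} -> K, (forall A, c A != 0) /\
  forall Y Z, lap g s Y Z =
    \sum_(A : {set T} | A \subset [set i in s]) c A * gs g A Y * gs g ([set i in s] :\: A) Z.
Proof.
elim: s => [|i s IH] /= => [_|/andP [iS /IH [c [c0 hc]]]].
  exists (fun=> 1); split=> [A|Y Z]; first exact: oner_neq0.
  rewrite (big_pred1 set0); last by move=> A; rewrite set_nil subset0.
  rewrite set_nil set0D mul1r /gs enum_set0 /= !ffunE -natrM mulnb //.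
set U := [set j in s] in hc; set U' := [set j in i :: s].
have U'E : U' = i |: U by rewrite /U' set_cons.
have iU : i \notin U by rewrite inE.
have [b hb] : exists b : {set T} -> bool, forall A, i \notin A ->
    L (g i) (gs g A) = (-1) ^+ b A *: gs g (i |: A).
  suff /fin_all_exists [b hb] : forall A : {set T}, exists b : bool, i \notin A ->
    L (g i) (gs g A) = (-1) ^+ b *: gs g (i |: A) by exists b.
  move=> A; case: (boolP (i \in A)) => iA; first by exists false.
  by have [b hb] := L_gs K iA; exists b.
exists (fun A => if i \in A then c (A :\ i) * (-1) ^+ b (A :\ i)
                else c A * (-1) ^+ #|A| * (-1) ^+ b (U :\: A)); split=> [A|Y Z].
  by case: ifP => _; rewrite !mulf_neq0 ?signr_eq0.
have sub A : A \subset U -> i \notin A by move=> /subsetP h; apply: contra iU; apply: h.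
rewrite [RHS](bigID (fun A => i \in A)) /=; congr (_ + _).
  transitivity (\sum_(A : {set T} | A \subset U) c A * L (g i) (gs g A) Y * gs g (U :\: A) Z).
    under eq_bigr do rewrite hc mulr_sumr.
    rewrite exchange_big; apply: eq_bigr => A _ /=.
    by rewrite LE mulr_sumr mulr_suml; apply: eq_bigr => a _; ring.
  rewrite [RHS](reindex_onto (fun A => i |: A) (fun A => A :\ i)) /=; last first.
    by move=> A /andP [_ iA]; rewrite setD1K.
  apply: eq_big => A.
    rewrite setU11 andbT U'E; apply/idP/andP => [AU|[AU /eqP e]].
      by rewrite setUS // setU1K // sub.
    apply/subsetP => j jA; have := subsetP AU j; rewrite !inE jA orbT => /(_ isT).
    by case/orP => // /eqP ji; move: jA; rewrite -e ji !inE eqxx.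
  move=> AU; rewrite setU11 setU1K ?sub // hb ?sub // scale_ffE.
  have -> : U' :\: (i |: A) = U :\: A.
    rewrite U'E; apply/setP => j; rewrite !inE.
    by case: (eqVneq j i) iU => [->|] //= ; rewrite inE => /negbTE ->; rewrite andbF.
  by ring.
transitivity (\sum_(A : {set T} | A \subset U)
   (-1) ^+ #|Y| * (c A * gs g A Y * L (g i) (gs g (U :\: A)) Z)).
  rewrite -mulr_sumr; congr (_ * _).
  under eq_bigr do rewrite hc mulr_sumr.
  rewrite exchange_big; apply: eq_bigr => A _ /=.
  by rewrite LE mulr_sumr; apply: eq_bigr => a _; ring.
apply: eq_big => A.
  apply/idP/andP => [AU|[AU iA]]; first by rewrite U'E (subset_trans AU) ?subsetUr // sub.
  apply/subsetP => j jA; have := subsetP AU j jA; rewrite U'E !inE.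
  by case/orP => // /eqP ji; rewrite -ji jA in iA.
move=> AU; rewrite (negbTE (sub _ AU)) hb; last by rewrite inE (negbTE iU) andbF.
have -> : U' :\: A = i |: U :\: A.
  rewrite U'E; apply/setP => j; rewrite !inE.
  by case: (eqVneq j i) => [->|] //=; rewrite (sub _ AU).
(* [lap] carries a sign depending on |Y|, while [c] may depend only on [A]; the minor [gs g A Y]
   vanishes unless the two sizes agree. *)
rewrite scale_ffE; case: (eqVneq #|Y| #|A|) => [->|YA]; first by ring.
by rewrite (gs_supp _ YA); ring.
Qed.

End Laplace.


Section CrossIntersectingShifts.
Local Open Scope ring_scope.
Variables (T : finType) (K : closedFieldType).
Implicit Types (g : T -> {ffun T -> K^o}) (H X : {set {set T}}) (A P Q R Y Z : {set T}).

Lemma sh_functional g H Q : Q \in sh g H -> exists phi : {set T} -> K,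
  \sum_(Y in H) phi Y * gs g Q Y != 0 /\
  forall R, (wt Q < wt R)%N -> \sum_(Y in H) phi Y * gs g R Y = 0.
Proof.
rewrite inE submxE => h; set C := cokermx _ in h.
have [j hj] : exists j, (rowof H (gs g Q) *m C) 0 j != 0.
  apply/existsP; apply: contraR h; rewrite negb_exists => /forallP h.
  by apply/eqP/rowP => j; rewrite [RHS]mxE; apply/eqP; have := h j; rewrite negbK.
have e R : (rowof H (gs g R) *m C) 0 j = \sum_(Y in H) C (enum_rank Y) j * gs g R Y.
  rewrite mxE (reindex (@enum_rank _)) /=; last by apply: onW_bij; apply: enum_rank_bij.
  rewrite [RHS]big_mkcond; apply: eq_bigr => Y _; rewrite mxE enum_rankK.
  by case: ifP => _; rewrite ?mul0r // mulrC.
exists (fun Y => C (enum_rank Y) j); rewrite -e; split=> // R lt.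
rewrite -e; have /submxP [D ->] : (rowof H (gs g R) <=
    gmx g H [set R' : {set T} | (wt Q < wt R')%N])%MS by rewrite rowof_mem // inE.
by rewrite -mulmxA mulmx_coker mulmx0 mxE.
Qed.

(* Functionals with leading terms Q and Q' have a product with leading term Q :|: Q' when
   Q and Q' are disjoint, but the product vanishes on cross-intersecting families. *)
Lemma sh_cross g H H' Q Q' :
  (forall Y Z, Y \in H -> Z \in H' -> ~~ [disjoint Y & Z]) ->
  Q \in sh g H -> Q' \in sh g H' -> ~~ [disjoint Q & Q'].
Proof.
move=> hHH' QH QH'; apply/negP => dQQ'.
have [phi [phiQ hphi]] := sh_functional QH.
have [psi [psiQ hpsi]] := sh_functional QH'.
pose U := Q :|: Q'; have [c [c0 hc]] := lap_split g (enum_uniq U).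
have Uset : [set i in enum U] = U by apply/setP => i; rewrite inE mem_enum.
rewrite Uset in hc.
pose Phi R := \sum_(Y in H) phi Y * gs g R Y.
pose Psi R := \sum_(Y in H') psi Y * gs g R Y.
have h0 : \sum_(A : {set T} | A \subset U) c A * (Phi A * Psi (U :\: A)) = 0.
  transitivity (\sum_(Y in H) \sum_(Z in H') phi Y * psi Z * lap g (enum U) Y Z).
    under [RHS]eq_bigr do under eq_bigr do rewrite hc mulr_sumr.
    under [RHS]eq_bigr do rewrite exchange_big.
    rewrite [RHS]exchange_big; apply: eq_bigr => A _ /=.
    rewrite /Phi /Psi mulr_suml mulr_sumr; apply: eq_bigr => Y _.
    by rewrite mulr_sumr mulr_sumr; apply: eq_bigr => Z _; ring.
  by rewrite big1 // => Y YH; rewrite big1 // => Z ZH; rewrite lap_meet ?mulr0 // hHH'.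
move: h0; rewrite (bigD1 Q) ?subsetUl //= big1 ?addr0.
  have -> : U :\: Q = Q' by rewrite /U setDUl setDv set0U; apply/setDidPl; rewrite disjoint_sym.
  move/eqP; rewrite mulf_eq0 (negbTE (c0 _)) /= mulf_eq0.
  by rewrite (negbTE phiQ) (negbTE psiQ).
move=> A /andP [AU AQ].
(* The weights of the two parts have a constant sum, so a split other than A = Q makes one part
   heavier than its leading term, where its functional is zero. *)
have wA : (wt A + wt (U :\: A) = wt Q + wt Q')%N.
  rewrite -[in RHS]wtU // -wtU; last by rewrite -setI_eq0 setDE setICA setICr setI0.
  congr wt; apply/setP => a; rewrite !inE; case: (boolP (a \in A)) => //= aA.
  by have := subsetP AU a aA; rewrite inE.
case: (ltngtP (wt A) (wt Q)) => [lt|gt|/wt_inj e]; last by rewrite e eqxx in AQ.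
  by rewrite [Psi _]hpsi ?mulr0 //; move: wA lt; lia.
by rewrite [Phi _]hphi ?mul0r ?mulr0.
Qed.

End CrossIntersectingShifts.

(** * Initial segments in the shift of a Cohen-Macaulay complex *)

Section ShiftOfCohenMacaulay.
Local Open Scope ring_scope.
Variables (T : finType) (K : closedFieldType) (al : T -> K).
Hypothesis al_inj : injective al.
Variables (S : {set {set T}}) (m : nat).
Hypotheses (dS : down_closed S) (cS : coCM K S m).
Implicit Types (g : T -> {ffun T -> K^o}) (H X : {set {set T}}) (A P Q R Y Z : {set T}).
Implicit Types x y : {ffun {set T} -> K^o}.

Definition vg : T -> {ffun T -> K^o} := fun i => vec al 'X^(rk i).

Definition inspan g X x :=
  exists c : {set T} -> K, x = \sum_(R in X) c R *: gs g R.

Lemma inspan_gs g X R : R \in X -> inspan g X (gs g R).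
Proof.
move=> RX; exists (fun R' => (R' == R)%:R); rewrite (bigD1 R) //= eqxx scale1r big1 ?addr0 //.
by move=> R' /andP [_ /negbTE ->]; rewrite scale0r.
Qed.

Lemma inspan0 g X : inspan g X 0.
Proof. by exists (fun=> 0); rewrite big1 // => R _; rewrite scale0r. Qed.

Lemma inspanD g X x y : inspan g X x -> inspan g X y -> inspan g X (x + y).
Proof.
case=> c -> [c' ->]; exists (fun R => c R + c' R); rewrite -big_split.
by apply: eq_bigr => R _; rewrite scalerDl.
Qed.

Lemma inspanZ g X a x : inspan g X x -> inspan g X (a *: x).
Proof.
case=> c ->; exists (fun R => a * c R); rewrite scaler_sumr.
by apply: eq_bigr => R _; rewrite scalerA.
Qed.

Lemma inspan_sum g X I (r : seq I) (P : pred I) (F : I -> {ffun {set T} -> K^o}) :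
  (forall i, P i -> inspan g X (F i)) -> inspan g X (\sum_(i <- r | P i) F i).
Proof. by move=> h; apply: (big_ind (inspan g X)) => //; [apply: inspan0|apply: inspanD]. Qed.

Lemma inspanS g X X' x : X \subset X' -> inspan g X x -> inspan g X' x.
Proof.
move=> /subsetP XX' [c ->]; apply: inspan_sum => R /XX' RX; exact/inspanZ/inspan_gs.
Qed.

Lemma inspan_L g X X' i x : (forall R, R \in X -> i \notin R -> i |: R \in X') ->
  inspan g X x -> inspan g X' (L (g i) x).
Proof.
move=> h [c ->]; rewrite L_sum; apply: inspan_sum => R RX; rewrite LZ; apply: inspanZ.
case: (boolP (i \in R)) => iR; first by rewrite L_gs0 //; apply: inspan0.
by have [b ->] := L_gs K iR; apply/inspanZ/inspan_gs/h.
Qed.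

Lemma inspan_rowof g H X x : inspan g X x -> (rowof H x <= gmx g H X)%MS.
Proof. by case=> c e; apply/sub_gmxP; exists c => Y _; rewrite e. Qed.

(** A vector in the left kernel lists the coefficients of a polynomial of size at most |T| that
    vanishes at |T| distinct points. *)
Lemma vandermonde_span (w : {ffun T -> K^o}) :
  exists c : T -> K, w = \sum_i c i *: vg i.
Proof.
pose V : 'M[K]_#|T| := \matrix_(i, t) al (enum_val t) ^+ i.
have : row_free V.
  rewrite -kermx_eq0; apply/rowV0P => v /sub_kermxP vV.
  pose p := \poly_(i < #|T|) (if insub i is Some j then v 0 j else 0).
  have pE (i : 'I_#|T|) : p`_i = v 0 i.
    rewrite coef_poly ltn_ord; case: insubP => [j _ e|/negP []//].
    by congr (v 0 _); apply: val_inj.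
  suff p0 : p = 0 by apply/rowP => i; rewrite -pE p0 coef0 mxE.
  apply/eqP; apply: contraTT isT => pn0.
  have /(max_poly_roots pn0) : all (root p) [seq al t | t <- enum T].
    apply/allP => _ /mapP [t _ ->]; apply/rootP.
    have /rowP /(_ (enum_rank t)) := vV; rewrite [RHS]mxE => <-.
    rewrite mxE (horner_coef_wide _ (size_poly _ _)).
    by apply: eq_bigr => i _; rewrite pE mxE enum_rankK.
  rewrite map_inj_uniq // enum_uniq size_map -cardE => /(_ isT).
  by rewrite ltnNge size_poly.
rewrite row_free_unit -row_full_unit => /(submx_full (\row_t w (enum_val t))).
case/submxP => D hD; exists (fun i => D 0 (enum_rank i)); apply/ffunP => t.
have /rowP /(_ (enum_rank t)) := hD; rewrite !mxE enum_rankK => ->.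
rewrite sum_ffunE (reindex (@enum_rank _)) /=; last by apply: onW_bij; apply: enum_rank_bij.
by apply: eq_bigr => i _; rewrite scale_ffE ffunE hornerXn mxE enum_rankK.
Qed.

Lemma inspan_all x : inspan vg setT x.
Proof.
have spanL w y : inspan vg setT y -> inspan vg setT (L w y).
  have [c ->] := vandermonde_span w => hy.
  have -> : L (\sum_i c i *: vg i) y = \sum_i c i *: L (vg i) y.
    apply/ffunP => Y; rewrite sum_ffunE LE.
    under eq_bigr do rewrite sum_ffunE mulr_sumr mulr_suml.
    rewrite exchange_big; apply: eq_bigr => i _ /=; rewrite scale_ffE LE mulr_sumr.
    by apply: eq_bigr => a _; rewrite scale_ffE; ring.
  apply: inspan_sum => i _; apply/inspanZ; by apply: inspan_L hy => R _ _; rewrite inE.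
have -> : x = \sum_Y (x Y * (gs (delta K) Y Y)^-1 : K) *: gs (@delta T K) Y.
  apply/ffunP => Y; rewrite sum_ffunE (bigD1 Y) //= big1 ?addr0.
    by rewrite scale_ffE mulrVK // unitfE gs_delta eqxx.
  move=> Z ZY; rewrite scale_ffE.
  have : ~~ (gs (@delta T K) Z Y != 0) by rewrite gs_delta.
  by rewrite negbK => /eqP ->; rewrite mulr0.
apply: inspan_sum => Y _; apply: inspanZ; rewrite /gs.
elim: (enum Y) => [|i s IH] /=; last exact: spanL.
have <- : gs vg set0 = one T K by rewrite /gs enum_set0.
by apply: inspan_gs; rewrite inE.
Qed.

Lemma initsegS p : (p < #|T|)%N -> exists2 i, rk i = p & initseg T p.+1 = i |: initseg T p.
Proof.
move=> pT; exists (enum_val (Ordinal pT)); first by rewrite /rk enum_valK.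
apply/setP => a; rewrite !inE ltnS leq_eqVlt; congr (_ || _).
by rewrite -(inj_eq (@rk_inj T)) /rk enum_valK.
Qed.

Lemma vandermonde_prod_span p A x : (p <= #|T|)%N ->
  inspan vg [set R : {set T} | A \subset R] x ->
  inspan vg [set R : {set T} | A :|: initseg T p \subset R] (vandermonde_prod al p x).
Proof.
elim: p A x => [|p IH] A x pT hx /=.
  apply: inspanS hx; apply/subsetP => R; rewrite !inE => h.
  by rewrite subUset h; apply/subsetP => a; rewrite inE.
have [i ri ->] := initsegS pT; rewrite setUCA setUA; apply: IH; first exact: ltnW.
rewrite -ri; apply: inspan_L hx => R; rewrite !inE => h _; exact: setUS.
Qed.

Lemma comb_span p c : (p <= #|T|)%N ->
  inspan vg [set R : {set T} | ~~ [disjoint R & initseg T p]] (comb al p c).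
Proof.
move=> pT; apply: inspan_sum => i _.
have iT := leq_trans (ltn_ord i) pT.
have [j rj _] := initsegS iT.
rewrite -rj; apply: inspan_L (inspan_all _) => R _ _; rewrite inE.
by apply/pred0Pn; exists j; rewrite /= !inE eqxx rj ltn_ord.
Qed.

Lemma vandermonde_prodD p x y :
  vandermonde_prod al p (x + y) = vandermonde_prod al p x + vandermonde_prod al p y.
Proof. by elim: p x y => //= p IH x y; rewrite LD IH. Qed.

Lemma vandermonde_prodZ p c x :
  vandermonde_prod al p (c *: x) = c *: vandermonde_prod al p x.
Proof. by elim: p x => //= p IH x; rewrite LZ IH. Qed.

Lemma level_eqon k x y : eqon S k x y -> rowof (level S k) x = rowof (level S k) y.
Proof. by move=> h; apply/rowof_eq => Y; rewrite inE => /andP [YS /eqP Yk]; apply: h. Qed.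

(** Rank-nullity for multiplication by the product of the first [p] rows. The image is spanned by
    products whose index set contains the initial segment; the kernel lies in the ideal of these
    rows, spanned by products whose index set meets it. *)
Lemma rho_vandermonde j p : (p <= #|T|)%N -> (j + p <= m)%N ->
  (#|level S j| <= rho vg (level S (j + p)%N) [set R : {set T} | initseg T p \subset R] +
    rho vg (level S j) [set R : {set T} | ~~ [disjoint R & initseg T p]])%N.
Proof.
move=> pT jp.
pose M : 'M[K]_#|{: {set T}}| := \matrix_i
  rowof (level S (j + p)%N) (vandermonde_prod al p (unrow (delta_mx 0 i))).
have vM v : v *m M = rowof (level S (j + p)%N) (vandermonde_prod al p (unrow v)).
  rewrite mulmx_sum_row.
  have -> : unrow v = \sum_i v 0 i *: unrow (delta_mx 0 i).
    apply/ffunP => Y; rewrite sum_ffunE (bigD1 (enum_rank Y)) //= big1 ?addr0.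
      by rewrite scale_ffE !ffunE mxE !eqxx mulr1.
    move=> i iY; rewrite scale_ffE !ffunE mxE [_ == i]eq_sym (negbTE iY) andbF mulr0 //.
  rewrite (big_morph _ (vandermonde_prodD p) (_ : _ = 0)); last first.
    by rewrite -(scale0r 0) vandermonde_prodZ !scale0r.
  rewrite (big_morph _ (@rowofD _ _ _) (_ : _ = 0)); last first.
    by rewrite -(scale0r 0) rowofZ !scale0r.
  by apply: eq_bigr => i _; rewrite rowK vandermonde_prodZ rowofZ.
pose E := gmx (@delta T K) (level S j) setT.
have rE : (#|level S j| <= \rank E)%N by apply: rank_delta.
apply: leq_trans rE _; rewrite -(mxrank_mul_ker E M); apply: leq_add.
  apply: mxrankS; apply: submx_trans (submxMl _ _) _; apply/row_subP => i.
  rewrite rowK; apply: inspan_rowof; rewrite -[initseg T p]set0U.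
  apply: vandermonde_prod_span => //; apply: inspanS (inspan_all _).
  by apply/subsetP => R _; rewrite inE sub0set.
apply: mxrankS; apply/rV_subP => v; rewrite sub_capmx => /andP [vE /sub_kermxP vM0].
have ev : v = rowof (level S j) (unrow v).
  have /submxP [D eD] := vE; apply/rowP => i; rewrite [RHS]mxE ffunE enum_valK.
  case: ifP => // hi; rewrite eD mxE big1 // => k _.
  by rewrite !mxE inE mxE hi mulr0.
have [|c hc] := vandermonde_prod_exact al_inj dS cS jp (x := unrow v).
  move: vM0; rewrite vM => h Y YS Yj.
  have : rowof (level S (j + p)%N) (vandermonde_prod al p (unrow v)) = rowof (level S (j + p)%N) 0.
    by rewrite h -[in RHS](scale0r 0) rowofZ scale0r.
  by move/rowof_eq; apply; rewrite inE YS Yj eqxx.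
by rewrite ev (level_eqon hc); apply/inspan_rowof/comb_span.
Qed.

Lemma sh_level_sub g Q A k : Q \in sh g (level S k) -> A \subset Q -> A \in sh g (level S #|A|).
Proof.
move: {2}#|Q :\: A| (erefl #|Q :\: A|) => n.
elim: n Q k => [|n IH] Q k hn QS AQ.
  have e : A = Q.
    by apply/eqP; rewrite eqEsubset AQ -setD_eq0 -cards_eq0 hn.
  have [Y] := sh_card_eq QS; rewrite inE => /andP [_ /eqP Yk] YQ.
  by rewrite e -YQ Yk.
have /card_gt0P [q] : (0 < #|Q :\: A|)%N by rewrite hn.
rewrite inE => /andP [qA qQ]; apply: (IH (Q :\ q) k.-1).
- have -> : Q :\ q :\: A = (Q :\: A) :\ q by rewrite !setDDl setUC.
  by move: hn; rewrite (cardsD1 q) inE qA qQ => [[]].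
- apply: sh_shadow QS qQ => Y a; rewrite !inE => /andP [YS /eqP <-] aY.
  by rewrite (dS YS (subD1set _ _)) (cardsD1 a Y) aY eqxx.
- apply/subsetP => a aA; rewrite !inE (subsetP AQ) // andbT.
  by apply: contraNneq qA => <-.
Qed.

Lemma card_initseg p : (p <= #|T|)%N -> #|initseg T p| = p.
Proof.
elim: p => [|p IH] pT.
  by apply/eqP; rewrite cards_eq0 -subset0; apply/subsetP => a; rewrite inE.
have [i ri ->] := initsegS pT.
by rewrite cardsU1 inE ri ltnn IH // ltnW.
Qed.

(* The two sets of faces below are compared through their numbers, which are ranks
   maximized by a generic g and known for the Vandermonde matrix. *)
Lemma sh_add_initseg g Q j p : generic g -> (p <= #|T|)%N -> (j + p <= m)%N ->
  Q \in sh g (level S j) -> [disjoint Q & initseg T p] ->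
  Q :|: initseg T p \in sh g (level S (j + p)%N).
Proof.
move=> gg pT jp QS dQ; set I := initseg T p.
pose X1 := [set R : {set T} | I \subset R].
pose X2 := [set R : {set T} | ~~ [disjoint R & I]].
have cI : #|I| = p by apply: card_initseg.
have c1 : #|sh g (level S (j + p)%N) :&: X1| = rho g (level S (j + p)%N) X1.
  by apply: card_sh_up; apply: up_contains_initseg.
have c2 : #|sh g (level S j) :&: X2| = rho g (level S j) X2.
  by apply: card_sh_up; apply: up_meets_initseg.
pose f R := R :\: I.
have e R : I \subset R -> f R :|: I = R.
  move=> IR; rewrite /f setUC -{1}(setIidPr IR) setUC.
  by rewrite setUC setID.
have finj : {in sh g (level S (j + p)%N) :&: X1 &, injective f}.
  by move=> R R'; rewrite !inE => /andP [_ /e {2}<-] /andP [_ /e {2}<-] ->.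
have fsub : f @: (sh g (level S (j + p)%N) :&: X1) \subset sh g (level S j) :\: X2.
  apply/subsetP => _ /imsetP [R + ->] => /setIP [RS]; rewrite inE => IR.
  have dfI : [disjoint f R & I] by rewrite -setI_eq0 setIDAC setDIl setDv setI0.
  rewrite in_setD inE dfI /=; have := sh_level_sub RS (subsetDl R I); rewrite -/(f R).
  suff -> : #|f R| = j by [].
  have [Y] := sh_card_eq RS; rewrite inE => /andP [_ /eqP ->] eR.
  by apply/eqP; rewrite -(eqn_add2r p) eR -(cardsID I R) (setIidPr IR) cI addnC.
(* Both ranks stand on the larger side of [rho_vandermonde], so that inequality survives their
   replacement by the generic ranks, which count members of shifts. Hence [f] is onto. *)
have cle : (#|sh g (level S j) :\: X2| <= #|f @: (sh g (level S (j + p)%N) :&: X1)|)%N.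
  rewrite card_in_imset // c1 cardsD c2 sh_card // leq_subLR addnC.
  apply: leq_trans (rho_vandermonde pT jp) _; exact: leq_add.
have : Q \in f @: (sh g (level S (j + p)%N) :&: X1).
  have /eqP -> : f @: (sh g (level S (j + p)%N) :&: X1) == sh g (level S j) :\: X2.
    by rewrite eqEcard fsub.
  by rewrite in_setD inE negbK dQ.
case/imsetP => R /setIP [RS]; rewrite inE => IR ->.
by rewrite e.
Qed.

End ShiftOfCohenMacaulay.


(** * From homology over F to cohomology over a closed field *)

Section CharacteristicOnly.
Local Open Scope ring_scope.

Definition same_char (F K : fieldType) :=
  forall d : int, (d%:~R == 0 :> F) = (d%:~R == 0 :> K).

(** An algebraic closure of the prime field suffices, since ranks of integer matrices see only the
    characteristic. *)
Lemma exists_closed_field (F : fieldType) : exists K : closedFieldType, same_char F K.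
Proof.
have abs (E : fieldType) (d : int) : (d%:~R == 0 :> E) = (`|d|%N%:R == 0 :> E).
  case: d => n //=; by rewrite NegzE mulrNz oppr_eq0.
case: (classic (exists p, p \in [pchar F])) => [[p pF]|no].
  have pp := pcharf_prime pF.
  have [K [f _]] := countable_algebraic_closure 'F_p.
  have pK : p \in [pchar K] by rewrite (fmorph_pchar f) pchar_Fp.
  by exists K => d; rewrite !abs -(dvdn_pcharf pF) -(dvdn_pcharf pK).
exists algC => d; rewrite !abs.
have /pcharf0P -> : [pchar F] =i pred0.
  by move=> p; rewrite !inE; apply/negP => h; apply: no; exists p.
by have /pcharf0P -> := Cpchar.
Qed.

Lemma rank_diag (F : fieldType) n (d : 'I_n -> F) :
  \rank (\matrix_(i, j) (d i *+ (i == j)) : 'M_n) = #|[set i | d i != 0]|.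
Proof.
set D := (X in \rank X); set P := [set i | _].
pose A : 'M[F]_(#|P|, n) := \matrix_(k, j) (enum_val k == j)%:R.
pose B : 'M[F]_(n, #|P|) := \matrix_(i, k) ((d i)^-1 * (i == enum_val k)%:R).
have AD k j : (A *m D) k j = d (enum_val k) *+ (enum_val k == j).
  rewrite mxE (bigD1 (enum_val k)) //= !mxE eqxx mul1r big1 ?addr0 // => i ik.
  by rewrite !mxE eq_sym (negbTE ik) mul0r.
apply/eqP; rewrite eqn_leq; apply/andP; split.
  have -> : D = A^T *m (A *m D).
    apply/matrixP => i j; rewrite mxE; case: (boolP (i \in P)) => iP.
      rewrite mxE (bigD1 (enum_rank_in iP i)) //= big1 ?addr0.
        by rewrite AD !mxE enum_rankK_in // eqxx mul1r.
      move=> k ki; rewrite !mxE; case: eqP => [e|]; last by rewrite mul0r.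
      by case/eqP: ki; apply: enum_val_inj; rewrite enum_rankK_in.
    rewrite mxE big1 => [|k _].
      by move: iP; rewrite inE negbK => /eqP ->; rewrite mul0rn.
    rewrite !mxE; case: eqP => [e|]; last by rewrite mul0r.
    by rewrite -e enum_valP in iP.
  by apply: leq_trans (mxrankM_maxl _ _) _; apply: rank_leq_col.
have ADB : A *m D *m B = 1%:M.
  apply/matrixP => k l; rewrite mxE (bigD1 (enum_val k)) //= big1 ?addr0.
    rewrite AD !mxE eqxx mulrA divff ?mul1r; last by have := enum_valP k; rewrite inE.
    by rewrite (inj_eq enum_val_inj).
  by move=> i ik; rewrite AD eq_sym (negbTE ik) mul0r.
rewrite -(mxrank1 F #|P|) -ADB; apply: leq_trans (mxrankM_maxl _ _) _; exact: mxrankM_maxr.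
Qed.

(** In Smith normal form the outer factors stay invertible over any field, so the rank counts the
    diagonal entries that are nonzero there. *)
Lemma rank_int_mx (F K : fieldType) n (M : 'M[int]_n) : same_char F K ->
  \rank (map_mx (fun d : int => d%:~R : F) M) = \rank (map_mx (fun d : int => d%:~R : K) M).
Proof.
move=> FK; have [P Pu [Q Qu [d _ ->]]] := int_Smith_normal_form M.
have unit_map (E : fieldType) (U : 'M[int]_n) : U \in unitmx -> map_mx (intmul (1 : E)) U \in unitmx.
  by rewrite !unitmxE (det_map_mx (intmul 1)); apply: rmorph_unit.
have h (E : fieldType) : \rank (map_mx (fun d : int => d%:~R : E)
    (P *m \matrix_(i, j) (d`_i *+ (i == j :> nat)) *m Q)) = #|[set i : 'I_n | (d`_i)%:~R != 0 :> E]|.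
  rewrite !(map_mxM (intmul 1)) mxrankMfree; last first.
    by rewrite row_free_unit unit_map.
  rewrite (eqmxMfull _ _); last by rewrite row_full_unit unit_map.
  rewrite -rank_diag; congr (\rank _); apply/matrixP => i j; rewrite !mxE.
  by rewrite rmorphMn.
by rewrite !h; apply: eq_card => i; rewrite !inE FK.
Qed.

End CharacteristicOnly.


Section UniversalCoefficients.
Local Open Scope ring_scope.
Variables (T : finType) (S : {set {set T}}).
Hypothesis dS : down_closed S.
Implicit Types (A B Y : {set T}) (k : nat).
Notation N := #|{: {set T}}|.

Definition incidz A B : int :=
  if (B \subset A) && (#|A| == #|B|.+1)%N
  then (-1) ^+ #|[set y in A | [exists x in A :\: B, (enum_rank y < enum_rank x)%N]]|
  else 0.

Lemma incid_int (E : fieldType) A B : incid E A B = (incidz A B)%:~R.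
Proof. by rewrite /incid /incidz; case: ifP => // _; rewrite rmorph_sign. Qed.

Lemma incid_D1 (E : fieldType) Y a : a \in Y -> incid E Y (Y :\ a) = sg E Y a.
Proof.
move=> aY; rewrite /incid subD1set (cardsD1 a Y) aY eqxx /=.
congr (_ ^+ _); apply: eq_card => b; rewrite !inE; congr (_ && _).
apply/exists_inP/idP => [[c]|lt]; last by exists a; rewrite // !inE eqxx aY.
by rewrite !inE; case: eqP => //= [->|_ /andP [/negP]].
Qed.

Lemma incid_neq0 (E : fieldType) Y B : incid E Y B != 0 -> exists2 a, a \in Y & B = Y :\ a.
Proof.
rewrite /incid; case: ifP => [/andP [BY /eqP cY] _|_]; last by rewrite eqxx.
have : #|Y :\: B| == 1%N.
  by rewrite cardsD (setIidPr BY) cY subSnn.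
case/cards1P => a e; exists a; first by have /setP /(_ a) := e; rewrite !inE eqxx => /andP [].
by rewrite -e setDDr setDv set0U; apply/esym/setIidPr.
Qed.

Lemma L_incid (E : fieldType) (x : {ffun {set T} -> E^o}) Y :
  L (ones T E) x Y = \sum_B incid E Y B * x B.
Proof.
rewrite (bigID (fun B => B \in [set Y :\ a | a in Y])) /= [X in _ + X]big1 ?addr0.
  rewrite big_imset /=.
    by rewrite LE; apply: eq_bigr => a aY; rewrite ffunE mulr1 incid_D1.
  move=> a b aY bY e; apply: contraTeq aY => ab; apply/negP => aY.
  by have /setP /(_ a) := e; rewrite !inE eqxx ab aY.
move=> B hB; case: (eqVneq (incid E Y B) 0) => [->|]; first by rewrite mul0r.
by case/incid_neq0 => a aY e; case/imsetP: hB; exists a.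
Qed.

Definition cobd (E : fieldType) k : 'M[E]_N := \matrix_(i, j)
  (if enum_val j \in level S k then incid E (enum_val j) (enum_val i) else 0).

Lemma rank_cobd (F K : fieldType) k : same_char F K -> \rank (cobd F k) = \rank (cobd K k).
Proof.
move=> FK; pose M : 'M[int]_N := \matrix_(i, j)
  (if enum_val j \in level S k then incidz (enum_val j) (enum_val i) else 0).
have e (E : fieldType) : cobd E k = map_mx (fun d : int => d%:~R) M.
  apply/matrixP => i j; rewrite !mxE; case: ifP => _; last by rewrite mulr0z.
  exact: incid_int.
by rewrite !e; apply: rank_int_mx.
Qed.

Lemma mul_cobd (E : fieldType) k v :
  v *m cobd E k = rowof (level S k) (L (ones T E) (unrow v)).
Proof.
apply/rowP => j; rewrite !mxE; case: ifP => hj; last first.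
  by rewrite big1 // => i _; rewrite mxE hj mulr0.
rewrite L_incid (reindex (@enum_rank _)) /=; last by apply: onW_bij; apply: enum_rank_bij.
by apply: eq_bigr => B _; rewrite mxE hj ffunE enum_rankK mulrC.
Qed.

Definition proj_mx_level (E : fieldType) k : 'M[E]_N :=
  \matrix_(i, j) ((enum_val i \in level S k)%:R *+ (i == j)).

Lemma rank_proj_level (E : fieldType) k : \rank (proj_mx_level E k) = #|level S k|.
Proof.
rewrite rank_diag -(card_imset _ (@enum_val_inj _ _)); apply: eq_card => Y.
apply/imsetP/idP => [[i]|YS].
  by rewrite inE => + ->; case: (_ \in _); rewrite ?eqxx.
by exists (enum_rank Y); rewrite ?enum_rankK // in_set enum_rankK YS oner_neq0.
Qed.

Lemma sub_proj_level (E : fieldType) k (v : 'rV[E]_N) : reflect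
  (forall i, v 0 i != 0 -> enum_val i \in level S k) (v <= proj_mx_level E k)%MS.
Proof.
have vP u : u *m proj_mx_level E k = \row_i (if enum_val i \in level S k then u 0 i else 0).
  apply/rowP => i; rewrite !mxE (bigD1 i) //= big1 ?addr0.
    by rewrite mxE eqxx; case: ifP; rewrite ?mulr1 ?mulr0.
  by move=> l li; rewrite mxE (negbTE li) mulr0.
apply: (iffP submxP) => [[u ->] i|h].
  by rewrite vP mxE; case: ifP => //; rewrite eqxx.
exists v; rewrite vP; apply/rowP => i; rewrite mxE; case: ifP => // hi.
by apply/eqP; apply: contraFT hi; apply: h.
Qed.

(** Rank-nullity for the boundary, the transpose of [cobd], whose kernel in degree [k] lies in the
    image from degree [k + 1]. Only this numerical form can change fields. *)
Lemma homology_rank (F : fieldType) k : homology_vanishes F S k ->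
  (#|level S k| <= \rank (cobd F k) + \rank (cobd F k.+1))%N.
Proof.
move=> hv; rewrite -(rank_proj_level F) -(mxrank_mul_ker _ (cobd F k)^T); apply: leq_add.
  by rewrite -[leqRHS]mxrank_tr; apply: mxrankM_maxr.
rewrite -[leqRHS]mxrank_tr; apply: mxrankS; apply/rV_subP => v.
rewrite sub_capmx => /andP [/sub_proj_level vS /sub_kermxP vk].
have bdE l (u : 'rV[F]_N) : (forall i, u 0 i != 0 -> enum_val i \in level S l) ->
    forall j, (u *m (cobd F l)^T) 0 j = bd (fun A => u 0 (enum_rank A)) (enum_val j).
  move=> uS j; rewrite mxE /bd (reindex (@enum_rank _)) /=; last first.
    by apply: onW_bij; apply: enum_rank_bij.
  apply: eq_bigr => A _; rewrite !mxE enum_rankK; case: ifP => // hA; rewrite mulr0.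
  case: (eqVneq (u 0 (enum_rank A)) 0) => [->|/uS]; rewrite ?mul0r //.
  by rewrite enum_rankK hA.
have [A|B|e eS he] := hv (fun A => v 0 (enum_rank A)).
- by move=> /vS; rewrite enum_rankK inE.
- by rewrite -[B]enum_rankK -(bdE k) // vk mxE.
pose w : 'rV[F]_N := \row_i e (enum_val i).
apply/submxP; exists w; apply/rowP => j; rewrite (bdE k.+1).
  rewrite -[LHS](congr1 (v 0) (enum_valK j)) -he; apply: eq_bigr => A _.
  by rewrite mxE enum_rankK.
by move=> i; rewrite mxE => /eS; rewrite inE.
Qed.

(** The inequality is symmetric under transposition: read for the coboundary, it bounds the
    dimension of the kernel by that of the image, which it contains. *)
Lemma rank_exact (K : fieldType) k :
  (#|level S k| <= \rank (cobd K k) + \rank (cobd K k.+1))%N -> exact_at S (ones T K) k.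
Proof.
move=> hr x hx; set E := proj_mx_level K k.
have unrow_rowof (y : {ffun {set T} -> K^o}) : eqon S k (unrow (rowof (level S k) y)) y.
  by move=> Y YS Yk; rewrite ffunE mxE enum_rankK inE YS Yk eqxx.
have cobd0 y : eqon S k.+1 (L (ones T K) y) 0 -> rowof (level S k) y *m cobd K k.+1 = 0.
  move=> hy; rewrite mul_cobd; apply/rowP => j; rewrite !mxE; case: ifP => //.
  rewrite inE => /andP [jS /eqP jk].
  by rewrite (eqon_L _ dS (unrow_rowof y)) // hy // ffunE.
have rowofE (y : {ffun {set T} -> K^o}) : (rowof (level S k) y <= E)%MS.
  by apply/sub_proj_level => i; rewrite mxE; case: ifP => //; rewrite eqxx.
have sub : (cobd K k <= E :&: kermx (cobd K k.+1))%MS.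
  apply/rV_subP => v /submxP [D ->]; rewrite mul_cobd sub_capmx rowofE /=.
  by apply/sub_kermxP/cobd0 => Y _ _; rewrite L_sq.
(* Rows of [cobd] outside the k-faces are already zero, as [S] is closed under subsets. *)
have EM : E *m cobd K k.+1 = cobd K k.+1.
  apply/matrixP => i j; rewrite mxE (bigD1 i) //= big1 ?addr0; last first.
    by move=> l li; rewrite mxE eq_sym (negbTE li) mul0r.
  rewrite !mxE eqxx; case: ifP => // hj; last by rewrite mulr0.
  case: (eqVneq (incid K (enum_val j) (enum_val i)) 0) => [->|]; first by rewrite mulr0.
  case/incid_neq0 => a aj e; move: hj; rewrite !inE e => /andP [jS /eqP jk].
  by rewrite (dS jS (subD1set _ _)) /= -eqSS -jk (cardsD1 a (enum_val j)) aj eqxx mul1r.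
have ker_le : (\rank (E :&: kermx (cobd K k.+1)) <= \rank (cobd K k))%N.
  rewrite -(leq_add2l (\rank (cobd K k.+1))) -{1}EM mxrank_mul_ker rank_proj_level.
  by rewrite addnC.
have : (rowof (level S k) x <= cobd K k)%MS.
  rewrite (submx_trans _ (_ : (E :&: kermx (cobd K k.+1) <= _)%MS)) //; last first.
    by rewrite -(geq_leqif (mxrank_leqif_sup sub)).
  by rewrite sub_capmx rowofE; apply/sub_kermxP/cobd0.
case/submxP => D; rewrite mul_cobd => /rowof_eq h; exists (unrow D) => Y YS Yk.
by apply: h; rewrite inE YS Yk eqxx.
Qed.

End UniversalCoefficients.


(** * Purity and links of Cohen-Macaulay complexes *)

Section Purity.
Local Open Scope ring_scope.
Variables (T : finType) (F : fieldType) (G : {set {set T}}) (d : nat).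
Hypotheses (dG : down_closed G) (cmG : cohen_macaulay F G).
Hypotheses (Gd : forall A, A \in G -> (#|A| <= d)%N).
Implicit Types (A B W Y Z : {set T}) (a b : T).

(** A function constant along edges is a cocycle, hence pairs to 0 with the boundary of a chain of
    edges. *)
Lemma chain_sum_edges (phi : {set T} -> F) (L : {set {set T}}) (e : {set T} -> F) :
  chain_on L 2 e ->
  (forall a b, [set a; b] \in L -> phi [set a] = phi [set b]) ->
  \sum_a phi [set a] * bd e [set a] = 0.
Proof.
move=> eL hphi; rewrite /bd.
under eq_bigr do rewrite mulr_sumr.
rewrite exchange_big big1 // => E _ /=.
case: (eqVneq (e E) 0) => [->|/eL /andP [EL /cards2P [a [b [ab eE]]]]].
  by rewrite big1 // => a _; rewrite mul0r mulr0.
have inc c : incid F E [set c] != 0 -> c \in E.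
  by rewrite /incid sub1set; case: (c \in E) => //; rewrite eqxx.
have Ea : E :\ a = [set b].
  by rewrite eE; apply/setP => c; rewrite !inE; case: (eqVneq c a) => [->|] //=; rewrite (negbTE ab).
have Eb : E :\ b = [set a].
  rewrite eE; apply/setP => c; rewrite !inE.
  by case: (eqVneq c b) => [->|_] /=; rewrite ?orbF // eq_sym (negbTE ab).
have aE : a \in E by rewrite eE !inE eqxx.
have bE : b \in E by rewrite eE !inE eqxx orbT.
have sg1 c : sg F [set c] c = 1.
  by rewrite /sg (_ : [set _ in _ | _] = set0) ?cards0 //; apply/setP => x;
    rewrite !inE; case: eqP => //= ->; rewrite ltnn.
have := sg_swap F aE bE ab; rewrite Ea Eb !sg1 !mulr1 => hs.
rewrite (bigD1 a) //= (bigD1 b) 1?eq_sym //= big1 ?addr0.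
  have -> : incid F E [set a] = sg F E b by rewrite -Eb incid_D1.
  have -> : incid F E [set b] = sg F E a by rewrite -Ea incid_D1.
  by rewrite (hphi a b) -?eE // hs; ring.
move=> c /andP [ca cb]; case: (eqVneq (incid F E [set c]) 0) => [->|/inc].
  by rewrite !mulr0.
by rewrite eE !inE (negbTE ca) (negbTE cb).
Qed.

Definition extends W := [exists Z in G, (W \subset Z) && (#|Z| == d)].

Lemma setU_setD A B : A \subset B -> A :|: B :\: A = B.
Proof. by move=> AB; rewrite -{1}(setIidPr AB) setID. Qed.

Lemma leq_maxsize (L : {set {set T}}) A : A \in L -> (#|A| <= maxsize L)%N.
Proof. by move=> AL; rewrite /maxsize (bigD1 A) //= leq_maxl. Qed.

Lemma extendsS A B : A \subset B -> extends B -> extends A.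
Proof.
move=> AB /exists_inP [Z ZG /andP [BZ Zd]]; apply/exists_inP; exists Z => //.
by rewrite (subset_trans AB BZ).
Qed.

(* Take a bad face Y and a d-face Z with maximal intersection W. Extending to a d-face is
   then constant along the edges of the connected link of W, but differs on Y and Z. *)
Lemma cm_pure Z0 Y0 : Z0 \in G -> #|Z0| = d -> Y0 \in G -> extends Y0.
Proof.
move=> Z0G Z0d Y0G; apply: contraT => Y0bad.
pose P (p : {set T} * {set T}) :=
  [&& p.1 \in G, ~~ extends p.1, p.2 \in G & #|p.2| == d].
have P0 : P (Y0, Z0) by rewrite /P /= Y0G Y0bad Z0G Z0d eqxx.
case: (@arg_maxnP _ (Y0, Z0) P (fun p => #|p.1 :&: p.2|) P0) => [[Y Z]] /=.
move=> /and4P [/= YG Ybad ZG /eqP Zd] hmax.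
have {}hmax Y' Z' W : Y' \in G -> ~~ extends Y' -> Z' \in G -> #|Z'| = d ->
    (#|Y :&: Z| < #|W|)%N -> W \subset Y' -> W \subset Z' -> False.
  move=> Y'G Y'bad Z'G Z'd lt WY WZ.
  have := hmax (Y', Z'); rewrite /P /= Y'G Y'bad Z'G Z'd eqxx => /(_ isT).
  by rewrite leqNgt (leq_trans lt) // subset_leq_card // subsetI WY WZ.
set W := Y :&: Z in hmax.
have WG : W \in G by apply: dG YG (subsetIl _ _).
have extZ A : A \subset Z -> extends A.
  by move=> AZ; apply/exists_inP; exists Z; rewrite // AZ Zd eqxx.
have [y yY yZ] : exists2 y, y \in Y & y \notin Z.
  by apply/subsetPn; apply: contra Ybad => /extZ.
have Yd : (#|Y| < d)%N.
  rewrite ltn_neqAle Gd // andbT; apply: contra Ybad => /eqP e.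
  by apply/exists_inP; exists Y; rewrite // subxx e eqxx.
have [z zZ zY] : exists2 z, z \in Z & z \notin Y.
  apply/subsetPn; apply/negP => /subset_leq_card; rewrite Zd.
  by rewrite leqNgt Yd.
have WU a : a \notin W -> (#|Y :&: Z| < #|a |: W|)%N by move=> aW; rewrite cardsU1 aW.
have nW a : a \notin Y :&: Z -> a \notin W by [].
have yW : y \notin W by rewrite inE (negbTE yZ) andbF.
have zW : z \notin W by rewrite inE (negbTE zY).
have sub1 a A : a \in A -> W \subset A -> a |: W \subset A.
  by move=> aA WA; rewrite subUset sub1set aA.
pose phi A : F := (extends (A :|: W))%:R.
have phiy : phi [set y] = 0.
  rewrite /phi; case: (boolP (extends _)) => //= /exists_inP [Z' Z'G /andP [h /eqP Z'd]].
  case: (hmax Y Z' (y |: W)) => //; first exact: WU.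
  by apply: sub1 => //; apply: subsetIl.
have phiz : phi [set z] = 1.
  by rewrite /phi extZ // sub1 // subsetIr.
have hphi a b : [set a; b] \in link G W -> phi [set a] = phi [set b].
  (* Otherwise the face formed by [W] and the edge would be bad and meet a d-face in more than [W],
     against maximality. *)
  have hw a' b' : [set a'; b'] \in link G W -> extends (b' |: W) -> extends (a' |: W).
    rewrite in_link => /and3P [_ dW abG] /exists_inP [Z' Z'G /andP [h /eqP Z'd]].
    apply: contraT => abad; case: (hmax (W :|: [set a'; b']) Z' (b' |: W)) => //.
    - apply: contra abad; apply: extendsS.
      by rewrite setUC; apply: setUS; apply/subsetP => c; rewrite !inE => ->.
    - by apply: WU; rewrite (disjointFl dW) // !inE eqxx orbT.
    - by rewrite setUC; apply: setUS; apply/subsetP => c; rewrite !inE => ->; rewrite orbT.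
  move=> abL; have baL : [set b; a] \in link G W by rewrite setUC.
  rewrite /phi; congr (_%:R); congr nat_of_bool; apply/idP/idP; exact: hw.
(* |W| < |Y| < d, so Z minus W has at least two elements and the link of [W] must be connected. *)
have big : (1 < maxsize (link G W))%N.
  have ZW : Z :\: W \in link G W.
    rewrite in_link (dG ZG (subsetDl _ _)) -setI_eq0 setIC setIDAC setDIl setDv setI0 eqxx /=.
    by rewrite setU_setD ?subsetIr.
  apply: leq_trans (leq_maxsize ZW); rewrite cardsD (setIidPr (subsetIr _ _)) Zd.
  have : (#|W| < #|Y|)%N by apply: proper_card; rewrite properE subsetIl; apply/subsetPn; exists y.
  by rewrite ltn_subRL addn1 => lt; apply: leq_ltn_trans Yd.
(* The cycle z - y must bound, yet its pairing with [phi] is 1, not 0. *)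
pose c A : F := (A == [set z])%:R - (A == [set y])%:R.
have lk1 a A : A \in G -> a \in A -> W \subset A -> a \notin W -> [set a] \in link G W.
  move=> AG aA WA aW; rewrite in_link (dG AG) ?sub1set //= disjoint_sym disjoints1 aW /=.
  by rewrite setUC; apply: dG AG (sub1 _ _ _ _).
have cL : chain_on (link G W) 1 c.
  move=> A; rewrite /c; case: (eqVneq A [set z]) => [-> _|_].
    by rewrite (lk1 z Z) ?cards1 ?eqxx // subsetIr.
  case: (eqVneq A [set y]) => [-> _|_]; last by rewrite subrr eqxx.
  by rewrite (lk1 y Y) ?cards1 ?eqxx // subsetIl.
have bdc B : bd c B = 0.
  rewrite /bd (bigD1 [set z]) //= (bigD1 [set y]) /=; last first.
    by rewrite (inj_eq set1_inj); apply: contraNneq yZ => ->.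
  rewrite big1 ?addr0 => [|A /andP [Az Ay]].
    have zy : z == y = false by apply: contraNF yZ => /eqP <-.
    rewrite /c !eqxx !(inj_eq set1_inj) zy eq_sym zy subr0 sub0r mul1r mulN1r.
    have inc1 a : incid F [set a] B = (B == set0)%:R.
      rewrite /incid cards1 eqSS [0%N == _]eq_sym cards_eq0.
      case: eqP => [->|_]; rewrite ?andbF // sub0set /=.
      rewrite (_ : [set _ in _ | _] = set0) ?cards0 //.
      apply/setP => u; rewrite !inE; case: eqP => //= ->.
      by apply/exists_inP => [[u']]; rewrite !inE => /eqP ->; rewrite ltnn.
    by rewrite !inc1 subrr.
  by rewrite /c (negbTE Az) (negbTE Ay) subrr mul0r.
have [e eL he] := cmG WG big cL bdc.
have := chain_sum_edges eL hphi.
under eq_bigr do rewrite he.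
rewrite (bigD1 z) //= big1 => [|a az].
  rewrite phiz /c eqxx (inj_eq set1_inj) (_ : z == y = false); last by apply: contraNF yZ => /eqP <-.
  by rewrite subr0 addr0 mulr1 => /eqP; rewrite oner_eq0.
rewrite /c (inj_eq set1_inj) (negbTE az) sub0r (inj_eq set1_inj).
by case: eqP => [->|]; rewrite ?phiy ?mul0r // oppr0 mulr0.
Qed.

(** By purity the link of [V :|: A] has a face of size d - |V :|: A|, so the range of degrees in
    [coCM] lies below the top of that link. *)
Lemma coCM_link_face (K : fieldType) Z0 V : same_char F K -> Z0 \in G -> #|Z0| = d ->
  V \in G -> coCM K (link G V) (d - #|V|).
Proof.
move=> FK Z0G Z0d VG A AV k kA; rewrite link_link //.
have dL : down_closed (link G (V :|: A)) by apply: link_down.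
move: AV; rewrite in_link => /and3P [_ dVA VAG].
apply: rank_exact => //; rewrite -!(rank_cobd _ _ FK); apply: homology_rank; apply: cmG => //.
have /exists_inP [Z ZG /andP [VAZ /eqP Zd]] := cm_pure Z0G Z0d VAG.
have ZL : Z :\: (V :|: A) \in link G (V :|: A).
  rewrite in_link (dG ZG (subsetDl _ _)) -setI_eq0 setIC setIDAC setDIl setDv setI0 eqxx /=.
  by rewrite setU_setD.
apply: leq_trans (leq_maxsize ZL); rewrite cardsD (setIidPr VAZ) Zd.
by rewrite cardsU (disjoint_setI0 dVA) cards0; move: kA; lia.
Qed.

End Purity.


(** * Compression *)

Section ShiftedComplexes.
Variables (T : finType) (D : {set {set T}}) (r : nat) (v : 'I_r -> T).
Hypotheses (dD : down_closed D) (vinj : injective v) (shD : shifted D v).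
Implicit Types (Y Z x b : {set T}) (A B H : {set {set T}}).

Notation V := [set v j | j : 'I_r].

Lemma card_V : #|V| = r.
Proof. by rewrite card_imset // card_ord. Qed.

(** Elements of [Z] outside [Y :|: V] are exchanged for missing elements of V; the bound on |Z|
    guarantees such an element as long as V is not inside [Z]. *)
Lemma shifted_extend Y Z : Y \subset Z -> Z \in D -> #|Y| + r <= #|Z| ->
  Y :|: V \in D.
Proof.
move: {2}#|V :\: Z| (leqnn #|V :\: Z|) => n.
elim: n Z => [|n IH] Z hn YZ ZD Zd.
  apply: dD ZD _; rewrite subUset YZ -setD_eq0 -cards_eq0 -leqn0 //.
case: (boolP (V \subset Z)) => VZ; first by apply: dD ZD _; rewrite subUset YZ.
have /subsetPn [_ /imsetP [i _ ->] viZ] := VZ.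
have [w wZ] : exists2 w, w \in Z & w \notin Y :|: V.
  apply/subsetPn; apply/negP => ZYV.
  have : Z \subset Y :|: (V :\ v i).
    apply/subsetP => a aZ; have := subsetP ZYV a aZ; rewrite !inE => /orP [->//|->].
    by rewrite andbT orbC; apply/orP; left; apply: contraNneq viZ => <-.
  move/subset_leq_card; rewrite leqNgt => /negP; apply.
  apply: leq_ltn_trans (leq_card_setU _ _) _; apply: leq_trans Zd.
  by rewrite ltn_add2l -[ltnRHS]card_V [ltnRHS](cardsD1 (v i)) imset_f.
rewrite !inE negb_or => /andP [wY wV].
have Z'D : (Z :\ w) :|: [set v i] \in D.
  apply: shD => //; apply: contra wV => /imsetP [j _ ->]; exact: imset_f.
apply: (IH ((Z :\ w) :|: [set v i])) => //.
- rewrite -ltnS; apply: leq_trans hn; apply: proper_card; rewrite properE.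
  apply/andP; split.
    apply/subsetP => a; rewrite !inE negb_or negb_and negbK => /andP [/andP [/orP [/eqP ->|->]] _] //.
    by rewrite (negbTE wV).
  by apply/subsetPn; exists (v i); rewrite !inE ?eqxx ?viZ ?imset_f // orbT.
- apply/subsetP => a aY; rewrite !inE (subsetP YZ) // andbT.
  by apply/orP; left; apply: contraNneq wY => <-.
- apply: leq_trans Zd _; rewrite setUC cardsU1 !inE (negbTE viZ) andbF.
  by rewrite (cardsD1 w Z) wZ.
Qed.

Section Compression.
Variables (i : 'I_r) (w : T).
Hypothesis wi : w \notin [set v j | j : 'I_r & (j <= i)%N].
Let u := v i.

Let uw : u != w.
Proof. by apply: contraNneq wi => <-; apply: imset_f; rewrite inE. Qed.

Definition swap x : {set T} := [set a | tperm u w a \in x].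

Lemma swapK : involutive swap.
Proof. by move=> x; apply/setP => a; rewrite !inE tpermK. Qed.

Lemma in_swap_u x : (u \in swap x) = (w \in x).
Proof. by rewrite inE tpermL. Qed.

Lemma in_swap_w x : (w \in swap x) = (u \in x).
Proof. by rewrite inE tpermR. Qed.

Lemma swap_id x : (u \in x) = (w \in x) -> swap x = x.
Proof.
by move=> uwx; apply/setP => a; rewrite inE; case: tpermP => // ->.
Qed.

Lemma swapE x : w \in x -> u \notin x -> swap x = (x :\ w) :|: [set u].
Proof.
move=> wx ux; apply/setP => a; rewrite !inE; case: tpermP => [->|->|].
- by rewrite wx eqxx orbT.
- by rewrite (negbTE ux) eqxx /= eq_sym (negbTE uw).
- by move=> /eqP /negbTE -> /eqP /negbTE ->; rewrite orbF.
Qed.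

Lemma card_swap x : #|swap x| = #|x|.
Proof.
have -> : swap x = tperm u w @: x; last by rewrite card_imset //; apply: perm_inj.
by apply/setP => a; rewrite inE -{2}[a](tpermK u w) mem_imset //; apply: perm_inj.
Qed.

Lemma swap_disjoint x b : [disjoint swap x & swap b] = [disjoint x & b].
Proof.
apply/idP/idP => /pred0P h; apply/pred0P => a /=.
  by have := h (tperm u w a); rewrite /= !inE tpermK.
by have := h (tperm u w a); rewrite /= !inE.
Qed.

Lemma swapD1 x a : swap (x :\ a) = swap x :\ tperm u w a.
Proof. by apply/setP => c; rewrite !inE -{1}[a](tpermK u w) (inj_eq perm_inj). Qed.

Definition up_type x := (u \in x) && (w \notin x).
Definition down_type x := (w \in x) && (u \notin x).

Lemma up_swap x : up_type (swap x) = down_type x.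
Proof. by rewrite /up_type in_swap_u in_swap_w. Qed.

(** The classical shifting operator from [w] to [u], written as OR on one member of each pair [x],
    [swap x] and AND on the other, so that its properties reduce to propositional logic. *)
Definition compress (H : {set {set T}}) : {set {set T}} :=
  [set x | if up_type x then (x \in H) || (swap x \in H)
           else if down_type x then (x \in H) && (swap x \in H) else x \in H].

Lemma compress_or H x : x \in compress H -> x \in H \/ swap x \in H.
Proof.
rewrite inE; case: ifP => _; first by move/orP.
by case: ifP => _; [case/andP|]; left.
Qed.

Lemma neutral_swap x : ~~ up_type x -> ~~ down_type x -> swap x = x.
Proof.
by rewrite /up_type /down_type => h h'; apply: swap_id; move: h h'; do 2!case: (_ \in _).
Qed.

Lemma compress_both H x : ~~ up_type x -> x \in compress H -> x \in H /\ swap x \in H.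
Proof.
move=> nu; rewrite inE (negbTE nu); case: ifP => [_ /andP //|nd xH].
by rewrite neutral_swap ?nd.
Qed.

Lemma both_compress H x : x \in H -> swap x \in H -> x \in compress H.
Proof. by move=> xH sH; rewrite inE xH sH; case: (up_type x); case: (down_type x). Qed.

Lemma or_compress H x : w \notin x -> x \in H \/ swap x \in H -> x \in compress H.
Proof.
move=> wx h; rewrite inE; case: ifP => [_|nu]; first by apply/orP.
case: ifP => [|nd]; first by rewrite /down_type (negbTE wx).
by move: h; rewrite neutral_swap ?nu ?nd //; case.
Qed.

(** Two disjoint sets cannot both contain [u]. The one that is not of up type comes with its swap,
    so it can be matched with whichever form of the other is in the original family; swapping both
    preserves disjointness. *)
Lemma compress_cross A B : cross_intersecting A B ->
  cross_intersecting (compress A) (compress B).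
Proof.
move=> hAB a b aA bB; rewrite setI_eq0; apply/negP => dab.
have hAB' x y : x \in A -> y \in B -> ~~ [disjoint x & y].
  by move=> xA yB; rewrite -setI_eq0; apply: hAB.
case: (boolP (up_type a)) => ta.
  have nb : ~~ up_type b.
    by rewrite /up_type negb_and (disjointFr dab) //; case/andP: ta.
  have [b1 b2] := compress_both nb bB.
  case: (compress_or aA) => a1; first by have := hAB' _ _ a1 b1; rewrite dab.
  by have := hAB' _ _ a1 b2; rewrite swap_disjoint dab.
have [a1 a2] := compress_both ta aA.
case: (compress_or bB) => b1; first by have := hAB' _ _ a1 b1; rewrite dab.
by have := hAB' _ _ a2 b1; rewrite swap_disjoint dab.
Qed.

Lemma compress_shadow A B : (forall b y, b \in B -> y \in b -> b :\ y \in A) ->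
  forall b y, b \in compress B -> y \in b -> b :\ y \in compress A.
Proof.
move=> hAB b y bB yb.
have hs : swap b \in B -> swap (b :\ y) \in A.
  by move=> sB; rewrite swapD1; apply: hAB; rewrite // inE tpermK.
case: (boolP (up_type b)) => tb.
  apply: or_compress; first by case/andP: tb => _; rewrite !inE negb_and => ->; rewrite orbT.
  by case: (compress_or bB) => [bB'|/hs]; [left; apply: hAB|right].
have [b1 b2] := compress_both tb bB.
by apply: both_compress; [apply: hAB|apply: hs].
Qed.

Lemma compress_face H k : (forall x, x \in H -> (x \in D) && (#|x| == k)) ->
  forall x, x \in compress H -> (x \in D) && (#|x| == k).
Proof.
move=> hH x; rewrite inE; case: ifP => [tx /orP [/hH //|sH]|_]; last first.
  by case: ifP => _; [case/andP=> + _|]; apply: hH.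
have /andP [sD sk] := hH _ sH; rewrite -(card_swap x) sk andbT.
have /andP [ux wx] := tx.
rewrite -[x]swapK swapE ?in_swap_u ?in_swap_w //.
by apply: shD; rewrite ?in_swap_u ?in_swap_w.
Qed.

Lemma sum_by_type (H : {set {set T}}) (f : {set T} -> nat) :
  \sum_(x in H) f x = \sum_(x in H | ~~ up_type x && ~~ down_type x) f x +
    \sum_(x | up_type x) ((x \in H) * f x + (swap x \in H) * f (swap x)).
Proof.
rewrite (bigID (fun x => ~~ up_type x && ~~ down_type x)) /=; congr (_ + _).
rewrite big_split /= (bigID up_type) /=; congr (_ + _).
  rewrite big_mkcond [RHS]big_mkcond; apply: eq_bigr => x _ /=.
  by case: (up_type x); rewrite ?andbF //= andbT; case: (x \in H); rewrite ?mul1n.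
rewrite [RHS](reindex_inj (inv_inj swapK)) /=.
rewrite big_mkcond [RHS]big_mkcond; apply: eq_bigr => x _ /=; rewrite up_swap swapK.
have : ~~ (up_type x && down_type x).
  by rewrite /up_type /down_type; case: (u \in x); rewrite ?andbF.
case: (up_type x); case: (down_type x) => //=; rewrite ?andbF // ?andbT.
by case: (x \in H); rewrite ?mul1n.
Qed.

Lemma sum_compress (H : {set {set T}}) (f : {set T} -> nat) :
  \sum_(x in compress H) f x = \sum_(x in H | ~~ up_type x && ~~ down_type x) f x +
    \sum_(x | up_type x) (((x \in H) || (swap x \in H)) * f x +
                          ((x \in H) && (swap x \in H)) * f (swap x)).
Proof.
rewrite sum_by_type; congr (_ + _).
  apply: eq_bigl => x; rewrite inE.
  by case: (up_type x); case: (down_type x); rewrite ?andbF.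
apply: eq_bigr => x tx; rewrite !inE tx up_swap swapK.
have -> : down_type (swap x) by rewrite -up_swap swapK.
have -> : down_type x = false by rewrite /down_type; case/andP: tx => ->; rewrite andbF.
by rewrite andbC.
Qed.

Lemma card_compress H : #|compress H| = #|H|.
Proof.
rewrite -!sum1_card sum_compress sum_by_type; congr (_ + _); apply: eq_bigr => x _.
by case: (x \in H); case: (swap x \in H).
Qed.

(* Elements outside the image of v get position r. *)
Definition position (a : T) : nat := if [pick j | v j == a] is Some j then j else r.

Lemma position_v j : position (v j) = j.
Proof.
rewrite /position; case: pickP => [j' /eqP /vinj -> //|/(_ j)]; by rewrite eqxx.
Qed.

Lemma position_w : i < position w.
Proof.
rewrite /position; case: pickP => [j /eqP e|_] //.
by rewrite ltnNge; apply: contra wi => ji; rewrite -e; apply: imset_f; rewrite inE.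
Qed.

Definition weight x := \sum_(a in x) position a.

Lemma weight_swap x : up_type x -> weight x < weight (swap x).
Proof.
move=> tx; have /andP [ux wx] := tx.
have -> : swap x = w |: (x :\ u).
  rewrite -[RHS]swapK; congr swap; rewrite swapE.
  - apply/setP => a; rewrite !inE; case: (eqVneq a u) => [->|au] /=; first by rewrite orbT ux.
    by case: (eqVneq a w) => [->|_]; rewrite ?(negbTE wx) // orbF.
  - by rewrite !inE eqxx.
  - by rewrite !inE negb_or uw eqxx.
rewrite /weight big_setU1 /=; last by rewrite !inE negb_and wx orbT.
by rewrite (big_setD1 u) //= ltn_add2r position_v position_w.
Qed.

Lemma compress_weight H b : b \in H -> w \in b -> u \notin b -> swap b \notin H ->
  \sum_(x in compress H) weight x < \sum_(x in H) weight x.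
Proof.
move=> bH wb ub sbH; rewrite sum_compress sum_by_type ltn_add2l.
have tb : up_type (swap b) by rewrite up_swap /down_type wb.
rewrite (bigD1 (swap b)) //= [ltnRHS](bigD1 (swap b)) //= swapK bH (negbTE sbH) /=.
rewrite !mul1n !mul0n addn0 add0n -addSn leq_add //.
  by have := weight_swap tb; rewrite swapK.
apply: leq_sum => x /andP [tx _]; have := weight_swap tx.
by case: (x \in H); case: (swap x \in H); rewrite /= ?mul1n ?mul0n ?addn0 ?add0n // => /ltnW.
Qed.

End Compression.

Definition faces_of_size k (H : {set {set T}}) :=
  forall x, x \in H -> (x \in D) && (#|x| == k).

(** Descent on the total weight of [B]: any failure of shiftedness gives a compression that lowers
    it, and [A] is compressed along with [B]. *)
Lemma exists_compressed (A B : {set {set T}}) :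
  faces_of_size r.-1 A -> faces_of_size r B -> cross_intersecting A B ->
  (forall b y, b \in B -> y \in b -> b :\ y \in A) ->
  exists A' B', [/\ faces_of_size r.-1 A', faces_of_size r B', cross_intersecting A' B' &
   [/\ (forall b y, b \in B' -> y \in b -> b :\ y \in A'), shifted B' v,
     #|A'| = #|A| & #|B'| = #|B|]].
Proof.
move: {2}(\sum_(x in B) weight x).+1 (ltnSn (\sum_(x in B) weight x)) => n.
elim: n A B => // n IH A B hn hA hB hAB hsh.
case: (classic (shifted B v)) => [sB|nsB]; first by exists A, B.
have [i [b [w [bB wb wi vib nB]]]] : exists (i : 'I_r) b w, [/\ b \in B, w \in b,
    w \notin [set v j | j : 'I_r & (j <= i)%N], v i \notin b &
    (b :\ w) :|: [set v i] \notin B].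
  apply: NNPP => h; apply: nsB => i b w bB wb wi vib.
  by apply: contraT => nB; case: h; exists i, b, w.
rewrite -(swapE wi wb vib) in nB.
have lt := compress_weight wi bB wb vib nB.
have [A' [B' [h1 h2 h3 [h4 h5 cA cB]]]] := IH (compress i w A) (compress i w B)
  (leq_trans lt hn) (compress_face wi hA) (compress_face wi hB) (compress_cross hAB)
  (compress_shadow hsh).
exists A', B'; split=> //; split=> //; first by rewrite cA card_compress.
by rewrite cB card_compress.
Qed.

Lemma shifted_family_top (B : {set {set T}}) : B != set0 -> shifted B v ->
  faces_of_size r B -> V \in B.
Proof.
case/set0Pn => b0 b0B sB hB.
case: (@arg_maxnP _ b0 (fun b => b \in B) (fun b => #|b :&: V|) b0B) => b bB hmax.
have /andP [_ /eqP br] := hB _ bB.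
suff Vb : V \subset b.
  suff -> : V = b by [].
  by apply/eqP; rewrite eqEcard Vb br card_V leqnn.
apply: contraT => /subsetPn [_ /imsetP [i _ ->] vib].
have [w wb wV] : exists2 w, w \in b & w \notin V.
  apply/subsetPn; apply/negP => bV; move: vib.
  have /eqP -> : b == V by rewrite eqEcard bV br card_V leqnn.
  by rewrite imset_f.
have b'B : (b :\ w) :|: [set v i] \in B.
  by apply: sB => //; apply: contra wV => /imsetP [j _ ->]; apply: imset_f.
have := hmax _ b'B; rewrite /= leqNgt => /negP; case; apply: proper_card; rewrite properE.
apply/andP; split; last first.
  by apply/subsetPn; exists (v i); rewrite !inE ?(negbTE vib) ?eqxx ?orbT // imset_f.
apply/subsetP => a; rewrite !inE => /andP [ab aV]; rewrite aV ab andbT.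
by apply/orP; left; rewrite andbT; apply: contraNneq wV => <-.
Qed.

End ShiftedComplexes.


(** * Reflection *)

Section Reflection.
Variables (N r : nat) (A B C : {set {set 'I_N}}).
Implicit Types (a b c : {set 'I_N}) (x y q g : 'I_N) (i s t : nat).

Definition seg i : {set 'I_N} := [set x : 'I_N | x < i].
Definition cnt b i := #|b :&: seg i|.
Definition reflect_at i b := (seg i :\: b) :|: (b :\: seg i).

Hypothesis rN : 2 * r <= N.+1.
Hypothesis r0 : 0 < r.
Hypothesis cardB : forall b, b \in B -> #|b| = r.
Hypothesis shB : forall b q g, b \in B -> q \in b -> g \notin b -> g < q -> g |: (b :\ q) \in B.
Hypothesis crossAB : forall a b, a \in A -> b \in B -> ~~ [disjoint a & b].
Hypothesis shadowB : forall b y, b \in B -> y \in b -> b :\ y \in A.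
Hypothesis AC : A \subset C.
Hypothesis topB : seg r \in B.
Hypothesis reflC : forall b i, b \in B -> 2 * cnt b i = i.+1 ->
  ~~ [disjoint reflect_at i b & seg r] -> reflect_at i b \in C.

Lemma segS x : seg x.+1 = x |: seg x.
Proof. by apply/setP => y; rewrite !inE ltnS leq_eqVlt. Qed.

Lemma card_seg i : i <= N -> #|seg i| = i.
Proof.
elim: i => [|i IH] iN; first by apply/eqP; rewrite cards_eq0 -subset0; apply/subsetP => x; rewrite inE.
by rewrite (segS (Ordinal iN)) cardsU1 inE ltnn IH // ltnW.
Qed.

Lemma segSS s t : s <= t -> seg s \subset seg t.
Proof. by move=> st; apply/subsetP => x; rewrite !inE => xs; apply: leq_trans st. Qed.

Lemma cnt_le s t b : s <= t -> cnt b s <= cnt b t.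
Proof. by move=> st; apply/subset_leq_card/setIS/segSS. Qed.

Lemma cnt_diff s t b : s <= t -> #|b :&: (seg t :\: seg s)| = cnt b t - cnt b s.
Proof.
move=> st; rewrite setIDA cardsD; congr (_ - #|_|).
by rewrite -setIA (setIidPr (segSS st)).
Qed.

Lemma cntN b : cnt b N = #|b|.
Proof. by rewrite /cnt (setIidPl _) //; apply/subsetP => x _; rewrite inE. Qed.

(* Move the elements of b above t, from the smallest one on, to gaps of b below them. *)
Lemma spread b t : b \in B -> t <= N ->
  (forall s, t <= s <= N -> 2 * (cnt b s - cnt b t) <= s - t) ->
  exists2 c, c \in B & c :&: seg t = b :&: seg t /\ [disjoint c :\: seg t & b].
Proof.
move=> bB tN hb.
suff h s : t <= s <= N -> exists2 c, c \in B &
    [/\ c :&: seg t = b :&: seg t, c :\: seg s = b :\: seg s,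
     [disjoint c :&: (seg s :\: seg t) & b] & cnt c s = cnt b s].
  have [|c cB [h1 h2 h3 h4]] := h N; first by rewrite tN leqnn.
  exists c => //; split=> //; apply: disjointWl h3; apply/subsetP => x.
  by rewrite !inE => /andP [-> ->]; rewrite ltn_ord.
elim: s => [|s IH] /andP [ts sN].
  exists b => //; split=> //; rewrite -setI_eq0 -subset0; apply/subsetP => x.
  by rewrite !inE ltn0 !andbF.
move: ts; rewrite leq_eqVlt => /orP [/eqP ->|ts].
  exists b => //; split=> //; rewrite -setI_eq0 -subset0; apply/subsetP => x.
  by rewrite !inE => /andP [/andP [_ /andP [/negP h /h]]].
have [|c cB [h1 h2 h3 h4]] := IH; first by rewrite -ltnS ts ltnW.
pose x0 : 'I_N := Ordinal sN.
have x0s : nat_of_ord x0 = s by [].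
have sE : seg s.+1 = x0 |: seg s by rewrite -(segS x0).
have x0n : x0 \notin seg s by rewrite inE ltnn.
have cntS d : cnt d s.+1 = (x0 \in d) + cnt d s.
  rewrite /cnt sE; case: (boolP (x0 \in d)) => x0d.
    rewrite setIUr (setIidPr _) ?sub1set // cardsU1 inE (negbTE x0n) andbF.
    by rewrite add1n.
  by apply: eq_card => y; rewrite !inE; case: (eqVneq y x0) => [->|] //=; rewrite (negbTE x0d).
have x0c : (x0 \in c) = (x0 \in b).
  by have /setP /(_ x0) := h2; rewrite !inE /= ltnn.
have dS d : d :\: seg s.+1 = (d :\: seg s) :\ x0.
  by rewrite sE setUC -setDDl.
case: (boolP (x0 \in b)) => x0b; last first.
  exists c => //; split=> //; [by rewrite !dS h2| |by rewrite !cntS x0c h4].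
  rewrite -setI_eq0 -subset0; apply/subsetP => y; rewrite !inE.
  move=> /andP [/andP [yc /andP [yt]]]; rewrite ltnS leq_eqVlt => /orP [/eqP ys|ys] yb.
    have e : y = x0 by exact: val_inj.
    by rewrite e (negbTE x0b) in yb.
  by have := disjointFr h3 (x := y); rewrite !inE yc yt ys => /(_ isT); rewrite yb.
(* Below s and from t on, [b] and [c] have k elements each. As s lies in [b], the hypothesis at s +
   1 reads 2 (k + 1) <= s + 1 - t, so 2 k < s - t and a common gap remains. *)
have [g [gs gt gb gc]] : exists g : 'I_N, [/\ g < s, t <= g, g \notin b & g \notin c].
  pose I := seg s :\: seg t.
  have ts' : t <= s by rewrite -ltnS.
  have cI : #|I| = s - t.
    by rewrite cardsD (setIidPr (segSS ts')) !card_seg // ltnW.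
  have lt : #|I :&: (b :|: c)| < #|I|.
    rewrite setIUr (leq_ltn_trans (leq_card_setU _ _)) // [I :&: b]setIC [I :&: c]setIC.
    rewrite !cnt_diff // h4 (_ : cnt c t = cnt b t) ?cI; last by rewrite /cnt h1.
    have := hb s.+1; rewrite cntS x0b (leq_trans ts') // sN => /(_ isT).
    by have := cnt_le b ts'; move: ts'; lia.
  have /subsetPn [g gI gn] : ~~ (I \subset b :|: c).
    by apply: contraTN lt => /setIidPl ->; rewrite ltnn.
  exists g; move: gI gn; rewrite !inE -leqNgt negb_or => /andP [-> ->] /andP [-> ->] //.
have gx0 : g != x0 by apply: contraTneq gs => ->; rewrite ltnn.
exists (g |: (c :\ x0)); first by apply: shB; rewrite ?x0c.
split.
- rewrite -h1; apply/setP => y; rewrite !inE.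
  case: (eqVneq y g) => [->|_] /=; first by rewrite ltnNge gt !andbF.
  case: (eqVneq y x0) => [->|_] //=; rewrite -[_ < t]negbK -leqNgt.
  by rewrite [t <= _](ts : t <= s) andbF.
- rewrite !dS -h2; apply/setP => y; rewrite !inE.
  case: (eqVneq y g) => [->|_] //=; first by rewrite gs !andbF.
  by case: (eqVneq y x0) => [->|_] //=.
- rewrite -setI_eq0 -subset0; apply/subsetP => y; rewrite !inE.
  move=> /andP [/andP [yc /andP [yt]]]; rewrite ltnS leq_eqVlt => ys yb.
  case/orP: yc => [/eqP e|/andP [yx0 yc]]; first by rewrite -e yb in gb.
  case/orP: ys => [/eqP ys|ys]; first by case/eqP: yx0; apply: val_inj.
  by have := disjointFr h3 (x := y); rewrite !inE yc yt ys => /(_ isT); rewrite yb.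
- rewrite !cntS !inE eqxx orbF [x0 == g]eq_sym (negbTE gx0) x0b -h4 /=.
  rewrite /cnt setIUl (setIidPl _) ?sub1set ?inE // cardsU1 !inE (negbTE gc) !andbF.
  rewrite add0n; congr addn; apply: eq_card => y; rewrite !inE.
  by case: (eqVneq y x0) => [->|] //=; rewrite ltnn andbF.
Qed.

(* The last i at which the lattice path of b is above the diagonal, so that the
   reflected prefix loses exactly one element. *)
Definition last_cross b := \max_(i < N.+1 | i < 2 * cnt b i) i.

(** If the path never crossed, [spread] from 0 would give a member of [B] disjoint from [b], against
    crossing with [b :\ y]. The exact value at the crossing comes from the next index, or from 2 r
    <= N + 1 when the crossing is at N. *)
Lemma last_crossP b : b \in B ->
  [/\ last_cross b <= N, 2 * cnt b (last_cross b) = (last_cross b).+1 &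
   forall s, last_cross b < s <= N -> 2 * cnt b s <= s].
Proof.
move=> bB.
have [i0 Pi0] : exists i : 'I_N.+1, i < 2 * cnt b i.
  apply/existsP; apply: contraT; rewrite negb_exists => /forallP h.
  have [//||c cB [_ dcb]] := @spread b 0 bB.
    move=> s /andP [_ sN]; have := h (Ordinal (sN : s < N.+1)); rewrite -leqNgt /= => hs.
    have -> : cnt b 0 = 0 by apply/eqP; rewrite cards_eq0 -subset0; apply/subsetP => x; rewrite !inE ltn0 andbF.
    by rewrite !subn0.
  have [y yb] : exists y, y \in b by apply/card_gt0P; rewrite cardB.
  have := crossAB (shadowB bB yb) cB; rewrite disjoint_sym (disjointWr (subD1set _ _)) //.
  by rewrite (_ : c = c :\: seg 0) //; apply/setP => x; rewrite !inE.
have [i Pi ei] := @eq_bigmax_cond _ (fun i : 'I_N.+1 => i < 2 * cnt b i) (@nat_of_ord _)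
  (ltac:(by apply/card_gt0P; exists i0)).
have hmax s : last_cross b < s <= N -> 2 * cnt b s <= s.
  move=> /andP [ls sN]; rewrite leqNgt; apply: contraTN ls => hs.
  by rewrite -leqNgt (leq_bigmax_cond (Ordinal (sN : s < N.+1))).
have li : last_cross b = i by exact: ei.
split=> //; first by rewrite li -ltnS.
have lP : last_cross b < 2 * cnt b (last_cross b) by rewrite li; exact: Pi.
apply/eqP; rewrite eqn_leq lP andbT.
case: (ltnP (last_cross b) N) => lN.
  have := hmax (last_cross b).+1; rewrite ltnSn lN => /(_ isT).
  by have := cnt_le b (leqnSn (last_cross b)); lia.
have -> : last_cross b = N by apply/eqP; rewrite eqn_leq lN li -ltnS ltn_ord.
by rewrite cntN cardB.
Qed.

Definition rho_refl b := reflect_at (last_cross b) b.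

Lemma reflect_atK i : involutive (reflect_at i).
Proof.
move=> b; apply/setP => x; rewrite !inE.
by case: (x < i); case: (x \in b).
Qed.

(** Beyond the crossing [b] fills at most half of every initial stretch, so [spread] moves that part
    off [b]. The result agrees with [b] before the crossing and is therefore disjoint from the
    reflection. *)
Lemma rho_reflNA b : b \in B -> rho_refl b \notin A.
Proof.
move=> bB; have [lN le lt] := last_crossP bB; apply/negP => hA.
have [//||c cB [h1 h2]] := @spread b (last_cross b) bB.
  move=> s /andP []; rewrite leq_eqVlt => /orP [/eqP <-|ls] sN; first by rewrite subnn.
  by have := lt s; rewrite ls sN => /(_ isT); lia.
have := crossAB hA cB; case/negP; rewrite -setI_eq0 -subset0; apply/subsetP => x.
have /setP /(_ x) := h1; have := disjointFr h2 (x := x); rewrite !inE.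
case: (x < last_cross b) => /=; rewrite ?andbT ?andbF ?orbF ?orFb.
  by move=> _ ->; case: (x \in b).
by move=> h _ /andP [xb xc]; rewrite h // in xb.
Qed.

(** From the crossing l on, the counts of the reflection are one less than those of [b]: twice the
    count plus 1 equals l at l, and is below s at each later s. So l can be read off the reflection,
    which gives injectivity. *)
Lemma last_cross_refl b : b \in B ->
  last_cross b = \max_(i < N.+1 | i <= (2 * cnt (rho_refl b) i).+1) i.
Proof.
move=> bB; have [lN le lt] := last_crossP bB; set l := last_cross b in lN le lt *.
have cl : cnt (rho_refl b) l + cnt b l = l.
  have -> : cnt (rho_refl b) l = #|seg l :\: b|.
    apply: eq_card => x; rewrite !inE -/l.
    by case: (x < l); case: (x \in b).
  by rewrite /cnt setIC addnC cardsID card_seg.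
have cs s : l < s -> cnt (rho_refl b) s - cnt (rho_refl b) l = cnt b s - cnt b l.
  move=> ls; rewrite -!cnt_diff ?(ltnW ls) //; apply: eq_card => x; rewrite !inE -/l.
  by case: (x < l); case: (x \in b); case: (x < s).
apply/eqP; rewrite eqn_leq; apply/andP; split.
  have lN' : l < N.+1 by [].
  apply: (@leq_bigmax_cond _ _ _ (Ordinal lN')) => /=; by move: cl le; lia.
apply/bigmax_leqP => s; apply: contraTT; rewrite -!ltnNge => ls.
have sN : s <= N by rewrite -ltnS.
have := lt s; rewrite ls sN => /(_ isT).
have := cs _ ls; have := cnt_le (rho_refl b) (ltnW ls); have := cnt_le b (ltnW ls).
by move: cl le; lia.
Qed.

Lemma rho_refl_inj : {in B &, injective rho_refl}.
Proof.
move=> b b' bB b'B e; have el : last_cross b = last_cross b'.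
  by rewrite !last_cross_refl // e.
by apply: (inv_inj (reflect_atK (last_cross b))); rewrite {2}el; exact: e.
Qed.

(** Otherwise removing one element of [b] would give a member of [A] disjoint from [seg r]. *)
Lemma two_le_top b : b \in B -> 1 < #|b :&: seg r|.
Proof.
move=> bB; rewrite ltnNge; apply/negP => le1.
have [y yb hy] : exists2 y, y \in b & b :&: seg r \subset [set y].
  case: (set_0Vmem (b :&: seg r)) => [->|[y yi]].
    have [y yb] : exists y, y \in b by apply/card_gt0P; rewrite cardB.
    by exists y; rewrite // sub0set.
  exists y; first by move: yi; rewrite inE => /andP [].
  by have /eqP <- : [set y] == b :&: seg r; rewrite // eqEcard sub1set yi cards1.
have := crossAB (shadowB bB yb) topB; case/negP; rewrite -setI_eq0 -subset0.
apply/subsetP => x; rewrite inE => /andP []; rewrite !inE => /andP [xy xb] xr.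
by have := subsetP hy x; rewrite !inE xb xr (negbTE xy) => /(_ isT).
Qed.

(** A reflection missing [seg r] forces [seg r] into [b] if the crossing l is at least r. If l < r,
    then [seg l] is all that [b] has in [seg r], and 2 l = l + 1 leaves a single element, against
    [two_le_top]. *)
Lemma rho_refl_meets b : b \in B -> b != seg r -> ~~ [disjoint rho_refl b & seg r].
Proof.
move=> bB bn; apply/negP => d; have [lN le _] := last_crossP bB.
have rN' : r <= N by move: rN r0; lia.
set l := last_cross b in lN le; have dx x : x < r -> x \notin rho_refl b.
  by move=> xr; rewrite (disjointFl d) // inE.
case: (leqP r l) => rl.
  case/eqP: bn; apply/esym/eqP; rewrite eqEcard cardB // card_seg // leqnn andbT.
  apply/subsetP => x; rewrite inE => xr; have := dx x xr; rewrite !inE -/l.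
  by rewrite (leq_trans xr rl) /=; case: (x \in b).
have sb : seg l \subset b.
  apply/subsetP => x; rewrite inE => xl; have := dx x (ltn_trans xl rl).
  by rewrite !inE -/l xl /=; case: (x \in b).
have l1 : l = 1.
  by move: le; rewrite /cnt (setIidPr sb) card_seg //; lia.
have := two_le_top bB; rewrite ltnNge => /negP; apply.
have -> : 1 = #|seg l| by rewrite card_seg.
apply/subset_leq_card/subsetP => x; rewrite inE => /andP [xb]; rewrite inE => xr.
by have := dx x xr; rewrite !inE -/l xb /=; case: (x < l).
Qed.

Lemma reflection_bound : #|A| + #|B| <= #|C| + 1.
Proof.
have cBr : #|rho_refl @: (B :\ seg r)| = #|B :\ seg r|.
  rewrite card_in_imset // => b b'; rewrite !inE => /andP [_ bB] /andP [_ b'B].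
  exact: rho_refl_inj.
have sub : rho_refl @: (B :\ seg r) \subset C :\: A.
  apply/subsetP => _ /imsetP [b + ->]; rewrite !inE => /andP [bn bB].
  rewrite rho_reflNA //=; apply: reflC => //; last exact: rho_refl_meets.
  by have [_ ->] := last_crossP bB.
have := subset_leq_card sub; rewrite cBr [#|C :\: A|]cardsD (setIidPr AC).
rewrite (cardsD1 (seg r) B) topB -(leq_add2l #|A|) (subnKC (subset_leq_card AC)).
by rewrite addnCA addnC addn1.
Qed.

End Reflection.


(** * Gluing the shifted fibers *)

Section TwoBlocks.
Variables (r : nat) (T : finType).
Implicit Types (b : {set 'I_(r + #|T|)}) (X : {set 'I_r}) (Q : {set T}) (i : 'I_r) (t : T).

(** The second block is all of [T], including the image of [v]: members of a shift are sets of row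
    labels of [g], for which every element of [T] serves. *)
Definition lpos i : 'I_(r + #|T|) := lshift #|T| i.
Definition rpos t : 'I_(r + #|T|) := rshift r (enum_rank t).
Definition lpart b : {set 'I_r} := [set i | lpos i \in b].
Definition rpart b : {set T} := [set t | rpos t \in b].

Lemma lpos_inj : injective lpos.
Proof. exact: lshift_inj. Qed.

Lemma rpos_inj : injective rpos.
Proof. by move=> s t /rshift_inj /enum_rank_inj. Qed.

Lemma lpos_rpos i t : (lpos i == rpos t) = false.
Proof. exact: eq_lrshift. Qed.

Lemma rpos_lpos i t : (rpos t == lpos i) = false.
Proof. by rewrite eq_sym lpos_rpos. Qed.

Lemma posP (x : 'I_(r + #|T|)) : (exists i, x = lpos i) \/ (exists t, x = rpos t).
Proof.
case: (splitP x) => [j e|k e]; first by left; exists j; apply: val_inj.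
by right; exists (enum_val k); apply: val_inj; rewrite /= enum_valK.
Qed.

Lemma parts_inj b b' : lpart b = lpart b' -> rpart b = rpart b' -> b = b'.
Proof.
move=> /setP hl /setP hr; apply/setP => x.
by case: (posP x) => [[i ->]|[t ->]]; [have := hl i|have := hr t]; rewrite !inE.
Qed.

Lemma card_parts b : #|b| = #|lpart b| + #|rpart b|.
Proof.
rewrite -!sum1_card big_mkcond big_split_ord /=; congr (_ + _).
  by rewrite [RHS]big_mkcond; apply: eq_bigr => i _; rewrite inE.
rewrite (reindex (@enum_rank T)) /=; last by apply: onW_bij; apply: enum_rank_bij.
by rewrite [RHS]big_mkcond; apply: eq_bigr => t _; rewrite inE.
Qed.

Definition join_parts X Q := [set lpos i | i in X] :|: [set rpos t | t in Q].

Lemma lpart_join X Q : lpart (join_parts X Q) = X.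
Proof.
apply/setP => i; rewrite !inE (mem_imset _ _ lpos_inj) orbC.
by case: imsetP => // [[t _ /eqP]]; rewrite lpos_rpos.
Qed.

Lemma rpart_join X Q : rpart (join_parts X Q) = Q.
Proof.
apply/setP => t; rewrite !inE (mem_imset _ _ rpos_inj).
by case: imsetP => // [[i _ /eqP]]; rewrite rpos_lpos.
Qed.

Definition hat (F : {set 'I_r} -> {set {set T}}) : {set {set 'I_(r + #|T|)}} :=
  [set b | rpart b \in F (lpart b)].

Lemma in_hat F b : (b \in hat F) = (rpart b \in F (lpart b)).
Proof. by rewrite inE. Qed.

Lemma card_hat F : #|hat F| = \sum_X #|F X|.
Proof.
rewrite -sum1_card (partition_big lpart predT) //=; apply: eq_bigr => X _.
rewrite sum1dep_card -(card_imset (F X) (_ : injective (join_parts X))); last first.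
  by move=> Q Q' e; rewrite -(rpart_join X Q) e rpart_join.
apply: eq_card => b; rewrite !inE; apply/andP/imsetP => [[h /eqP e]|[Q QF ->]].
  exists (rpart b); first by rewrite -e.
  by apply: parts_inj; rewrite ?lpart_join ?rpart_join.
by rewrite lpart_join rpart_join.
Qed.

Lemma lpart_D1l b i : lpart (b :\ lpos i) = lpart b :\ i.
Proof. by apply/setP => j; rewrite !inE (inj_eq lpos_inj). Qed.

Lemma lpart_D1r b t : lpart (b :\ rpos t) = lpart b.
Proof. by apply/setP => j; rewrite !inE lpos_rpos. Qed.

Lemma rpart_D1l b i : rpart (b :\ lpos i) = rpart b.
Proof. by apply/setP => j; rewrite !inE rpos_lpos. Qed.

Lemma rpart_D1r b t : rpart (b :\ rpos t) = rpart b :\ t.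
Proof. by apply/setP => j; rewrite !inE (inj_eq rpos_inj). Qed.

Lemma lpart_U1l b i : lpart (lpos i |: b) = i |: lpart b.
Proof. by apply/setP => j; rewrite !inE (inj_eq lpos_inj). Qed.

Lemma lpart_U1r b t : lpart (rpos t |: b) = lpart b.
Proof. by apply/setP => j; rewrite !inE lpos_rpos. Qed.

Lemma rpart_U1l b i : rpart (lpos i |: b) = rpart b.
Proof. by apply/setP => j; rewrite !inE rpos_lpos. Qed.

Lemma rpart_U1r b t : rpart (rpos t |: b) = t |: rpart b.
Proof. by apply/setP => j; rewrite !inE (inj_eq rpos_inj). Qed.

End TwoBlocks.

Section Fibers.
Variables (T : finType) (r : nat) (v : 'I_r -> T).
Hypothesis vinj : injective v.
Implicit Types (H : {set {set T}}) (X : {set 'I_r}) (Y : {set T}).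
Notation V := [set v j | j : 'I_r].

Definition fiber H X := [set Y : {set T} | [disjoint Y & V] && ((v @: X) :|: Y \in H)].

Lemma imset_subV X : v @: X \subset V.
Proof. by apply/subsetP => _ /imsetP [i _ ->]; apply: imset_f. Qed.

Lemma disjoint_image X Y : [disjoint Y & V] -> [disjoint v @: X & Y].
Proof. by move=> dY; rewrite disjoint_sym; apply: disjointWr dY; apply: imset_subV. Qed.

Lemma card_fiber_face X Y : [disjoint Y & V] -> #|(v @: X) :|: Y| = #|X| + #|Y|.
Proof.
move=> dY; rewrite cardsU (disjoint_setI0 (disjoint_image X dY)) cards0 subn0.
by rewrite card_imset.
Qed.

Lemma sum_card_fiber H : \sum_X #|fiber H X| = #|H|.
Proof.
rewrite -[RHS]sum1_card [RHS](partition_big (fun b : {set T} => v @^-1: b) predT) //=.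
apply: eq_bigr => X _; rewrite sum1dep_card.
have vY Y : [disjoint Y & V] -> forall i, v i \notin Y.
  by move=> dY i; rewrite (disjointFl dY) // imset_f.
rewrite -(@card_in_imset _ _ (fun Y => (v @: X) :|: Y) (fiber H X)).
  apply: eq_card => b; rewrite !inE; apply/imsetP/andP => [[Y]|[bH /eqP <-]].
    rewrite inE => /andP [dY h] ->; split=> //; apply/eqP/setP => i.
    by rewrite !inE (mem_imset _ _ vinj) (negbTE (vY _ dY i)) orbF.
  have e : v @: (v @^-1: b) :|: b :\: V = b.
    apply/setP => a; rewrite !inE; case: (boolP (a \in V)) => [/imsetP [i _ ->]|aV] /=.
      by rewrite (mem_imset _ _ vinj) inE orbF.
    case: imsetP => // [[i _ ea]]; by rewrite ea imset_f in aV.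
  exists (b :\: V); last by rewrite e.
  by rewrite inE e bH -setI_eq0 setIDAC setDIl setDv setI0 eqxx.
move=> Y Y'; rewrite !inE => /andP [dY _] /andP [dY' _] /setP e; apply/setP => a.
have := e a; rewrite !inE; case: imsetP => // [[i _ ->]] _.
by rewrite !(negbTE (vY _ _ i)).
Qed.

Lemma fiberS H H' X : H \subset H' -> fiber H X \subset fiber H' X.
Proof. by move=> /subsetP h; apply/subsetP => Y; rewrite !inE => /andP [-> /h]. Qed.

End Fibers.


(** * The shifted families satisfy the hypotheses of the reflection *)

Section ShiftedFamilies.
Variables (T : finType) (F : fieldType) (D : {set {set T}}) (d r : nat) (v : 'I_r -> T).
Variables (A B : {set {set T}}).
Implicit Types (X : {set 'I_r}) (Y Z Q : {set T}) (b : {set 'I_(r + #|T|)}).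
Hypotheses (dD : down_closed D) (D0 : D != set0) (depthD : depth_is F D d).
Hypotheses (r2 : 2 <= r) (rd : 2 * r <= d + 1).
Hypotheses (vinj : injective v) (shD : shifted D v).
Hypotheses (hA : faces_of_size D r.-1 A) (hB : faces_of_size D r B) (B0 : B != set0).
Hypotheses (hAB : cross_intersecting A B).
Hypothesis hsh : forall (b : {set T}) y, b \in B -> y \in b -> b :\ y \in A.
Hypothesis sB : shifted B v.

Notation V := [set v j | j : 'I_r].
Notation G := (skel D d).
Notation S := (link (skel D d) V).

Let dG : down_closed G.
Proof.
move=> Y Z; rewrite !inE => /andP [YD Yd] ZY; rewrite (dD YD ZY) /=.
exact: leq_trans (subset_leq_card ZY) Yd.
Qed.

Let Gd Y : Y \in G -> #|Y| <= d.
Proof. by rewrite inE => /andP []. Qed.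

Lemma exists_d_face : exists2 Z, Z \in G & #|Z| = d.
Proof.
have [dmax _ _] := depthD; have [Z0 Z0D] := set0Pn _ D0.
have [|Z ZD eZ] := @eq_bigmax_cond _ (mem D) (fun Y : {set T} => #|Y|).
  by apply/card_gt0P; exists Z0.
have : d <= #|Z| by rewrite -[#|Z|]eZ.
case/card_geqP => s [us ss sZ]; exists [set x in s]; last by rewrite cardsE (card_uniqP us).
rewrite inE cardsE (card_uniqP us) ss leqnn andbT; apply: dD ZD _.
by apply/subsetP => x; rewrite inE => /sZ.
Qed.

Lemma d_le_card : d <= #|T|.
Proof. by have [Z _ <-] := exists_d_face; apply: max_card. Qed.

Let cmG : cohen_macaulay F G.
Proof. by case: depthD. Qed.

(** Purity puts [Y] inside a d-face, and |Y| + r <= 2 r - 1 <= d is the room that [shifted_extend]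
    asks for. *)
Lemma face_union_V Y : Y \in D -> #|Y| <= r.-1 -> Y :|: V \in D.
Proof.
move=> YD Yr; have [Z0 Z0G Z0d] := exists_d_face.
have YG : Y \in G by rewrite inE YD /=; move: Yr r2 rd; lia.
have /exists_inP [Z + /andP [YZ /eqP Zd]] := cm_pure dG cmG Gd Z0G Z0d YG.
rewrite inE => /andP [ZD _]; apply: shifted_extend YZ ZD _ => //.
by rewrite Zd; move: Yr r2 rd; lia.
Qed.

Lemma V_face : V \in G.
Proof.
have [Z0 Z0D] := set0Pn _ D0; have e0 : set0 \in D by apply: dD Z0D (sub0set _).
have := face_union_V e0; rewrite set0U cards0 inE card_V // => -> //.
by move: r2 rd; lia.
Qed.

Lemma in_linkV Y : #|Y| <= r.-1 -> (Y \in S) = (Y \in D) && [disjoint Y & V].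
Proof.
move=> Yr; rewrite in_link disjoint_sym; apply/and3P/andP => [[]|[YD dY]].
  by rewrite inE => /andP [].
have YVD : V :|: Y \in D by rewrite setUC face_union_V.
have Vd : #|V| + #|Y| <= d by rewrite card_V //; move: Yr r2 rd; lia.
rewrite !inE YD YVD dY /=; split=> //; first by apply: leq_trans Vd; rewrite leq_addl.
by apply: leq_trans Vd; apply: leq_card_setU.
Qed.

Lemma linkV_union Y X : Y \in S -> v @: X :|: Y \in D.
Proof.
rewrite in_link => /and3P [_ _]; rewrite inE => /andP [VYD _].
by apply: dD VYD _; apply: setSU; apply: imset_subV.
Qed.

Notation faces := [set Y in D | #|Y| == r.-1].

(** Small faces avoiding V can be joined to all of V, so all these fibers are levels of the one
    complex link V; reflected sets may thus land over another X. *)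
Lemma fiber_faces X k : #|X| + k = r.-1 -> fiber v faces X = level S k.
Proof.
move=> Xk; apply/setP => Y; rewrite [LHS]in_set [_ :|: _ \in _]in_set [RHS]in_set.
case: (boolP [disjoint Y & V]) => dY /=; last first.
  apply/esym/negP => /andP [YS /eqP Yk]; case/negP: dY.
  by have := in_linkV (Y := Y); rewrite YS Yk => /(_ ltac:(lia)) /esym /andP [].
rewrite card_fiber_face // -Xk eqn_add2l.
case: (eqVneq #|Y| k) => Yk; rewrite ?andbF // !andbT.
rewrite in_linkV; last by rewrite Yk -Xk leq_addl.
rewrite dY andbT; apply/idP/idP => [|YD]; first by move/dD; apply; apply: subsetUr.
by apply: linkV_union; rewrite in_linkV ?YD // Yk -Xk leq_addl.
Qed.

Lemma V_in_B : V \in B.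
Proof. exact (shifted_family_top vinj B0 sB hB). Qed.

Lemma fiberA0 : fiber v A set0 = set0.
Proof.
apply/setP => Y; rewrite !inE imset0 set0U; apply/negP => /andP [dY YA].
by have := hAB YA V_in_B; rewrite setI_eq0 dY.
Qed.

Lemma fiberB0 : fiber v B set0 = set0.
Proof.
apply/setP => Y; rewrite !inE imset0 set0U; apply/negP => /andP [dY YB].
have [y yY] : exists y, y \in Y.
  by apply/card_gt0P; have /andP [_ /eqP ->] := hB YB; apply: ltnW.
have := hAB (hsh YB yY) V_in_B; rewrite setI_eq0 => /negP; apply.
exact: disjointWl (subD1set _ _) dY.
Qed.

Lemma fiberB_level X : fiber v B X \subset level S (r - #|X|).
Proof.
case: (set_0Vmem X) => [->|[i iX]]; first by rewrite fiberB0 sub0set.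
have X0 : 0 < #|X| by apply/card_gt0P; exists i.
apply/subsetP => Y; rewrite inE => /andP [dY /hB /andP [YD]].
rewrite card_fiber_face // => /eqP XY; rewrite in_set (_ : #|Y| == _) ?andbT; last first.
  have Xr : #|X| <= r by apply: leq_trans (leq_addr #|Y| _) _; rewrite XY.
  by rewrite -(eqn_add2l #|X|) XY subnKC.
rewrite in_linkV ?dY ?andbT; last by move: XY X0; lia.
by apply: dD YD _; apply: subsetUr.
Qed.

Lemma fiberA_faces X : fiber v A X \subset fiber v faces X.
Proof. by apply: fiberS; apply/subsetP => Y /hA; rewrite inE. Qed.

Section Assembly.
Variables (K : closedFieldType) (al : T -> K) (g : T -> {ffun T -> K^o}).
Hypotheses (FK : same_char F K) (al_inj : injective al) (gg : generic g).

Let dS : down_closed S.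
Proof. exact: link_down. Qed.

Let cS : coCM K S (d - r).
Proof.
have [Z0 Z0G Z0d] := exists_d_face.
by have := coCM_link_face dG cmG Gd FK Z0G Z0d V_face; rewrite card_V.
Qed.

Definition hatA := hat (fun X => sh g (fiber v A X)).
Definition hatB := hat (fun X => sh g (fiber v B X)).
(** Dropping the fiber over the empty set is what produces gamma; [hatA] stays inside by
    [fiberA0]. *)
Definition hatC := hat (fun X => if X == set0 then set0 else sh g (fiber v faces X)).

Lemma card_hat_sh H : #|hat (fun X => sh g (fiber v H X))| = #|H|.
Proof.
by rewrite card_hat -(sum_card_fiber vinj H); apply: eq_bigr => X _; rewrite sh_card.
Qed.

Lemma card_hatC : #|hatC| = #|faces| - #|fiber v faces set0|.
Proof.
rewrite card_hat -(sum_card_fiber vinj faces) (bigD1 set0) //= [in RHS](bigD1 set0) //=.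
rewrite eqxx cards0 addKn; apply: eq_bigr => X /negbTE ->; exact: sh_card.
Qed.

Lemma card_hatB b : b \in hatB -> #|b| = r.
Proof.
rewrite in_hat => /sh_card_eq [Y]; rewrite inE => /andP [dY YB] e.
have /andP [_ /eqP] := hB YB; rewrite card_fiber_face // => cY.
by rewrite card_parts -e.
Qed.

Lemma hatA_sub : hatA \subset hatC.
Proof.
apply/subsetP => b; rewrite !in_hat; case: eqP => [->|_].
  by move/sh_card_eq => [Y]; rewrite fiberA0 inE.
exact: (subsetP (sh_mono g (fiberA_faces _))).
Qed.

Lemma fiberB_shift_VV X (i q : 'I_r) : q \in X -> i \notin X -> i < q ->
  fiber v B X \subset fiber v B (i |: X :\ q).
Proof.
move=> qX iX iq; apply/subsetP => Y; rewrite !inE => /andP [dY YB]; rewrite dY /=.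
have vY j : v j \notin Y by rewrite (disjointFl dY) // imset_f.
have vX (j : 'I_r) X' : (v j \in v @: X') = (j \in X') by apply: mem_imset.
have h1 : v q \in v @: X :|: Y by rewrite in_setU vX qX.
have h2 : v q \notin [set v j | j : 'I_r & j <= i] by rewrite vX inE -ltnNge.
have h3 : v i \notin v @: X :|: Y by rewrite in_setU vX (negbTE iX) (negbTE (vY i)).
have := sB YB h1 h2 h3.
suff -> : (v @: X :|: Y) :\ v q :|: [set v i] = v @: (i |: X :\ q) :|: Y by [].
apply/setP => a; rewrite !inE; case: (boolP (a \in V)) => [/imsetP [j _ ->]|aV].
  rewrite !vX !inE !(inj_eq vinj) (negbTE (vY j)) !orbF.
  by rewrite orbC.
have nv j : (a == v j) = false by apply: contraNF aV => /eqP ->; apply: imset_f.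
have nX X' : (a \in v @: X') = false by apply: contraNF aV; apply/subsetP/imset_subV.
by rewrite !nX !nv orbF.
Qed.

Lemma fiberB_shift_VT X (i : 'I_r) Y a : i \notin X -> Y \in fiber v B X -> a \in Y ->
  Y :\ a \in fiber v B (i |: X).
Proof.
move=> iX; rewrite !inE => /andP [dY YB] aY.
have aV : a \notin V by rewrite (disjointFr dY).
have vY j : v j \notin Y by rewrite (disjointFl dY) // imset_f.
rewrite (disjointWl (subD1set _ _) dY) /=.
have h1 : a \in v @: X :|: Y by rewrite in_setU aY orbT.
have h2 : a \notin [set v j | j : 'I_r & j <= i].
  by apply: contra aV => /imsetP [j _ ->]; apply: imset_f.
have h3 : v i \notin v @: X :|: Y.
  by rewrite in_setU (mem_imset _ _ vinj) (negbTE iX) (negbTE (vY i)).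
have := sB YB h1 h2 h3.
suff -> : (v @: X :|: Y) :\ a :|: [set v i] = v @: (i |: X) :|: Y :\ a by [].
rewrite imsetU1; apply/setP => c; rewrite !inE.
case: (eqVneq c a) => [->|] /=; last by rewrite orbC orbA.
have -> : (a == v i) = false by apply: contraNF aV => /eqP ->; apply: imset_f.
by rewrite orbF; apply/esym/negP => /(subsetP (imset_subV _ _)); rewrite (negbTE aV).
Qed.

(** Exchanges inside the first block come from shiftedness of [B] and [sh_mono], inside the second
    from genericity, and from the second to the first from shiftedness and [sh_shadow]. The
    remaining direction would increase the position. *)
Lemma hatB_shift b x y : b \in hatB -> x \in b -> y \notin b -> y < x ->
  y |: (b :\ x) \in hatB.
Proof.
rewrite !in_hat; case: (posP x) => [[q ->]|[q ->]]; case: (posP y) => [[i ->]|[i ->]] bB qb ib lt.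
- rewrite lpart_U1l rpart_U1l lpart_D1l rpart_D1l.
  by apply: (subsetP (sh_mono g (fiberB_shift_VV _ _ _))) bB; rewrite ?inE.
- by move: lt; rewrite /= ltnNge (leq_trans (ltnW (ltn_ord q))) ?leq_addr.
- rewrite lpart_U1l rpart_U1l lpart_D1r rpart_D1r.
  apply: sh_shadow bB _; last by rewrite inE.
  by move=> Y a; apply: fiberB_shift_VT; rewrite inE.
- rewrite lpart_U1r rpart_U1r lpart_D1r rpart_D1r.
  apply: sh_shift => //; rewrite ?inE //.
  by move: lt; rewrite /= ltn_add2l.
Qed.

Lemma hat_cross a b : a \in hatA -> b \in hatB -> ~~ [disjoint a & b].
Proof.
rewrite !in_hat => aA bB; apply/negP => dab.
have dl : [disjoint lpart a & lpart b].
  apply/pred0P => i /=; rewrite !inE; case: (boolP (lpos T i \in a)) => //= h.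
  by rewrite (disjointFr dab h).
have : ~~ [disjoint rpart a & rpart b].
  apply: sh_cross aA bB => Y Z; rewrite !inE => /andP [dY YA] /andP [dZ ZB].
  apply/negP => dYZ; have := hAB YA ZB; rewrite setI_eq0 => /negP; apply.
  rewrite -setI_eq0 setIUl !setIUr !setU_eq0 !setI_eq0 dYZ andbT.
  rewrite (disjoint_image _ dZ) [X in _ && X]disjoint_sym (disjoint_image _ dY) !andbT -setI_eq0.
  by rewrite -imsetI ?(disjoint_setI0 dl) ?imset0 // => x y _ _; apply: vinj.
case/pred0Pn => t /=; rewrite !inE => /andP [ta tb].
by rewrite (disjointFr dab ta) in tb.
Qed.

Lemma hat_shadow b y : b \in hatB -> y \in b -> b :\ y \in hatA.
Proof.
rewrite !in_hat; case: (posP y) => [[i ->]|[t ->]] bB yb.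
  rewrite lpart_D1l rpart_D1l; apply: (subsetP (sh_mono g _)) bB.
  apply/subsetP => Y; rewrite !inE => /andP [dY YB]; rewrite dY /=.
  have vY : v i \notin Y by rewrite (disjointFl dY) // imset_f.
  have := hsh (y := v i) YB; rewrite !inE (mem_imset _ _ vinj) inE yb => /(_ isT).
  suff -> : (v @: lpart b :|: Y) :\ v i = v @: (lpart b :\ i) :|: Y by [].
  have -> : v @: (lpart b :\ i) = v @: lpart b :\ v i.
    apply/setP => a; rewrite !inE; apply/imsetP/andP => [[j + ->]|[ai /imsetP [j jX e]]].
      by rewrite !inE => /andP [ji jb]; rewrite (inj_eq vinj) ji imset_f // inE.
    by exists j; rewrite // in_setD1 jX andbT; apply: contraNneq ai => <-; rewrite e.
  by rewrite setDUl [Y :\ _](setDidPl _) // disjoint_sym disjoints1.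
rewrite lpart_D1r rpart_D1r; apply: sh_shadow bB _; last by rewrite inE.
move=> Y a; rewrite !inE => /andP [dY YB] aY.
rewrite (disjointWl (subD1set _ _) dY) /=.
have := hsh (y := a) YB; rewrite !inE aY orbT => /(_ isT).
suff -> : (v @: lpart b :|: Y) :\ a = v @: lpart b :|: Y :\ a by [].
rewrite setDUl; congr (_ :|: _); apply/setDidPl.
rewrite disjoint_sym disjoints1.
by apply/negP => aX; move: aY; rewrite (disjointFr (disjoint_image _ dY) aX).
Qed.

Lemma seg_hatB : seg (r + #|T|) r \in hatB.
Proof.
have eV : v @: [set: 'I_r] = V.
  by apply/setP => a; apply/imsetP/imsetP => -[j _ ->]; exists j; rewrite ?inE.
have fT : fiber v B setT = [set set0].
  apply/setP => Y; rewrite !inE; apply/andP/eqP => [[dY YB]|->].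
    have /andP [_] := hB YB; rewrite card_fiber_face // cardsT card_ord.
    by rewrite -{2}[r]addn0 eqn_add2l cards_eq0 => /eqP.
  by rewrite setU0 eV V_in_B -setI_eq0 set0I.
have lT : lpart (seg (r + #|T|) r) = setT.
  by apply/setP => i; rewrite !inE /= ltn_ord.
have r0 : rpart (seg (r + #|T|) r) = set0.
  by apply/setP => t; rewrite !inE /= ltnNge leq_addr.
rewrite in_hat lT r0 fT.
have /card_gt0P [Q QS] : 0 < #|sh g [set set0 : {set T}]| by rewrite sh_card // cards1.
have [Y] := sh_card_eq QS; rewrite inE => /eqP ->; rewrite cards0 => /esym /eqP.
by rewrite cards_eq0 => /eqP e; rewrite e in QS.
Qed.

Lemma hat_reflect b i : b \in hatB -> 2 * cnt b i = i.+1 ->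
  ~~ [disjoint reflect_at i b & seg (r + #|T|) r] -> reflect_at i b \in hatC.
Proof.
move=> bB ci; have br := card_hatB bB; have dT := d_le_card.
have cle : cnt b i <= r by have := subset_leq_card (subsetIl b (seg _ i)); rewrite br.
have iN : i <= r + #|T| by move: ci cle rd dT; lia.
set c := reflect_at i b => hc; have cX : lpart c != set0.
  case/pred0Pn: hc => x /= /andP [xc]; rewrite inE => xr; apply/set0Pn.
  case: (posP x) xc xr => [[j ->]|[t ->]] xc; first by exists j; rewrite inE.
  by rewrite /= ltnNge leq_addr.
have cc : #|lpart c| + #|rpart c| = r.-1.
  rewrite -card_parts /c /reflect_at cardsU.
  rewrite (_ : _ :&: _ = set0) ?cards0 ?subn0; last first.
    by apply/setP => x; rewrite !inE; case: (x < i); rewrite ?andbF.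
  rewrite !cardsD [_ :&: b]setIC -/(cnt b i) card_seg // br.
  by move: ci cle; lia.
rewrite in_hat (negbTE cX) (fiber_faces cc).
have bL : rpart b \in sh g (level S (r - #|lpart b|)).
  by move: bB; rewrite in_hat; apply: (subsetP (sh_mono g (fiberB_level _))).
case: (leqP i r) => ir.
  have -> : rpart c = rpart b.
    apply/setP => t; rewrite !inE /=.
    by rewrite ltnNge (leq_trans ir (leq_addr _ _)) /= andbF.
  exact (sh_level_sub dS bL (subxx _)).
pose p := i - r; pose Q := rpart b.
have pT : p <= #|T| by rewrite /p leq_subLR.
have jle : #|Q :\: initseg T p| <= r - cnt b i.
  apply: (@leq_trans (#|b| - cnt b i)); last by rewrite br.
  rewrite -cardsD -(card_imset _ (@rpos_inj r T)).
  apply/subset_leq_card/subsetP => _ /imsetP [t + ->]; rewrite !inE /= => /andP [tp ->].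
  by rewrite andbT; move: tp; rewrite -!leqNgt /p leq_subLR.
(* The left side is at most (r - cnt b i) + (i - r) = cnt b i - 1, because 2 cnt b i = i + 1; then
   cnt b i - 1 <= r - 1 <= d - r. *)
have hj : #|Q :\: initseg T p| + p <= d - r.
  by move: jle ci cle ir rd r2; rewrite /p; lia.
have QjS := sh_level_sub dS bL (subsetDl Q (initseg T p)).
have dQ : [disjoint Q :\: initseg T p & initseg T p].
  by rewrite -setI_eq0 setIDAC setDIl setDv setI0.
have hS := sh_add_initseg al_inj dS cS gg pT hj QjS dQ.
(* The reflection keeps from [initseg T p] only the labels outside [Q], so it is a subset of the
   union just obtained. *)
apply: (sh_level_sub dS hS).
apply/subsetP => t; rewrite !inE /= -/(rk t).
have -> : (r + rk t < i) = (rk t < p) by rewrite /p ltn_subRL.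
by case: (rk t < p); case: (rpos r t \in b).
Qed.

Lemma bound_assembly : #|A| + #|B| <= #|faces| - #|fiber v faces set0| + 1.
Proof.
rewrite -(card_hat_sh A) -(card_hat_sh B) -card_hatC.
have dT := d_le_card.
apply: (@reflection_bound (r + #|T|) r hatA hatB hatC).
- by move: rd dT; lia.
- exact: ltnW.
- exact: card_hatB.
- by move=> b x y; apply: hatB_shift.
- exact: hat_cross.
- exact: hat_shadow.
- exact: hatA_sub.
- exact: seg_hatB.
- exact: hat_reflect.
Qed.

End Assembly.

End ShiftedFamilies.


Lemma exists_injection (T : finType) (K : closedFieldType) : exists al : T -> K, injective al.
Proof.
have [s [us ss]] : exists s : seq K, uniq s /\ size s = #|T|.
  elim: #|T| => [|n [s [us ss]]]; first by exists [::].
  have [a ha] : exists a, (\prod_(z <- s) ('X - z%:P))%R.[a]%R != 0%R.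
    by apply: nonroot; apply: monic_neq0; apply: monic_prod_XsubC.
  exists (a :: s); rewrite /= us ss andbT; split=> //.
  by move: ha; rewrite -[_ == _]/(root _ a) root_prod_XsubC.
exists (fun t => nth 0%R s (rk t)) => t u /eqP.
by rewrite nth_uniq ?ss ?rk_lt // => /eqP /rk_inj.
Qed.

Theorem theorem1p7 (T : finType) (F : fieldType) (D : {set {set T}}) (d r : nat)
  (A B : {set {set T}}) (v : 'I_r -> T) :
  simplicial_complex D ->
  depth_is F D d ->
  (2 <= r)%N -> (2 * r <= d + 1)%N ->
  A != set0 -> B != set0 ->
  (forall a, a \in A -> (a \in D) && (#|a| == r.-1)) ->
  (forall b, b \in B -> (b \in D) && (#|b| == r)) ->
  cross_intersecting A B ->
  shadow r B \subset A ->
  injective v ->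
  shifted D v ->
  (#|A| + #|B| <=
     fnum D r.-1 - #|[set S in D | (#|S| == r.-1) && [disjoint S & [set v j | j : 'I_r]]]| + 1)%N.
Proof.
move=> [D0 dD] depthD r2 rd _ B0 hA hB hAB /subsetP hsh vinj shD.
have shB b y : b \in B -> y \in b -> b :\ y \in A.
  move=> bB yb; apply: hsh; rewrite inE.
  have /andP [_ /eqP br] := hB b bB; move: br; rewrite (cardsD1 y b) yb => <-.
  rewrite eqxx; apply/exists_inP; exists b => //; exact: subD1set.
have [A' [B' [hA' hB' hAB' [shB' sB' <- cB]]]] := exists_compressed vinj shD hA hB hAB shB.
have B'0 : B' != set0 by rewrite -card_gt0 cB card_gt0.
have [K FK] := exists_closed_field F.
have [g gg] := exists_generic T K.
have [al al_inj] := exists_injection T K.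
rewrite -cB; apply: leq_trans (bound_assembly dD D0 depthD r2 rd vinj shD hA' hB' B'0 hAB'
  shB' sB' FK al_inj gg) _.
rewrite leq_add2r /fnum leq_sub2l // subset_leq_card //; apply/subsetP => Y.
by rewrite !inE imset0 set0U => /and3P [-> -> ->].
Qed.
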